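(* Suppose that $(X^n,g^+)$ is asymptotically hyperbolic of $C^2$ regularity and that $x$ is a defining function. Assume $$\mathrm{Ric}[g^+]\ge-(n-1)g^+\quad\text{and}\quad R[g^+]+n(n-1)=o(x)\ \text{ as } x\to0.$$ Then there is a constant $C_0$ such that $$|K[g^+]+1|\le C_0x^2$$ for every sectional curvature $K[g^+]$ at every point of $X$.
   Context: Let $\overline{X^n}$ be a smooth compact manifold with boundary $\partial X$ and interior $X^n$. A smooth defining function is a smooth $x\ge0$ on $\overline{X}$ with $x>0$ in $X$, and $x=0$, $dx\ne0$ on $\partial X$. A Riemannian metric $g^+$ on $X$ is conformally compact of $C^k$ regularity if, for a smooth defining function $x$, $x^2g^+$ extends to a $C^k$ Riemannian metric on $\overline X$; it is asymptotically hyperbolic (AH) of $C^k$ regularity if in addition $|dx|^2_{x^2g^+}=1$ on $\partial X$. $R[g^+]$ is the scalar curvature. *)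

(* Defs.v *)
From HB Require Import structures.
From mathcomp Require Import all_boot all_order all_algebra.
From mathcomp Require Import all_classical all_reals all_analysis.
Set Implicit Arguments.
Unset Strict Implicit.
Unset Printing Implicit Defensive.
Import Order.TTheory GRing.Theory Num.Theory.
Import numFieldNormedType.Exports.
Local Open Scope classical_set_scope.
Local Open Scope ring_scope.

Definition evec (R : realType) (n : nat) (a : 'I_n) : 'rV[R]_n := delta_mx 0 a.

(* {p in R^n | 0 <= p_0}. The condition "val a = 0" selects the first
   coordinate without requiring n to be of the form n'.+1. *)
Definition half_space (R : realType) (n : nat) : set 'rV[R]_n :=
  [set p | forall a : 'I_n, val a = 0%N -> 0 <= p 0 a].

Fixpoint C_open (R : realType) (n k : nat) (U : set 'rV[R]_n)
    (F : 'rV[R]_n -> R) : Prop :=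
  (forall p, U p -> {for p, continuous F}) /\
  match k with
  | 0%N => True
  | k'.+1 => forall a : 'I_n,
      (forall p, U p -> derivable F p (evec R a)) /\
      C_open k' U (fun p => 'D_(evec R a) F p)
  end.

(* On a set that need not be open, regularity means that the function extends,
   near each point of the set, to a function of that regularity on an open
   set of R^n. *)
Definition C_on (R : realType) (n k : nat) (S : set 'rV[R]_n)
    (f : 'rV[R]_n -> R) : Prop :=
  forall p, S p -> exists (U : set 'rV[R]_n) (F : 'rV[R]_n -> R),
    [/\ open U, U p, C_open k U F & forall q, S q -> U q -> F q = f q].

Definition smooth_on (R : realType) (n : nat) (S : set 'rV[R]_n)
    (f : 'rV[R]_n -> R) : Prop :=
  forall p, S p -> exists (U : set 'rV[R]_n) (F : 'rV[R]_n -> R),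
    [/\ open U, U p, forall k, C_open k U F &
        forall q, S q -> U q -> F q = f q].

(* The half-space is stable under p |-> p + h e_a for h > 0, so this quotient
   only uses values of f on relatively open subsets of the half-space, also at
   boundary points; it is the a-th partial derivative of f as soon as f is
   C^1 in the sense of C_on. *)
Definition partial_right (R : realType) (n : nat) (a : 'I_n)
    (f : 'rV[R]_n -> R) (p : 'rV[R]_n) : R :=
  lim (h^-1 * (f (p + h *: evec R a) - f p) @[h --> 0^'+]).

(* Values of cmap outside cdom and of cinv outside the image of cdom are
   irrelevant. *)
Record smooth_atlas (R : realType) (n : nat) (M : topologicalType) := SmoothAtlas {
  cindex : Type;
  cdom : cindex -> set M;
  cmap : cindex -> M -> 'rV[R]_n;
  cinv : cindex -> 'rV[R]_n -> M;
  cdom_open : forall i, open (cdom i);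
  cdom_cover : forall m, exists i, cdom i m;
  cimage_open : forall i, exists O : set 'rV[R]_n,
    open O /\ cmap i @` cdom i = O `&` @half_space R n;
  cmapK : forall i m, cdom i m -> cinv i (cmap i m) = m;
  cmap_continuous : forall i, {within cdom i, continuous (cmap i)};
  cinv_continuous : forall i, {within cmap i @` cdom i, continuous (cinv i)};
  ctransition_smooth : forall i j (a : 'I_n),
    smooth_on (cmap i @` (cdom i `&` cdom j)) (fun p => cmap j (cinv i p) 0 a)
}.

Definition boundary (R : realType) (n : nat) (M : topologicalType)
    (A : smooth_atlas R n M) : set M :=
  [set m | exists (i : cindex A) (a : 'I_n),
    [/\ cdom i m, val a = 0%N & cmap i m 0 a = 0]].

Definition mfd_interior (R : realType) (n : nat) (M : topologicalType)
    (A : smooth_atlas R n M) : set M := ~` boundary A.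

Definition smooth_fun (R : realType) (n : nat) (M : topologicalType)
    (A : smooth_atlas R n M) (f : M -> R) : Prop :=
  forall i : cindex A, smooth_on (cmap i @` cdom i) (fun p => f (cinv i p)).

Definition differential (R : realType) (n : nat) (M : topologicalType)
    (A : smooth_atlas R n M) (f : M -> R) (i : cindex A) (m : M) : 'rV[R]_n :=
  \row_a partial_right a (fun p => f (cinv i p)) (cmap i m).

Definition defining_function (R : realType) (n : nat) (M : topologicalType)
    (A : smooth_atlas R n M) (x : M -> R) : Prop :=
  [/\ smooth_fun A x,
      forall m, mfd_interior A m -> 0 < x m,
      forall m, boundary A m -> x m = 0 &
      forall m (i : cindex A), boundary A m -> cdom i m ->
        differential x i m != 0].

Definition transition_jacobian (R : realType) (n : nat) (M : topologicalType)
    (A : smooth_atlas R n M) (i j : cindex A) (m : M) : 'M[R]_n :=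
  \matrix_(a, b)
    partial_right b (fun p => cmap j (cinv i p) 0 a) (cmap i m).

Definition bilin (R : realType) (n : nat) (G : 'M[R]_n) (u v : 'rV[R]_n) : R :=
  (u *m G *m v^T) 0 0.

(* A field of bilinear forms is given by its component matrices: g i m is the
   matrix of the form on T_m M in the coordinate basis of the chart i, which is
   meaningful when m is in cdom i; the last clause is the transformation law
   between charts. *)
Definition riemannian_metric (R : realType) (n : nat) (M : topologicalType)
    (A : smooth_atlas R n M) (k : nat) (S : set M)
    (g : cindex A -> M -> 'M[R]_n) : Prop :=
  [/\ forall (i : cindex A) (a b : 'I_n),
        C_on k (cmap i @` (cdom i `&` S)) (fun p => g i (cinv i p) a b),
      forall i m, S m -> cdom i m -> (g i m)^T = g i m,
      forall i m, S m -> cdom i m ->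
        forall v : 'rV[R]_n, v != 0 -> 0 < bilin (g i m) v v &
      forall i j m, S m -> cdom i m -> cdom j m ->
        g i m = (transition_jacobian i j m)^T *m g j m
                *m transition_jacobian i j m].

Definition compactification (R : realType) (n : nat) (M : topologicalType)
    (A : smooth_atlas R n M) (k : nat) (g : cindex A -> M -> 'M[R]_n)
    (x : M -> R) (gbar : cindex A -> M -> 'M[R]_n) : Prop :=
  [/\ defining_function A x,
      riemannian_metric k setT gbar &
      forall i m, mfd_interior A m -> cdom i m ->
        gbar i m = (x m ^+ 2) *: g i m].

Definition asymptotically_hyperbolic (R : realType) (n : nat)
    (M : topologicalType) (A : smooth_atlas R n M) (k : nat)
    (g : cindex A -> M -> 'M[R]_n) : Prop :=
  exists x gbar, compactification k g x gbar /\
    forall i m, boundary A m -> cdom i m ->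
      bilin (invmx (gbar i m)) (differential x i m) (differential x i m) = 1.

(* Curvature of a metric G on an open set of R^n, with
     christoffel G c a b = Gamma^c_{ab},
     riemann G d c a b = R^d_{cab},  R(e_a, e_b) e_c = sum_d R^d_{cab} e_d,
     R(X, Y) Z = nabla_X nabla_Y Z - nabla_Y nabla_X Z - nabla_[X, Y] Z. *)
Definition christoffel (R : realType) (n : nat) (G : 'rV[R]_n -> 'M[R]_n)
    (c a b : 'I_n) (p : 'rV[R]_n) : R :=
  2^-1 * \sum_(d < n) invmx (G p) c d *
    ('D_(evec R a) (fun q => G q b d) p + 'D_(evec R b) (fun q => G q a d) p
     - 'D_(evec R d) (fun q => G q a b) p).

Definition riemann (R : realType) (n : nat) (G : 'rV[R]_n -> 'M[R]_n)
    (d c a b : 'I_n) (p : 'rV[R]_n) : R :=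
  'D_(evec R a) (christoffel G d b c) p - 'D_(evec R b) (christoffel G d a c) p
  + \sum_(e < n) (christoffel G d a e p * christoffel G e b c p
                  - christoffel G d b e p * christoffel G e a c p).

(* Ric(Y, Z) is the trace of X |-> R(X, Y) Z. *)
Definition ricci (R : realType) (n : nat) (G : 'rV[R]_n -> 'M[R]_n)
    (p : 'rV[R]_n) : 'M[R]_n :=
  \matrix_(b, c) \sum_(a < n) riemann G a c a b p.

Definition scalar_curvature (R : realType) (n : nat) (G : 'rV[R]_n -> 'M[R]_n)
    (p : 'rV[R]_n) : R :=
  \sum_(b < n) \sum_(c < n) invmx (G p) b c * ricci G p b c.

(* The vector R(u, v) w. *)
Definition curvature_vec (R : realType) (n : nat) (G : 'rV[R]_n -> 'M[R]_n)
    (p u v w : 'rV[R]_n) : 'rV[R]_n :=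
  \row_d \sum_(a < n) \sum_(b < n) \sum_(c < n)
    u 0 a * v 0 b * w 0 c * riemann G d c a b p.

Definition sectional_curvature (R : realType) (n : nat)
    (G : 'rV[R]_n -> 'M[R]_n) (p u v : 'rV[R]_n) : R :=
  bilin (G p) (curvature_vec G p u v v) u /
  (bilin (G p) u u * bilin (G p) v v - bilin (G p) u v ^+ 2).

Definition chart_metric (R : realType) (n : nat) (M : topologicalType)
    (A : smooth_atlas R n M) (g : cindex A -> M -> 'M[R]_n) (i : cindex A) :
    'rV[R]_n -> 'M[R]_n :=
  fun p => g i (cinv i p).

Definition ricci_at (R : realType) (n : nat) (M : topologicalType)
    (A : smooth_atlas R n M) (g : cindex A -> M -> 'M[R]_n) (i : cindex A)
    (m : M) : 'M[R]_n :=
  ricci (chart_metric g i) (cmap i m).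

Definition scalar_curvature_at (R : realType) (n : nat) (M : topologicalType)
    (A : smooth_atlas R n M) (g : cindex A -> M -> 'M[R]_n) (i : cindex A)
    (m : M) : R :=
  scalar_curvature (chart_metric g i) (cmap i m).

(* The plane in T_m M spanned by the vectors with components u and v in the
   chart i. *)
Definition sectional_curvature_at (R : realType) (n : nat)
    (M : topologicalType) (A : smooth_atlas R n M)
    (g : cindex A -> M -> 'M[R]_n) (i : cindex A) (m : M)
    (u v : 'rV[R]_n) : R :=
  sectional_curvature (chart_metric g i) (cmap i m) u v.

(* Main.v *)
Require Import Defs.
From HB Require Import structures.
From mathcomp Require Import all_boot all_order all_algebra.
From mathcomp Require Import all_classical all_reals all_analysis.
From mathcomp Require Import ring lra.
Import Order.TTheory GRing.Theory Num.Theory.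
Import numFieldNormedType.Exports.
Set Implicit Arguments.
Unset Strict Implicit.
Unset Printing Implicit Defensive.
Local Open Scope classical_set_scope.
Local Open Scope ring_scope.

(** Near the boundary write the metric as H = x^-2 G, where x is the defining
    function of the asymptotically hyperbolic compactification and G is of
    class C^2 up to the boundary. A conformal change of metric alters the
    curvature tensor by a Kulkarni-Nomizu product with G (curv_conformal), and
    after the part of constant curvature -1 has been split off this reads, for
    a G-orthonormal pair u, v,
      K[H] + 1 = x^2 (K[G](u, v) + D(u, u) + D(v, v)),
    with the defect form D = x^-1 Hess x + (1 - |dx|^2) / (2 x^2) G. As K[G] is
    bounded, only x^2 D has to be controlled, and it is singular at first sight.

    Its trace is F = x Lap x + (n / 2) (1 - |dx|^2), and the scalar curvature is
    given by R[H] + n (n - 1) = x^2 R[G] + 2 (n - 1) F, so the hypothesis says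
    F = o(x). On the boundary F vanishes because |dx| = 1 there. The derivative
    of F along the normal coordinate t is the sum of
    m = (d_t x) Lap x - (n / 2) d_t |dx|^2, which is of class C^1, and of x times
    a continuous function. As F = o(t), m vanishes on the boundary, so
    m = O(t), d_t F = O(t) and F = O(t^2) (defect_taylor). This is where a metric
    of class C^2 suffices although F is only C^1.

    The Ricci curvature supplies the rest: Ric[H] + (n - 1) H is
    Ric[G] + (n - 2) D + (tr D) G, so its nonnegativity bounds (n - 2) x^2 D(w, w)
    from below by -C t^2 on unit vectors w. Completing u, v to an orthonormal
    frame, the values of x^2 D on the frame are bounded below and add up to F;
    hence each partial sum of them is also bounded above by C t^2
    (sectional_conformal_bound). When n = 2 the sum of two values is F itself.
    Together this gives |K[H] + 1| <= C t^2 near each boundary point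
    (boundary_estimate).

    At interior points continuity of the curvature is enough. Any defining
    function is comparable to the coordinate t (defining_function_coord), and
    sectional curvature does not depend on the chart (sectional_invariance),
    which is proved by treating a change of coordinates as a gauge
    transformation of the connection matrices (conn_pullback, curv_pullback).
    Compactness then yields one constant. *)

(** * Functions of class C^k on open sets *)

Section Pointwise.
Context {R : realType} {V : normedModType R}.
Implicit Types (f g : V -> R) (p v : V).

Lemma deriveD_fun f g p v : derivable f p v -> derivable g p v ->
  'D_v (fun q => f q + g q) p = 'D_v f p + 'D_v g p.
Proof. exact: deriveD. Qed.

Lemma derivableD_fun f g p v : derivable f p v -> derivable g p v ->
  derivable (fun q => f q + g q) p v.
Proof. exact: derivableD. Qed.

Lemma deriveM_fun f g p v : derivable f p v -> derivable g p v ->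
  'D_v (fun q => f q * g q) p = 'D_v f p * g p + f p * 'D_v g p.
Proof.
move=> df dg; have := deriveM df dg; rewrite /GRing.mul/= => ->.
by rewrite addrC; congr (_ + _); rewrite /GRing.scale/= mulrC.
Qed.

Lemma derivableM_fun f g p v : derivable f p v -> derivable g p v ->
  derivable (fun q => f q * g q) p v.
Proof. exact: derivableM. Qed.

Lemma is_derive_sum_fun (I : Type) (r : seq I) (P : pred I) (f : I -> V -> R)
    p v : (forall i, derivable (f i) p v) ->
  is_derive p v (fun q => \sum_(i <- r | P i) f i q)
    (\sum_(i <- r | P i) 'D_v (f i) p).
Proof.
move=> df; elim: r => [|i r IH].
  under eq_fun do rewrite big_nil; rewrite big_nil; exact: is_derive_cst.
under eq_fun do rewrite big_cons; rewrite big_cons.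
case: ifP => // _; apply: is_deriveD; exact/derivableP.
Qed.

Lemma is_derive_line f p v (t : R) : derivable f (p + t *: v) v ->
  is_derive t 1 (fun s : R => f (p + s *: v)) ('D_v f (p + t *: v)).
Proof.
have E : (fun h : R => h^-1 *:
      (((fun s : R => f (p + s *: v)) \o shift t) (h *: 1) - f (p + t *: v)))
    = (fun h : R => h^-1 *: ((f \o shift (p + t *: v)) (h *: v) - f (p + t *: v))).
  apply/funext => h /=; rewrite [h *: 1]mulr1; congr (_ *: (f _ - _)).
  by rewrite scalerDl addrCA.
by move=> df; split; rewrite /derivable /derive E.
Qed.

End Pointwise.

Section RowNorm.
Context {R : realType} {n : nat}.
Implicit Types (p q : 'rV[R]_n) (a : 'I_n).

Lemma row_norm_le p (r : R) : 0 <= r -> (forall a, `|p 0 a| <= r) -> `|p| <= r.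
Proof.
move=> r0 H; rewrite /Num.Def.normr/= mx_normrE; apply/bigmax_leP; split=> //.
by move=> -[i a] _ /=; rewrite ord1.
Qed.

Lemma coord_norm_le p a : `|p 0 a| <= `|p|.
Proof.
rewrite [leRHS]/Num.Def.normr/= mx_normrE.
exact: (le_bigmax _ (fun i : 'I_1 * 'I_n => `|p i.1 i.2|) (ord0, a)).
Qed.

Lemma norm_evec a : `|evec R a| <= 1.
Proof.
apply: row_norm_le => // b; rewrite /evec mxE eqxx /=.
by case: (_ == _); rewrite ?normr1 // normr0.
Qed.

Lemma norm_scale_evec (s : R) a : `|s *: evec R a| <= `|s|.
Proof. by rewrite normrZ ler_piMr // norm_evec. Qed.

Lemma evecE a b : evec R a 0 b = (b == a)%:R.
Proof. by rewrite /evec mxE eqxx. Qed.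

End RowNorm.

Section COpen.
Context {R : realType} {n : nat}.
Implicit Types (U V : set 'rV[R]_n) (F G : 'rV[R]_n -> R) (p : 'rV[R]_n).
Implicit Types (a b : 'I_n) (k : nat).

Lemma C_open_continuous k U F p : C_open k U F -> U p -> {for p, continuous F}.
Proof. by case: k => [|k] [+ _]; exact. Qed.

Lemma C_open_derivable k U F p a :
  C_open k.+1 U F -> U p -> derivable F p (evec R a).
Proof. by move=> [_ /(_ a)[+ _]]; exact. Qed.

Lemma C_open_derive k U F a :
  C_open k.+1 U F -> C_open k U (fun p => 'D_(evec R a) F p).
Proof. by move=> [_ /(_ a)[]]. Qed.

Lemma C_openW k U F : C_open k.+1 U F -> C_open k U F.
Proof.
elim: k F => [|k IH] F [Fc FD]; split => // a.
by have [Fd /IH] := FD a.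
Qed.

Lemma C_open_le j k U F : (j <= k)%N -> C_open k U F -> C_open j U F.
Proof.
move=> /subnK <-; elim: (k - j)%N => [//|m IH] H.
by apply: IH; apply: C_openW.
Qed.

Lemma C_open_sub k U V F : V `<=` U -> C_open k U F -> C_open k V F.
Proof.
move=> VU; elim: k F => [|k IH] F [Fc FD].
  by split=> // p /VU /Fc.
split=> [p /VU /Fc //|a].
have [Fd /IH ?] := FD a; split=> // p /VU; exact: Fd.
Qed.

Lemma near_eq_continuous F G p : (\forall q \near p, F q = G q) ->
  {for p, continuous F} -> {for p, continuous G}.
Proof.
move=> FG Fc; rewrite /prop_for /continuous_at -(nbhs_singleton FG).
apply: cvg_trans Fc; exact: (near_eq_cvg FG).
Qed.

Lemma C_open_ext k U F G : open U -> (forall p, U p -> F p = G p) ->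
  C_open k U F -> C_open k U G.
Proof.
move=> Uo; elim: k F G => [|k IH] F G FG [Fc FD].
  split=> // p Up; apply: (near_eq_continuous _ (Fc p Up)).
  by near=> q; apply: FG; near: q; exact: open_nbhs_nbhs.
have nFG p : U p -> \forall q \near p, F q = G q.
  by move=> Up; near=> q; apply: FG; near: q; exact: open_nbhs_nbhs.
split=> [p Up|a].
  exact: (near_eq_continuous (nFG p Up) (Fc p Up)).
have [Fd FC] := FD a; split.
  by move=> p Up; apply: near_eq_derivable (Fd p Up); exact: nFG.
by apply: IH FC => p Up; apply: near_eq_derive; exact: nFG.
Unshelve. all: by end_near. Qed.

Lemma C_open_cst k U (c : R) : C_open k U (fun=> c).
Proof.
elim: k c => [|k IH] c; first by split=> // p _; exact: cst_continuous.
split=> [p _|a]; first exact: cst_continuous.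
split=> [p _|]; first exact: derivable_cst.
have -> : (fun p => 'D_(evec R a) (fun=> c) p) = (fun=> 0).
  by apply/funext => p; exact: derive_cst.
exact: IH.
Qed.

Lemma C_openD k U F G : open U -> C_open k U F -> C_open k U G ->
  C_open k U (fun p => F p + G p).
Proof.
move=> Uo; elim: k F G => [|k IH] F G CF CG.
  by split=> // p Up; apply: continuousD; [case: CF|case: CG] => + _; exact.
split=> [p Up|a].
  by apply: continuousD; [case: CF|case: CG] => + _; exact.
split=> [p Up|].
  by apply: derivableD_fun; [exact: C_open_derivable CF Up|exact: C_open_derivable CG Up].
apply: C_open_ext (IH _ _ (C_open_derive a CF) (C_open_derive a CG)) => // p Up.
by rewrite deriveD_fun//; [exact: C_open_derivable CF Up|exact: C_open_derivable CG Up].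
Qed.

Lemma C_openM k U F G : open U -> C_open k U F -> C_open k U G ->
  C_open k U (fun p => F p * G p).
Proof.
move=> Uo; elim: k F G => [|k IH] F G CF CG.
  by split=> // p Up; apply: continuousM; [case: CF|case: CG] => + _; exact.
split=> [p Up|a].
  by apply: continuousM; [case: CF|case: CG] => + _; exact.
split=> [p Up|].
  by apply: derivableM_fun; [exact: C_open_derivable CF Up|exact: C_open_derivable CG Up].
apply: C_open_ext (C_openD Uo (IH _ _ (C_open_derive a CF) (C_openW CG))
  (IH _ _ (C_openW CF) (C_open_derive a CG))) => // p Up.
by rewrite deriveM_fun//; [exact: C_open_derivable CF Up|exact: C_open_derivable CG Up].
Qed.

Lemma C_openZ k U F (c : R) : open U -> C_open k U F ->
  C_open k U (fun p => c * F p).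
Proof. by move=> Uo; apply: C_openM => //; exact: C_open_cst. Qed.

Lemma C_openN k U F : open U -> C_open k U F -> C_open k U (fun p => - F p).
Proof.
move=> Uo /(C_openZ (-1) Uo); apply: C_open_ext => // p _; exact: mulN1r.
Qed.

Lemma C_openB k U F G : open U -> C_open k U F -> C_open k U G ->
  C_open k U (fun p => F p - G p).
Proof. by move=> Uo CF CG; apply: C_openD => //; exact: C_openN. Qed.

Lemma C_open_sum k U (I : Type) (r : seq I) (P : pred I)
    (F : I -> 'rV[R]_n -> R) : open U ->
  (forall i, C_open k U (F i)) -> C_open k U (fun p => \sum_(i <- r | P i) F i p).
Proof.
move=> Uo CF; elim: r => [|i r IH].
  by under eq_fun do rewrite big_nil; exact: C_open_cst.
under eq_fun do rewrite big_cons; case: (P i) => //; exact: C_openD.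
Qed.

Lemma C_open_prod k U (I : Type) (r : seq I) (P : pred I)
    (F : I -> 'rV[R]_n -> R) : open U ->
  (forall i, C_open k U (F i)) -> C_open k U (fun p => \prod_(i <- r | P i) F i p).
Proof.
move=> Uo CF; elim: r => [|i r IH].
  by under eq_fun do rewrite big_nil; exact: C_open_cst.
under eq_fun do rewrite big_cons; case: (P i) => //; exact: C_openM.
Qed.

Lemma C_openV k U F : open U -> (forall p, U p -> F p != 0) ->
  C_open k U F -> C_open k U (fun p => (F p)^-1).
Proof.
move=> Uo F0; elim: k => [|k IH] CF.
  split=> // p Up; apply: continuousV; [exact: F0|exact: C_open_continuous CF Up].
split=> [p Up|a].
  apply: continuousV; [exact: F0|exact: C_open_continuous CF Up].
split=> [p Up|].
  by apply: derivableV; [exact: F0|exact: C_open_derivable CF Up].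
have CV := IH (C_openW CF).
apply: (C_open_ext Uo _ (C_openN Uo (C_openM Uo (C_openM Uo CV CV) (C_open_derive a CF)))).
move=> p Up; rewrite deriveV ?F0//; last exact: C_open_derivable CF Up.
by rewrite scaleNr /GRing.scale/= -invfM -expr2.
Qed.

Lemma C_open_det k U m (X : 'rV[R]_n -> 'M[R]_m) : open U ->
  (forall i j, C_open k U (fun p => X p i j)) -> C_open k U (fun p => \det (X p)).
Proof.
move=> Uo CX; apply: C_open_sum => // s.
by apply: C_openZ => //; apply: C_open_prod.
Qed.

Lemma C_open_inv k U m (X : 'rV[R]_n -> 'M[R]_m) (i j : 'I_m) : open U ->
  (forall p, U p -> X p \in unitmx) ->
  (forall i j, C_open k U (fun p => X p i j)) ->
  C_open k U (fun p => invmx (X p) i j).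
Proof.
move=> Uo Xu CX.
have Cc : C_open k U (fun p => cofactor (X p) j i).
  apply: C_openZ => //; apply: C_open_det => // i' j'.
  by under eq_fun do rewrite !mxE.
have Cd : C_open k U (fun p => (\det (X p))^-1).
  apply: C_openV => //; last exact: C_open_det.
  by move=> p /Xu; rewrite unitmxE unitfE.
apply: C_open_ext (C_openM Uo Cd Cc) => // p /Xu Xp.
by rewrite /invmx Xp !mxE.
Qed.

End COpen.

(** * Increments along lines *)

Section Increments.
Context {R : realType} {n : nat}.
Implicit Types (U : set 'rV[R]_n) (F : 'rV[R]_n -> R) (p q v : 'rV[R]_n).

Lemma MVT_line_ge0 F p v (s : R) : 0 <= s ->
  (forall t, 0 <= t <= s -> derivable F (p + t *: v) v) ->
  exists2 t, 0 <= t <= s & F (p + s *: v) - F p = s * 'D_v F (p + t *: v).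
Proof.
move=> s0 dF.
have dl t : 0 <= t <= s ->
    is_derive t 1 (fun t : R => F (p + t *: v)) ('D_v F (p + t *: v)).
  by move=> /dF; exact: is_derive_line.
have [||t] := @MVT_segment R (fun t : R => F (p + t *: v))
    (fun t => 'D_v F (p + t *: v)) 0 s s0.
- move=> t; rewrite in_itv/= => /andP[/ltW t0 /ltW ts].
  by apply: dl; rewrite t0 ts.
- apply: derivable_within_continuous => t; rewrite in_itv/= => ts.
  by have [] := dl t ts.
rewrite in_itv/= scale0r addr0 subr0 => ts E.
by exists t => //; rewrite E mulrC.
Qed.

(** Writing the intermediate point as t * s with t in [0, 1] covers both signs
    of s at once. *)
Lemma MVT_line F p v (s : R) :
  (forall t, 0 <= t <= 1 -> derivable F (p + (t * s) *: v) v) ->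
  exists2 t, 0 <= t <= 1 &
    F (p + s *: v) - F p = s * 'D_v F (p + (t * s) *: v).
Proof.
move=> dF; have [->|sn0] := eqVneq s 0.
  by exists 0; rewrite ?lexx ?ler01// scale0r addr0 subrr mul0r.
have [s0|s0] := leP 0 s.
  have sgt : 0 < s by rewrite lt_neqAle eq_sym sn0.
  have [t /andP[t0 ts]|t /andP[t0 ts] E] := @MVT_line_ge0 F p v s s0.
    rewrite -[t](divfK sn0); apply: dF.
    by rewrite divr_ge0//= ler_pdivrMr// mul1r.
  exists (t / s); first by rewrite divr_ge0//= ler_pdivrMr// mul1r.
  by rewrite divfK.
have sp (t : R) : p + s *: v + t *: v = p + ((t / s + 1) * s) *: v.
  by rewrite -addrA -scalerDl mulrDl divfK// mul1r addrC [s + t]addrC addrC.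
have ts t : 0 <= t <= - s -> 0 <= t / s + 1 <= 1.
  move=> /andP[t0 tm]; apply/andP; split.
    by rewrite -lerBlDr sub0r ler_ndivlMr// mulN1r.
  by rewrite gerDr; apply: mulr_ge0_le0 => //; rewrite invr_le0 ltW.
have [|t tt|t tt] := @MVT_line_ge0 F (p + s *: v) v (- s).
- by rewrite oppr_ge0 ltW.
- by rewrite sp; apply: dF; exact: ts.
rewrite -addrA -scalerDl subrr scale0r addr0 => E.
exists (t / s + 1); first exact: ts.
by rewrite -sp -[LHS]opprB E mulNr opprK.
Qed.

End Increments.

(** * The chain rule and the symmetry of second derivatives *)

Section ChainRule.
Context {R : realType} {n : nat}.
Implicit Types (U : set 'rV[R]_n) (F : 'rV[R]_n -> R) (p q v : 'rV[R]_n).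

Lemma open_norm_ball p (r : R) : open [set q : 'rV[R]_n | `|q - p| < r].
Proof.
have -> : [set q : 'rV[R]_n | `|q - p| < r] = ball p r.
  by apply/seteqP; split=> q; rewrite /= -ball_normE /ball_/= distrC.
exact: ball_open.
Qed.

Lemma nbhs_norm_ball p (S : set 'rV[R]_n) : nbhs p S ->
  exists2 r : R, 0 < r & forall q, `|q - p| < r -> S q.
Proof.
move=> /nbhs_ballP[r /= r0 Hr]; exists r => // q qp; apply: Hr.
by rewrite -ball_normE /ball_/= distrC.
Qed.

Lemma nbhs_ballP_open U p : open U -> U p ->
  exists2 r : R, 0 < r & forall q, `|q - p| < r -> U q.
Proof. by move=> Uo Up; apply: nbhs_norm_ball; exact: open_nbhs_nbhs. Qed.

Lemma ball_open_nbhs p (r : R) : 0 < r -> \forall q \near p, `|q - p| < r.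
Proof.
move=> r0; apply/nbhs_ballP; exists r => // q.
by rewrite -ball_normE /ball_/= distrC.
Qed.

(** Moving from p to q one coordinate at a time reduces an increment of a
    function of n variables to n mean values in one variable. *)
Definition stair p q (k : nat) : 'rV[R]_n :=
  \row_j (if (j < k)%N then q 0 j else p 0 j).

Lemma stair_step p q (k : 'I_n) (t : R) : 0 <= t <= 1 ->
  `|stair p q k + (t * (q 0 k - p 0 k)) *: evec R k - p| <= `|q - p|.
Proof.
move=> /andP[t0 t1]; apply: row_norm_le => // j; rewrite !mxE/=.
have cj : `|q 0 j - p 0 j| <= `|q - p|.
  by have := coord_norm_le (q - p) j; rewrite !mxE.
have [->|jk] := eqVneq j k.
  rewrite ltnn /= mulr1 addrC addKr normrM ger0_norm//.
  apply: le_trans (ler_piMl _ t1) _ => //.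
  by have := coord_norm_le (q - p) k; rewrite !mxE.
rewrite mulr0 addr0; case: ifP => // _.
by rewrite subrr normr0.
Qed.

Lemma stairS p q (k : 'I_n) :
  stair p q k.+1 = stair p q k + (q 0 k - p 0 k) *: evec R k.
Proof.
apply/rowP => j; rewrite !mxE/= ltnS leq_eqVlt.
have [->|jk] := eqVneq j k; first by rewrite eqxx/= ltnn mulr1 addrC subrK.
by rewrite (negbTE (_ : val j != val k))//= mulr0 addr0.
Qed.

Lemma increment_partials U F p (r : R) : C_open 1 U F ->
  (forall q, `|q - p| < r -> U q) ->
  forall q, `|q - p| < r -> exists xi : 'I_n -> 'rV[R]_n,
    (forall k, `|xi k - p| <= `|q - p|) /\
    F q - F p = \sum_k (q 0 k - p 0 k) * 'D_(evec R k) F (xi k).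
Proof.
move=> CF pU q qr.
have step (k : 'I_n) : exists x : 'rV[R]_n, `|x - p| <= `|q - p| /\
    F (stair p q k.+1) - F (stair p q k) = (q 0 k - p 0 k) * 'D_(evec R k) F x.
  have [t t01|t t01 E] := @MVT_line R n F (stair p q k) (evec R k) (q 0 k - p 0 k).
    apply: (C_open_derivable CF). apply: pU.
    exact: le_lt_trans (stair_step _ _ _ t01) qr.
  exists (stair p q k + (t * (q 0 k - p 0 k)) *: evec R k).
  by split; [exact: stair_step|rewrite stairS].
have [xi xiP] := choice step.
exists xi; split=> [k|]; first by have [] := xiP k.
rewrite -(eq_bigr _ (fun k _ => (xiP k).2)).
rewrite -(big_mkord xpredT (fun k => F (stair p q k.+1) - F (stair p q k))).
rewrite telescope_sumr//; congr (F _ - F _); apply/rowP => j; rewrite mxE//.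
by rewrite ltn_ord.
Qed.

(** The increment of F along Phi is split by increment_partials, at
    intermediate points squeezed between Phi x and the moving point;
    continuity of the partial derivatives of F then passes to the limit. *)
Lemma chain_rule (V : normedModType R) U F (Phi : V -> 'rV[R]_n) (x w : V) :
  open U -> U (Phi x) -> C_open 1 U F ->
  (forall k, derivable (fun y => Phi y 0 k) x w) ->
  is_derive x w (fun y => F (Phi y))
    (\sum_k 'D_w (fun y => Phi y 0 k) x * 'D_(evec R k) F (Phi x)).
Proof.
move=> Uo Ux CF dPhi; set p := Phi x.
have [r r0 rU] := nbhs_ballP_open Uo Ux.
have [xi xiP] : exists xi : 'rV[R]_n -> 'I_n -> 'rV[R]_n, forall q, `|q - p| < r ->
    (forall k, `|xi q k - p| <= `|q - p|) /\
    F q - F p = \sum_k (q 0 k - p 0 k) * 'D_(evec R k) F (xi q k).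
  suff step q : exists xi : 'I_n -> 'rV[R]_n, `|q - p| < r ->
      (forall k, `|xi k - p| <= `|q - p|) /\
      F q - F p = \sum_k (q 0 k - p 0 k) * 'D_(evec R k) F (xi k).
    by have [xi xiP] := choice step; exists xi.
  have [qr|qr] := ltP `|q - p| r; last by exists (fun=> p).
  by have [xi xiP] := increment_partials CF rU qr; exists xi.
pose c (h : R) := Phi (h *: w + x).
have ck k : {for 0, continuous (fun h : R => c h 0 k)}.
  apply/differentiable_continuous/derivable1_diffP.
  exact: (derivable1P (fun y => Phi y 0 k) x w).1 (dPhi k).
have c0 : c 0 = p by rewrite /c scale0r add0r.
have cc : c h @[h --> 0^'] --> p.
  apply/cvgrPdist_le => /= e e0; near=> h.
  apply: row_norm_le => [|k]; first exact: ltW.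
  rewrite !mxE; move: k; near: h; apply: filter_forall => k.
  have /continuous_withinNx/cvgrPdist_le/(_ e e0) := ck k.
  by rewrite c0.
have xic k : xi (c h) k @[h --> 0^'] --> p.
  apply/cvgrPdist_le => /= e e0; near=> h.
  have hr : `|p - c h| < r by near: h; move/cvgrPdist_lt : cc => /(_ r r0).
  rewrite distrC in hr.
  rewrite distrC; apply: le_trans ((xiP _ hr).1 k) _.
  by rewrite distrC; near: h; move/cvgrPdist_le : cc => /(_ e e0).
have lim : h^-1 *: (F (c h) - F p) @[h --> 0^'] -->
    \sum_k 'D_w (fun y => Phi y 0 k) x * 'D_(evec R k) F p.
  have : \sum_k (h^-1 *: (Phi (h *: w + x) 0 k - Phi x 0 k)) *
      'D_(evec R k) F (xi (c h) k) @[h --> 0^'] -->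
      \sum_k 'D_w (fun y => Phi y 0 k) x * 'D_(evec R k) F p.
    apply: cvg_big => [|k _]; first exact: add_continuous.
    apply: cvgM; first exact: dPhi.
    have cD : {for p, continuous (fun q => 'D_(evec R k) F q)}.
      exact: C_open_continuous (C_open_derive k CF) Ux.
    exact: (@cvg_comp _ _ _ (fun h => xi (c h) k) (fun q => 'D_(evec R k) F q)
      _ _ _ (xic k) cD).
  apply: cvg_trans; apply: near_eq_cvg; near=> h.
  have hr : `|p - c h| < r by near: h; move/cvgrPdist_lt : cc => /(_ r r0).
  rewrite distrC in hr.
  rewrite (xiP _ hr).2 scaler_sumr; apply: eq_bigr => k _.
  by rewrite /GRing.scale/= mulrA.
by split; [apply/cvg_ex; eexists; exact: lim|exact: cvg_lim lim].
Unshelve. all: by end_near. Qed.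

(** The matching values of A and B may be taken at different points: the mean
    value theorem yields such pairs when a second difference is expanded in
    two orders. *)
Lemma continuous_eq_at (A B : 'rV[R]_n -> R) p (r : R) : 0 < r ->
  {for p, continuous A} -> {for p, continuous B} ->
  (forall h, 0 < h -> h < r ->
     exists z w, [/\ `|z - p| <= h, `|w - p| <= h & A z = B w]) ->
  A p = B p.
Proof.
move=> r0 cA cB AB.
apply/eqP; rewrite -subr_eq0 -normr_le0; apply/ler_addgt0Pr => e e0.
rewrite add0r.
have e20 : 0 < e / 2 by rewrite divr_gt0.
move/cvgrPdist_lt : cA => /(_ _ e20) /nbhs_ballP[r1 /= r10 H1].
move/cvgrPdist_lt : cB => /(_ _ e20) /nbhs_ballP[r2 /= r20 H2].
pose m := Num.min r (Num.min r1 r2).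
have m0 : 0 < m by rewrite !lt_min r0 r10 r20.
have hm : m / 2 < m by lra.
have h0 : 0 < m / 2 by rewrite divr_gt0.
have [||z [w [zp wp E]]] := AB (m / 2) => //.
  by apply: lt_le_trans hm _; rewrite ge_min lexx.
have dz : `|A p - A z| < e / 2.
  apply: H1; rewrite -ball_normE /ball_/= distrC.
  by apply: le_lt_trans zp (lt_le_trans hm _); rewrite !ge_min lexx orbT.
have dw : `|B p - B w| < e / 2.
  apply: H2; rewrite -ball_normE /ball_/= distrC.
  by apply: le_lt_trans wp (lt_le_trans hm _); rewrite !ge_min lexx !orbT.
rewrite -(subrKA (A z)) [e]splitr; apply: le_trans (ler_normD _ _) _.
by apply: lerD; rewrite ltW// E distrC.
Qed.

(** Schwarz: the second difference over a square of side h is h^2 times either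
    mixed derivative, at some point of the square. *)
Lemma derive_comm U F p (a b : 'I_n) : open U -> U p -> C_open 2 U F ->
  'D_(evec R a) (fun q => 'D_(evec R b) F q) p =
  'D_(evec R b) (fun q => 'D_(evec R a) F q) p.
Proof.
move=> Uo Up CF; have [r r0 rU] := nbhs_ballP_open Uo Up.
(* the second difference over a square of side h, in either order *)
have key (a' b' : 'I_n) (h : R) : 0 < h -> h + h < r -> exists2 z, `|z - p| <= h + h &
    F (p + h *: evec R a' + h *: evec R b') - F (p + h *: evec R a')
      - (F (p + h *: evec R b') - F p)
    = h * (h * 'D_(evec R b') (fun q => 'D_(evec R a') F q) z).
  move=> h0 hr.
  have near2 (s t : R) : 0 <= s <= h -> 0 <= t <= h ->
      `|p + s *: evec R a' + t *: evec R b' - p| <= h + h.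
    move=> /andP[s0 sh] /andP[t0 th].
    rewrite -[p + _ + _]addrA [p + (_ + _)]addrC addrK.
    apply: le_trans (ler_normD _ _) _.
    apply: lerD; (apply: le_trans (norm_scale_evec _ _) _; by rewrite ger0_norm).
  have in2 (s t : R) : 0 <= s <= h -> 0 <= t <= h ->
      U (p + s *: evec R a' + t *: evec R b').
    by move=> sh th; apply: rU; exact: le_lt_trans (near2 _ _ sh th) hr.
  have h0h : 0 <= h <= h by rewrite lexx ltW.
  have z0h : 0 <= (0 : R) <= h by rewrite lexx ltW.
  pose D q := F (q + h *: evec R b') - F q.
  have dsh (s : R) : 0 <= s <= h -> is_derive (p + s *: evec R a') (evec R a') D
      ('D_(evec R a') F (p + s *: evec R a' + h *: evec R b')
       - 'D_(evec R a') F (p + s *: evec R a')).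
    move=> sh; apply: is_deriveB; last first.
      apply/derivableP; apply: (C_open_derivable CF).
      by have := in2 s 0 sh z0h; rewrite scale0r addr0.
    have dF : derivable F (p + s *: evec R a' + h *: evec R b') (evec R a').
      by apply: (C_open_derivable CF); exact: in2.
    have E : (fun k : R => k^-1 *: (((fun q => F (q + h *: evec R b')) \o
        shift (p + s *: evec R a')) (k *: evec R a')
        - F (p + s *: evec R a' + h *: evec R b'))) =
      (fun k : R => k^-1 *: ((F \o shift (p + s *: evec R a' + h *: evec R b'))
        (k *: evec R a') - F (p + s *: evec R a' + h *: evec R b'))).
      by apply/funext => k /=; rewrite !addrA.
    by split; rewrite /derivable /derive E.
  have [s sh|s sh E1] := @MVT_line_ge0 R n D p (evec R a') h (ltW h0).
    by have [] := dsh s sh.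
  have Es := @derive_val _ _ _ _ _ _ _ (dsh s sh).
  have [t th|t th E2] := @MVT_line_ge0 R n (fun q => 'D_(evec R a') F q)
    (p + s *: evec R a') (evec R b') h (ltW h0).
    by apply: (C_open_derivable (C_open_derive a' CF)); exact: in2.
  exists (p + s *: evec R a' + t *: evec R b'); first exact: near2.
  by rewrite -E2 -Es -E1.
apply: (@continuous_eq_at (fun q => 'D_(evec R a) (fun q => 'D_(evec R b) F q) q)
  (fun q => 'D_(evec R b) (fun q => 'D_(evec R a) F q) q) p r) => //.
- exact: C_open_continuous (C_open_derive a (C_open_derive b CF)) Up.
- exact: C_open_continuous (C_open_derive b (C_open_derive a CF)) Up.
move=> h h0 hr; have h20 : 0 < h / 2 by rewrite divr_gt0.
have h2r : h / 2 + h / 2 < r by rewrite -splitr.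
have [z zp Ez] := key b a (h / 2) h20 h2r.
have [w wp Ew] := key a b (h / 2) h20 h2r.
exists z, w; split; [by rewrite [leRHS]splitr|by rewrite [leRHS]splitr|].
have C : p + (h / 2) *: evec R b + (h / 2) *: evec R a =
         p + (h / 2) *: evec R a + (h / 2) *: evec R b by exact: addrAC.
have sw (x y u v : R) : x - y - (u - v) = x - u - (y - v) by ring.
apply: (mulfI (lt0r_neq0 h20)); apply: (mulfI (lt0r_neq0 h20)).
by apply: etrans (esym Ez) (etrans _ Ew); rewrite C; exact: sw.
Qed.

End ChainRule.

Lemma is_derive_coord (R : realType) (n : nat) (p : 'rV[R]_n) (b c : 'I_n) :
  is_derive p (evec R c) (fun q : 'rV[R]_n => q 0 b) (b == c)%:R.
Proof.
have E : (fun h : R => h^-1 *: (((fun q : 'rV[R]_n => q 0 b) \o shift p) (h *: evec R c) - p 0 b))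
    = (fun h : R => h^-1 *: (h * (b == c)%:R)).
  by apply/funext => h /=; rewrite !mxE eqxx /= addrK.
have L : h^-1 *: (h * (b == c)%:R) @[h --> (0 : R)^'] --> ((b == c)%:R : R).
  apply: cvg_near_cst; near=> h; rewrite /GRing.scale/= mulKf//.
  by near: h; exact: nbhs_dnbhs_neq.
split; rewrite /derivable /derive E; first by apply/cvg_ex; eexists; exact: L.
exact: cvg_lim L.
Unshelve. all: by end_near. Qed.

(* From here on the derivative is used only through its rules of calculus. *)
#[local] Opaque derive.

(** * Calculus of matrix-valued functions *)

Section MatrixCalculus.
Context {R : realType} {V : normedModType R}.
Implicit Types (p v : V).

Lemma derive_mxE m k (X : V -> 'M[R]_(m, k)) p v i j : derivable X p v ->
  ('D_v X p) i j = 'D_v (fun q => X q i j) p.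
Proof. by move=> dX; rewrite derive_mx // mxE. Qed.

Lemma is_derive_mx m k (X : V -> 'M[R]_(m, k)) p v (D : 'M[R]_(m, k)) :
  (forall i j, is_derive p v (fun q => X q i j) (D i j)) -> is_derive p v X D.
Proof.
move=> dX; have dXp : derivable X p v.
  by apply/derivable_mxP => i j; have [] := dX i j.
split=> //; apply/matrixP => i j; rewrite derive_mxE//.
by have [] := dX i j.
Qed.

Lemma is_derive_mx_entry m k (X : V -> 'M[R]_(m, k)) p v i j : derivable X p v ->
  is_derive p v (fun q => X q i j) ('D_v X p i j).
Proof.
move=> dX; rewrite derive_mxE//; apply/derivableP.
by move/derivable_mxP : dX; exact.
Qed.

Lemma is_derive_fun (W : normedModType R) (X : V -> W) p v : derivable X p v ->
  is_derive p v X ('D_v X p).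
Proof. by move=> dX; split. Qed.

Lemma is_deriveM_fun (f g : V -> R) p v (df dg : R) :
  is_derive p v f df -> is_derive p v g dg ->
  is_derive p v (fun q => f q * g q) (df * g p + f p * dg).
Proof.
move=> [? <-] [? <-].
by split; [exact: derivableM_fun|exact: deriveM_fun].
Qed.

Lemma is_derive_mulmx m k l (X : V -> 'M[R]_(m, k)) (Y : V -> 'M[R]_(k, l)) p v dX dY :
  is_derive p v X dX -> is_derive p v Y dY ->
  is_derive p v (fun q => X q *m Y q) (dX *m Y p + X p *m dY).
Proof.
move=> [hX <-] [hY <-]; apply: is_derive_mx => i j.
under eq_fun do rewrite mxE.
rewrite !mxE -big_split/=.
have H c : is_derive p v (fun q => X q i c * Y q c j)
    ('D_v X p i c * Y p c j + X p i c * 'D_v Y p c j).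
  by apply: is_deriveM_fun; exact: is_derive_mx_entry.
rewrite -(eq_bigr _ (fun c _ => @derive_val _ _ _ _ _ _ _ (H c))).
by apply: is_derive_sum_fun => c; have [] := H c.
Qed.

Lemma is_derive_scalemx m k (f : V -> R) (X : V -> 'M[R]_(m, k)) p v df dX :
  is_derive p v f df -> is_derive p v X dX ->
  is_derive p v (fun q => f q *: X q) (df *: X p + f p *: dX).
Proof.
move=> hf [hX <-]; apply: is_derive_mx => i j.
under eq_fun do rewrite mxE.
rewrite !mxE; apply: is_deriveM_fun => //; exact: is_derive_mx_entry.
Qed.

Lemma is_derive_trmx m k (X : V -> 'M[R]_(m, k)) p v dX :
  is_derive p v X dX -> is_derive p v (fun q => (X q)^T) dX^T.
Proof.
move=> [hX <-]; apply: is_derive_mx => i j.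
under eq_fun do rewrite mxE.
rewrite mxE; exact: is_derive_mx_entry.
Qed.

Lemma is_derive_sum_mx m k (I : Type) (r : seq I) (P : pred I)
    (X : I -> V -> 'M[R]_(m, k)) p v (dX : I -> 'M[R]_(m, k)) :
  (forall i, is_derive p v (X i) (dX i)) ->
  is_derive p v (fun q => \sum_(i <- r | P i) X i q) (\sum_(i <- r | P i) dX i).
Proof.
move=> H; elim: r => [|i r IH].
  under eq_fun do rewrite big_nil; rewrite big_nil; exact: is_derive_cst.
under eq_fun do rewrite big_cons; rewrite big_cons.
case: ifP => // _; exact: is_deriveD.
Qed.

Lemma is_deriveD_fun (W : normedModType R) (X Y : V -> W) p v dX dY :
  is_derive p v X dX -> is_derive p v Y dY ->
  is_derive p v (fun q => X q + Y q) (dX + dY).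
Proof. exact: is_deriveD. Qed.

Lemma is_deriveB_fun (W : normedModType R) (X Y : V -> W) p v dX dY :
  is_derive p v X dX -> is_derive p v Y dY ->
  is_derive p v (fun q => X q - Y q) (dX - dY).
Proof. exact: is_deriveB. Qed.

End MatrixCalculus.

Section SmoothMatrix.
Context {R : realType} {n : nat}.
Implicit Types (U : set 'rV[R]_n) (p : 'rV[R]_n) (a b : 'I_n).

Definition mxC m l (k : nat) U (X : 'rV[R]_n -> 'M[R]_(m, l)) : Prop :=
  forall i j, C_open k U (fun q => X q i j).

Lemma mxC_derivable m l k U (X : 'rV[R]_n -> 'M[R]_(m, l)) p a :
  mxC k.+1 U X -> U p -> derivable X p (evec R a).
Proof.
move=> CX Up; apply/derivable_mxP => i j; exact: C_open_derivable (CX i j) Up.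
Qed.

Lemma mxC_is_derive m l k U (X : 'rV[R]_n -> 'M[R]_(m, l)) p a :
  mxC k.+1 U X -> U p -> is_derive p (evec R a) X ('D_(evec R a) X p).
Proof. by move=> CX Up; apply: is_derive_fun; exact: mxC_derivable CX Up. Qed.

Lemma mxC_derive m l k U (X : 'rV[R]_n -> 'M[R]_(m, l)) a : open U ->
  mxC k.+1 U X -> mxC k U (fun p => 'D_(evec R a) X p).
Proof.
move=> Uo CX i j; apply: C_open_ext (C_open_derive a (CX i j)) => // p Up.
by rewrite derive_mxE//; exact: mxC_derivable CX Up.
Qed.

Lemma mxC_le m l j k U (X : 'rV[R]_n -> 'M[R]_(m, l)) : (j <= k)%N ->
  mxC k U X -> mxC j U X.
Proof. by move=> jk CX a b; exact: C_open_le jk (CX a b). Qed.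

Lemma mxC_sub m l k U W (X : 'rV[R]_n -> 'M[R]_(m, l)) : W `<=` U ->
  mxC k U X -> mxC k W X.
Proof. by move=> WU CX a b; exact: C_open_sub WU (CX a b). Qed.

Lemma mxC_mulmx m l r k U (X : 'rV[R]_n -> 'M[R]_(m, l)) (Y : 'rV[R]_n -> 'M[R]_(l, r)) :
  open U -> mxC k U X -> mxC k U Y -> mxC k U (fun q => X q *m Y q).
Proof.
move=> Uo CX CY i j; under eq_fun do rewrite mxE.
by apply: C_open_sum => // c; apply: C_openM.
Qed.

Lemma mxC_scale m l k U (f : 'rV[R]_n -> R) (X : 'rV[R]_n -> 'M[R]_(m, l)) :
  open U -> C_open k U f -> mxC k U X -> mxC k U (fun q => f q *: X q).
Proof.
by move=> Uo Cf CX i j; under eq_fun do rewrite mxE; exact: C_openM.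
Qed.

Lemma mxC_inv m k U (X : 'rV[R]_n -> 'M[R]_m) : open U ->
  (forall p, U p -> X p \in unitmx) -> mxC k U X -> mxC k U (fun q => invmx (X q)).
Proof. by move=> Uo Xu CX i j; exact: C_open_inv. Qed.

Lemma near_eq_derive_open (W : normedModType R) U (X Y : 'rV[R]_n -> W) p a :
  open U -> U p -> (forall q, U q -> X q = Y q) ->
  'D_(evec R a) X p = 'D_(evec R a) Y p.
Proof.
move=> Uo Up XY; apply: near_eq_derive; near=> q; apply: XY; near: q.
exact: open_nbhs_nbhs.
Unshelve. all: by end_near. Qed.

Lemma derive_comm_mx m l U (X : 'rV[R]_n -> 'M[R]_(m, l)) p a b :
  open U -> U p -> mxC 2 U X ->
  'D_(evec R a) (fun q => 'D_(evec R b) X q) p =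
  'D_(evec R b) (fun q => 'D_(evec R a) X q) p.
Proof.
move=> Uo Up CX; apply/matrixP => i j.
have E a' b' : 'D_(evec R a') (fun q => 'D_(evec R b') X q) p i j =
    'D_(evec R a') (fun q => 'D_(evec R b') (fun q => X q i j) q) p.
  rewrite derive_mxE; last exact: mxC_derivable (mxC_derive _ Uo CX) Up.
  apply: (near_eq_derive_open (U := U)) => // q Uq.
  by apply: derive_mxE; exact: mxC_derivable CX Uq.
exact: etrans (E a b) (etrans (derive_comm a b Uo Up (CX i j)) (esym (E b a))).
Qed.

End SmoothMatrix.

(** * The Levi-Civita connection and its curvature in coordinates *)

Section Connection.
Context {R : realType} {n : nat}.
Implicit Types (U : set 'rV[R]_n) (p : 'rV[R]_n) (a b c d : 'I_n).
Implicit Types (G : 'rV[R]_n -> 'M[R]_n).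

(** The connection matrix of the covariant derivative in the direction a,
    acting on columns of components. Matrix products of these encode the
    quadratic terms of the curvature. *)
Definition conn G a p : 'M[R]_n := \matrix_(c, b) christoffel G c a b p.

(** The endomorphism R(e_a, e_b). *)
Definition curv G a b p : 'M[R]_n := \matrix_(d, c) riemann G d c a b p.

Definition metric_on k U G : Prop :=
  [/\ mxC k U G, forall p, U p -> (G p)^T = G p & forall p, U p -> G p \in unitmx].

Lemma metric_on_sub k U W G : W `<=` U -> metric_on k U G -> metric_on k W G.
Proof.
move=> WU [CG sG uG]; split; first exact: mxC_sub CG.
- by move=> p /WU /sG.
- by move=> p /WU /uG.
Qed.

Lemma C_open_christoffel k U G c a b : open U ->
  (forall p, U p -> G p \in unitmx) -> mxC k.+1 U G ->
  C_open k U (christoffel G c a b).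
Proof.
move=> Uo Gu CG; apply: C_openZ => //; apply: C_open_sum => // d.
apply: C_openM => //.
  by apply: mxC_inv => //; exact: mxC_le CG.
by apply: C_openB => //; [apply: C_openD => //|]; exact: C_open_derive (CG _ _).
Qed.

Lemma mxC_conn k U G a : open U ->
  (forall p, U p -> G p \in unitmx) -> mxC k.+1 U G -> mxC k U (conn G a).
Proof.
move=> Uo Gu CG c b; under eq_fun do rewrite mxE; exact: C_open_christoffel.
Qed.

(** These are the Christoffel symbols of the first kind. *)
Lemma conn_lower G a p : G p \in unitmx ->
  G p *m conn G a p = \matrix_(d, b) (2^-1 *
    ('D_(evec R a) (fun q => G q b d) p + 'D_(evec R b) (fun q => G q a d) p
     - 'D_(evec R d) (fun q => G q a b) p)).
Proof.
move=> Gu; rewrite -[RHS](mulKVmx Gu); congr (_ *m _).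
apply/matrixP => c b; rewrite !mxE /christoffel mulr_sumr.
by apply: eq_bigr => d _; rewrite !mxE mulrCA.
Qed.

Section AtPoint.
Variables (U : set 'rV[R]_n) (G : 'rV[R]_n -> 'M[R]_n) (k : nat).
Hypotheses (Uo : open U) (mG : metric_on k.+1 U G).

Let CG : mxC k.+1 U G. Proof. by case: mG. Qed.
Let Gu p : U p -> G p \in unitmx. Proof. by case: mG => _ _; exact. Qed.
Let Gs p : U p -> (G p)^T = G p. Proof. by case: mG => _ + _; exact. Qed.

Lemma derive_metric_sym p a b d : U p ->
  'D_(evec R a) (fun q => G q b d) p = 'D_(evec R a) (fun q => G q d b) p.
Proof.
move=> Up; apply: (near_eq_derive_open (U := U)) => // q Uq.
by rewrite -[in LHS](Gs Uq) mxE.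
Qed.

Lemma conn_torsion_free p a b c : U p -> conn G a p c b = conn G b p c a.
Proof.
move=> Up; rewrite !mxE /christoffel; congr (_ * _); apply: eq_bigr => d _.
by congr (_ * (_ - _)); [exact: addrC|exact: derive_metric_sym].
Qed.

(** The Levi-Civita connection is the only one that is torsion free and
    compatible with the metric: a T with the two properties of the lowered
    symbols is solved for by cyclic permutation of the indices. It identifies
    the connection of a metric that is pulled back or rescaled. *)
Lemma conn_unique p (T : 'I_n -> 'M[R]_n) a : U p ->
  (forall a b e, T a e b = T b e a) ->
  (forall a, 'D_(evec R a) G p = T a + (T a)^T) -> G p *m conn G a p = T a.
Proof.
move=> Up Ts TD; rewrite conn_lower ?Gu//; apply/matrixP => d b; rewrite mxE.
have E a' i j : 'D_(evec R a') (fun q => G q i j) p = T a' i j + T a' j i.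
  by rewrite -derive_mxE ?TD ?mxE//; exact: mxC_derivable CG Up.
rewrite !E (Ts b a d) (Ts d a b) (Ts b d a) (Ts d b a) (Ts a b d).
by field.
Qed.

Lemma conn_compat p a : U p ->
  'D_(evec R a) G p = G p *m conn G a p + (G p *m conn G a p)^T.
Proof.
move=> Up; apply/matrixP => i j; rewrite conn_lower ?Gu// !mxE.
rewrite derive_mxE; last exact: mxC_derivable CG Up.
by rewrite (derive_metric_sym _ j i)//; field.
Qed.

End AtPoint.

Lemma christoffel_local U G G' c a b p : open U -> U p ->
  (forall q, U q -> G q = G' q) -> christoffel G c a b p = christoffel G' c a b p.
Proof.
move=> Uo Up GG'; rewrite /christoffel GG'//; congr (_ * _).
apply: eq_bigr => d _; congr (_ * _).
by congr (_ + _ - _); apply: (near_eq_derive_open (U := U)) => // q Uq; rewrite GG'.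
Qed.

Lemma riemann_local U G G' d c a b p : open U -> U p ->
  (forall q, U q -> G q = G' q) -> riemann G d c a b p = riemann G' d c a b p.
Proof.
move=> Uo Up GG'; have E := fun c a b q Uq => @christoffel_local U G G' c a b q Uo Uq GG'.
have DE e a' b' c' : 'D_(evec R e) (christoffel G c' a' b') p =
    'D_(evec R e) (christoffel G' c' a' b') p.
  by apply: (near_eq_derive_open (U := U)) => // q Uq; exact: E.
rewrite /riemann !DE; congr (_ + _).
by apply: eq_bigr => e _; rewrite !E.
Qed.

Lemma curv_anti G a b p : curv G b a p = - curv G a b p.
Proof.
apply/matrixP => d c; rewrite !mxE /riemann opprD opprB -sumrN.
by congr (_ + _); apply: eq_bigr => e _; rewrite opprB.
Qed.

(** The structure equation: curvature is the covariant exterior derivative of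
    the matrix-valued connection form. *)
Lemma curvE G a b p : derivable (conn G a) p (evec R b) ->
  derivable (conn G b) p (evec R a) ->
  curv G a b p = 'D_(evec R a) (conn G b) p - 'D_(evec R b) (conn G a) p
    + (conn G a p *m conn G b p - conn G b p *m conn G a p).
Proof.
move=> da db; apply/matrixP => d c.
have DE e f : derivable (conn G f) p (evec R e) ->
    'D_(evec R e) (conn G f) p d c = 'D_(evec R e) (christoffel G d f c) p.
  move=> dG; rewrite derive_mxE//.
  by under eq_fun do rewrite mxE.
have entries (A B C D : 'M[R]_n) :
    (A - B + (C *m D - D *m C)) d c =
    A d c - B d c + \sum_(e < n) (C d e * D e c - D d e * C e c).
  by rewrite !mxE sumrB.
transitivity (riemann G d c a b p); first by rewrite /curv mxE.
apply: esym; apply: (etrans (entries _ _ _ _)).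
apply: (etrans (congr2 (fun x y => x - y + _) (DE _ _ db) (DE _ _ da))).
rewrite /riemann; by apply: (congr1 (fun y => _ + y)); apply: eq_bigr => e _; rewrite !mxE.
Qed.

(** Here A and B stand for the connection matrices in two directions a and b,
    DB for the derivative of B along a and DA for that of A along b. Then X +
    X^T and Y + Y^T are the two mixed second derivatives of the metric. *)
Lemma skew_of_commuting (g A B DA DB : 'M[R]_n) : g^T = g ->
  let X := (g *m A + (g *m A)^T) *m B + g *m DB in
  let Y := (g *m B + (g *m B)^T) *m A + g *m DA in
  X + X^T = Y + Y^T ->
  (g *m (DB - DA + (A *m B - B *m A)))^T = - (g *m (DB - DA + (A *m B - B *m A))).
Proof.
move=> gT /=; rewrite !mulmxDl !mulmxDr !mulmxN !trmx_mul gT !mulmxA.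
have : (A^T *m g *m B)^T = B^T *m g *m A by rewrite !trmx_mul trmxK gT mulmxA.
move: (g *m A *m B) (g *m B *m A) (A^T *m g *m B) (B^T *m g *m A) (g *m DA) (g *m DB).
move=> X Y Z W P Q ZW /matrixP H; apply/matrixP => i j.
have := H i j; have /matrixP ZW' := ZW.
have := ZW' i j; have := ZW' j i; rewrite !mxE => *; lra.
Qed.

(** Second derivatives of the metric commute; expressed through the
    connection, their difference is twice the symmetric part of the lowered
    curvature. *)
Lemma curv_skew U G a b p : open U -> U p -> metric_on 2 U G ->
  (G p *m curv G a b p)^T = - (G p *m curv G a b p).
Proof.
move=> Uo Up mG; have [CG Gs Gu] := mG.
have CC c : mxC 1 U (conn G c) by exact: mxC_conn.
have dC c e : is_derive p (evec R e) (conn G c) ('D_(evec R e) (conn G c) p).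
  exact: mxC_is_derive (CC c) Up.
have dG e : is_derive p (evec R e) G ('D_(evec R e) G p).
  exact: mxC_is_derive CG Up.
have second e c : 'D_(evec R e) (fun q => 'D_(evec R c) G q) p =
    ('D_(evec R e) G p *m conn G c p + G p *m 'D_(evec R e) (conn G c) p)
    + ('D_(evec R e) G p *m conn G c p + G p *m 'D_(evec R e) (conn G c) p)^T.
  transitivity ('D_(evec R e) (fun q => G q *m conn G c q + (G q *m conn G c q)^T) p).
    apply: (near_eq_derive_open (U := U)) => // q Uq.
    exact: (conn_compat Uo mG).
  have H := is_derive_mulmx (dG e) (dC c e).
  by have [] := is_deriveD_fun H (is_derive_trmx H).
have := derive_comm_mx a b Uo Up CG.
rewrite !second !(conn_compat Uo mG _ Up) curvE; [|by have [] := dC a b|by have [] := dC b a].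
exact: skew_of_commuting (Gs p Up).
Qed.

End Connection.

(** * Changes of coordinates *)

Section PullbackAlgebra.
Context {R : realType} {n : nat}.

(** The derivative of J^T g J in terms of the derivative Ja of J, when that of
    g is given by metric compatibility with the connection matrix A. *)
Lemma pullback_compat_algebra (J Ja g A : 'M[R]_n) : g^T = g ->
  let T := J^T *m g *m (A *m J + Ja) in
  (Ja^T *m g + J^T *m (g *m A + (g *m A)^T)) *m J + J^T *m g *m Ja = T + T^T.
Proof.
move=> gT T.
have -> : T^T = (J^T *m A^T + Ja^T) *m (g *m J).
  by rewrite /T trmx_mul [X in X *m _]linearD/= !trmx_mul trmxK gT.
rewrite /T trmx_mul gT.
rewrite !(mulmxDr, mulmxDl, mulmxA).
move: (Ja^T *m g *m J) (J^T *m g *m A *m J) (J^T *m A^T *m g *m J) (J^T *m g *m Ja).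
by move=> X Y Z W; apply/matrixP => i j; rewrite !mxE; ring.
Qed.

(** A gauge transformation J of connections intertwines their curvatures. The
    last two hypotheses are the derivatives of the first two; the second
    derivative Jab of J occurs symmetrically and cancels. *)
Lemma gauge_algebra (J Ja Jb Jab X Y DX DY A B DA DB : 'M[R]_n) :
  J *m X = A *m J + Ja -> J *m Y = B *m J + Jb ->
  Ja *m Y + J *m DY = (DB *m J + B *m Ja) + Jab ->
  Jb *m X + J *m DX = (DA *m J + A *m Jb) + Jab ->
  J *m (DY - DX + (X *m Y - Y *m X)) = (DB - DA + (A *m B - B *m A)) *m J.
Proof.
move=> HX HY HDY HDX.
have H1 : J *m DY = - (Ja *m Y) + (DB *m J + B *m Ja + Jab).
  by rewrite -HDY addKr.
have H2 : J *m DX = - (Jb *m X) + (DA *m J + A *m Jb + Jab).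
  by rewrite -HDX addKr.
rewrite !mulmxDr !mulmxN !mulmxA H1 H2 HX HY !mulmxDl !mulNmx.
rewrite -[A *m J *m Y]mulmxA -[B *m J *m X]mulmxA HX HY !mulmxDr !mulmxA.
move: (Ja *m Y) (DB *m J) (B *m Ja) (Jb *m X) (DA *m J) (A *m Jb) (A *m B *m J) (B *m A *m J).
move=> *; apply/matrixP => i j; rewrite !mxE; ring.
Qed.

End PullbackAlgebra.

Section Pullback.
Context {R : realType} {n : nat}.
Implicit Types (a b i j k : 'I_n).
Variables (V U : set 'rV[R]_n) (Phi : 'rV[R]_n -> 'rV[R]_n).
Variables (G H : 'rV[R]_n -> 'M[R]_n).

Definition jacobian_mx (q : 'rV[R]_n) : 'M[R]_n :=
  \matrix_(k, a) 'D_(evec R a) (fun q => Phi q 0 k) q.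

Hypotheses (Vo : open V) (Uo : open U) (VU : forall q, V q -> U (Phi q)).
Hypothesis CPhi : forall k, C_open 3 V (fun q => Phi q 0 k).
Hypotheses (mG : metric_on 2 V G) (mH : metric_on 2 U H).
Let J := jacobian_mx.
Hypothesis GH : forall q, V q -> G q = (J q)^T *m H (Phi q) *m J q.

Let CJ : mxC 2 V J.
Proof.
by move=> k a; under eq_fun do rewrite mxE; exact: C_open_derive (CPhi k).
Qed.

Let CG : mxC 2 V G. Proof. by case: mG. Qed.
Let CH : mxC 2 U H. Proof. by case: mH. Qed.
Let Hs q : V q -> (H (Phi q))^T = H (Phi q).
Proof. by move=> /VU; case: mH => _ + _; exact. Qed.
Let Hu q : V q -> H (Phi q) \in unitmx.
Proof. by move=> /VU; case: mH => _ _; exact. Qed.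

Let Ju q : V q -> J q \in unitmx.
Proof.
move=> Vq; have : G q \in unitmx by case: mG => _ _; exact.
by rewrite GH// unitmx_mul => /andP[].
Qed.

Let JD a k b q : V q ->
  'D_(evec R a) J q k b = 'D_(evec R a) (fun q => 'D_(evec R b) (fun q => Phi q 0 k) q) q.
Proof.
move=> Vq; apply: (etrans (derive_mxE _ _ _)).
  exact: mxC_derivable CJ Vq.
by apply: (near_eq_derive_open (U := V)) => // r _; rewrite mxE.
Qed.

Let JDsym a k b q : V q -> 'D_(evec R a) J q k b = 'D_(evec R b) J q k a.
Proof.
move=> Vq; apply: (etrans (JD a k b Vq)); apply: etrans (esym (JD b k a Vq)).
exact: derive_comm Vo Vq (C_openW (CPhi k)).
Qed.

Let chain_mx m l (X : 'rV[R]_n -> 'M[R]_(m, l)) q a : V q -> mxC 1 U X ->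
  is_derive q (evec R a) (fun r => X (Phi r))
    (\sum_i J q i a *: 'D_(evec R i) X (Phi q)).
Proof.
move=> Vq CX; apply: is_derive_mx => c d.
rewrite summxE.
have -> : \sum_i (J q i a *: 'D_(evec R i) X (Phi q)) c d =
    \sum_i 'D_(evec R a) (fun q => Phi q 0 i) q
      * 'D_(evec R i) (fun r => X r c d) (Phi q).
  apply: eq_bigr => i _; rewrite [LHS]mxE [J q i a]mxE; congr (_ * _).
  by apply: derive_mxE; exact: mxC_derivable CX (VU Vq).
apply: chain_rule Uo (VU Vq) (CX c d) _ => k.
exact: C_open_derivable (CPhi k) Vq.
Qed.

Let A a (q : 'rV[R]_n) : 'M[R]_n := \sum_i J q i a *: conn H i (Phi q).

Let conn_sym_pullback a b k q : V q ->
  (A a q *m J q + 'D_(evec R a) J q) k b = (A b q *m J q + 'D_(evec R b) J q) k a.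
Proof.
move=> Vq; rewrite [LHS]mxE [RHS]mxE; congr (_ + _); last exact: JDsym.
have E x y : (A x q *m J q) k y =
    \sum_l \sum_i J q i x * conn H i (Phi q) k l * J q l y.
  rewrite mxE; apply: eq_bigr => l _; rewrite summxE mulr_suml.
  by apply: eq_bigr => i _; rewrite [X in X * _]mxE.
rewrite !E exchange_big/=; apply: eq_bigr => l _; apply: eq_bigr => i _.
by rewrite (conn_torsion_free Uo mH _ _ _ (VU Vq)); ring.
Qed.

(** The inhomogeneous transformation law of a connection. The right-hand side,
    lowered with J^T H, is torsion free and compatible with the pulled-back
    metric, so conn_unique applies. *)
Lemma conn_pullback a q : V q ->
  J q *m conn G a q = A a q *m J q + 'D_(evec R a) J q.
Proof.
move=> Vq.
pose T c := (J q)^T *m H (Phi q) *m (A c q *m J q + 'D_(evec R c) J q).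
have TG : G q *m conn G a q = T a.
  apply: (@conn_unique _ _ V G 1 mG q T a Vq).
    move=> x y e; rewrite /T [LHS]mxE [RHS]mxE; apply: eq_bigr => k _.
    exact: (congr1 (fun z => _ * z) (conn_sym_pullback x y k Vq)).
  move=> c.
  have dJ := mxC_is_derive c CJ Vq.
  have dH := chain_mx c Vq (mxC_le (isT : (1 <= 2)%N) CH).
  have dHA : \sum_i J q i c *: 'D_(evec R i) H (Phi q) =
      H (Phi q) *m A c q + (H (Phi q) *m A c q)^T.
    rewrite mulmx_sumr linear_sum/= -big_split/=; apply: eq_bigr => i _.
    rewrite -scalemxAr [in X in _ = _ + X]linearZ/= -scalerDr; congr (_ *: _).
    exact: (conn_compat Uo mH _ (VU Vq)).
  have [_ D] := is_derive_mulmx (is_derive_mulmx (is_derive_trmx dJ) dH) dJ.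
  transitivity ('D_(evec R c) (fun r => (J r)^T *m H (Phi r) *m J r) q).
    exact: (near_eq_derive_open (U := V)).
  apply: (etrans D); rewrite dHA; exact: pullback_compat_algebra (Hs Vq).
have JHu : (J q)^T *m H (Phi q) \in unitmx.
  by rewrite unitmx_mul unitmx_tr Ju// Hu.
rewrite -[LHS](mulKmx JHu) -[RHS](mulKmx JHu); congr (_ *m _).
by rewrite mulmxA -GH.
Qed.

Let CconnH i : mxC 1 U (conn H i).
Proof. by apply: mxC_conn => //; case: mH. Qed.

Let dA a b q : V q -> is_derive q (evec R a) (A b)
  (\sum_j ('D_(evec R a) J q j b *: conn H j (Phi q)
     + J q j b *: \sum_i J q i a *: 'D_(evec R i) (conn H j) (Phi q))).
Proof.
move=> Vq; apply: is_derive_sum_mx => j; apply: is_derive_scalemx.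
  by apply: is_derive_mx_entry; exact: mxC_derivable CJ Vq.
exact: chain_mx.
Qed.

(** Differentiating conn_pullback gives the hypotheses of gauge_algebra. In
    the curvature of the pulled-back connection A the derivatives of J then
    cancel by symmetry, which leaves the curvature of H. *)
Lemma curv_pullback a b p : V p ->
  J p *m curv G a b p =
  (\sum_i \sum_j (J p i a * J p j b) *: curv H i j (Phi p)) *m J p.
Proof.
move=> Vp.
have CC c : mxC 1 V (conn G c) by apply: mxC_conn => //; case: mG.
have dC c e : is_derive p (evec R e) (conn G c) ('D_(evec R e) (conn G c) p).
  exact: mxC_is_derive (CC c) Vp.
have dJ e : is_derive p (evec R e) J ('D_(evec R e) J p).
  exact: mxC_is_derive CJ Vp.
have dJJ c e : is_derive p (evec R e) (fun q => 'D_(evec R c) J q)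
    ('D_(evec R e) (fun q => 'D_(evec R c) J q) p).
  exact: mxC_is_derive (mxC_derive c Vo CJ) Vp.
set DA := fun x y => \sum_j ('D_(evec R x) J p j y *: conn H j (Phi p)
     + J p j y *: \sum_i J p i x *: 'D_(evec R i) (conn H j) (Phi p)).
have second x y : 'D_(evec R x) J p *m conn G y p + J p *m 'D_(evec R x) (conn G y) p
    = (DA x y *m J p + A y p *m 'D_(evec R x) J p)
      + 'D_(evec R x) (fun q => 'D_(evec R y) J q) p.
  have [_ L] := is_derive_mulmx (dJ x) (dC y x).
  have [_ RR] := is_deriveD_fun (is_derive_mulmx (dA x y Vp) (dJ x)) (dJJ y x).
  apply: (etrans (esym L)); apply: etrans RR.
  by apply: (near_eq_derive_open (U := V)) => // q; exact: conn_pullback.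
have Eab := second a b.
have Eba : 'D_(evec R b) J p *m conn G a p + J p *m 'D_(evec R b) (conn G a) p
    = (DA b a *m J p + A a p *m 'D_(evec R b) J p)
      + 'D_(evec R a) (fun q => 'D_(evec R b) J q) p.
  apply: (etrans (second b a)).
  exact: (congr1 (fun y => _ + y) (derive_comm_mx b a Vo Vp CJ)).
have := gauge_algebra (conn_pullback a Vp) (conn_pullback b Vp) Eab Eba.
have dcab : derivable (conn G a) p (evec R b) by have [] := dC a b.
have dcba : derivable (conn G b) p (evec R a) by have [] := dC b a.
rewrite -(curvE dcab dcba) => ->; congr (_ *m _).
have RH i j : curv H i j (Phi p) = 'D_(evec R i) (conn H j) (Phi p)
    - 'D_(evec R j) (conn H i) (Phi p)
    + (conn H i (Phi p) *m conn H j (Phi p) - conn H j (Phi p) *m conn H i (Phi p)).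
  by apply: curvE; exact: mxC_derivable (CconnH _) (VU Vp).
have AA x y : A x p *m A y p = \sum_i \sum_j
    (J p i x * J p j y) *: (conn H i (Phi p) *m conn H j (Phi p)).
  rewrite mulmx_suml; apply: eq_bigr => i _; rewrite mulmx_sumr.
  by apply: eq_bigr => j _; rewrite -scalemxAl -scalemxAr scalerA.
have DAE x y : DA x y = \sum_j 'D_(evec R x) J p j y *: conn H j (Phi p)
    + \sum_i \sum_j (J p i x * J p j y) *: 'D_(evec R i) (conn H j) (Phi p).
  rewrite /DA big_split/=; congr (_ + _); rewrite exchange_big/=.
  apply: eq_bigr => j _; rewrite scaler_sumr; apply: eq_bigr => i _.
  by rewrite scalerA mulrC.
have sw : \sum_j 'D_(evec R b) J p j a *: conn H j (Phi p) =
          \sum_j 'D_(evec R a) J p j b *: conn H j (Phi p).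
  apply: eq_bigr => j _.
  exact: (congr1 (fun y => y *: conn H j (Phi p)) (JDsym b j a Vp)).
rewrite !DAE sw !AA.
rewrite [X in _ - (_ + X)]exchange_big/= [X in _ + (_ - X)]exchange_big/=.
have cancel (s X Y : 'M[R]_n) : s + X - (s + Y) = X - Y.
  by rewrite opprD addrACA subrr add0r.
rewrite cancel -!sumrB -big_split/=; apply: eq_bigr => i _.
rewrite -!sumrB -big_split/=; apply: eq_bigr => j _.
by rewrite RH [J p j b * _]mulrC -!scalerBr -scalerDr.
Qed.

End Pullback.

(** * Sectional curvature *)

Section Bilin.
Context {R : realType} {n : nat}.
Implicit Types (g : 'M[R]_n) (u v w : 'rV[R]_n) (a b : R).

Lemma bilinDl g u v w : bilin g (u + v) w = bilin g u w + bilin g v w.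
Proof. by rewrite /bilin !mulmxDl mxE. Qed.

Lemma bilinDr g u v w : bilin g u (v + w) = bilin g u v + bilin g u w.
Proof. by rewrite /bilin linearD/= mulmxDr mxE. Qed.

Lemma bilinZl g a u w : bilin g (a *: u) w = a * bilin g u w.
Proof. by rewrite /bilin -!scalemxAl mxE. Qed.

Lemma bilinZr g a u w : bilin g u (a *: w) = a * bilin g u w.
Proof. by rewrite /bilin linearZ/= -scalemxAr mxE. Qed.

Lemma trmx11 (m : 'M[R]_1) : m^T = m.
Proof. by apply/matrixP => i j; rewrite !ord1 mxE. Qed.

Lemma bilin_tr g u v : bilin g u v = bilin g^T v u.
Proof. by rewrite /bilin -[u *m g *m v^T]trmx11 !trmx_mul trmxK mulmxA. Qed.

Lemma bilinC g u v : g^T = g -> bilin g u v = bilin g v u.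
Proof. by move=> gT; rewrite bilin_tr gT. Qed.

Lemma bilinE g u v : bilin g u v = \sum_i \sum_j u 0 i * v 0 j * g i j.
Proof.
rewrite /bilin mxE exchange_big/=; apply: eq_bigr => j _.
by rewrite !mxE mulr_suml; apply: eq_bigr => i _; ring.
Qed.

Lemma bilin_mulmx k (h : 'M[R]_k) (J : 'M[R]_(k, n)) u v :
  bilin (J^T *m h *m J) u v = (u *m J^T *m h *m (v *m J^T)^T) 0 0.
Proof. by rewrite /bilin trmx_mul trmxK !mulmxA. Qed.

End Bilin.

Section Sectional.
Context {R : realType} {n : nat}.
Implicit Types (G H : 'rV[R]_n -> 'M[R]_n) (p u v w : 'rV[R]_n) (a b : 'I_n).

(** The endomorphism R(u, v). *)
Definition curv_op G p u v : 'M[R]_n :=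
  \sum_a \sum_b (u 0 a * v 0 b) *: curv G a b p.

Lemma curvature_vecE G p u v w : curvature_vec G p u v w = w *m (curv_op G p u v)^T.
Proof.
apply/rowP => d; rewrite !mxE.
transitivity (\sum_(a < n) \sum_(b < n) \sum_(c < n) w 0 c * (u 0 a * v 0 b * riemann G d c a b p)).
  by do 3 (apply: eq_bigr => ? _); ring.
rewrite exchange_big/=; under eq_bigr do rewrite exchange_big/=.
rewrite exchange_big/=; apply: eq_bigr => c _; rewrite !mxE summxE.
rewrite exchange_big/= mulr_sumr; apply: eq_bigr => a _.
rewrite summxE mulr_sumr; apply: eq_bigr => b _.
by rewrite !mxE.
Qed.

Lemma curv_opDr G p u v w : curv_op G p u (v + w) = curv_op G p u v + curv_op G p u w.
Proof.
rewrite /curv_op -big_split/=; apply: eq_bigr => a _.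
rewrite -big_split/=; apply: eq_bigr => b _.
by rewrite mxE mulrDr scalerDl.
Qed.

Lemma curv_opZr G p (c : R) u v : curv_op G p u (c *: v) = c *: curv_op G p u v.
Proof.
rewrite scaler_sumr; apply: eq_bigr => a _.
rewrite scaler_sumr; apply: eq_bigr => b _.
by rewrite mxE scalerA; congr (_ *: _); ring.
Qed.

Lemma curv_opZl G p (c : R) u v : curv_op G p (c *: u) v = c *: curv_op G p u v.
Proof.
rewrite scaler_sumr; apply: eq_bigr => a _.
rewrite scaler_sumr; apply: eq_bigr => b _.
by rewrite mxE scalerA; congr (_ *: _); ring.
Qed.

Lemma curv_op_alt G p u : curv_op G p u u = 0.
Proof.
have E : curv_op G p u u = - curv_op G p u u.
  rewrite {1}/curv_op exchange_big/= -sumrN; apply: eq_bigr => a _.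
  by rewrite -sumrN; apply: eq_bigr => b _; rewrite curv_anti scalerN mulrC.
apply/matrixP => i j; move/matrixP: E => /(_ i j); rewrite !mxE; lra.
Qed.

Definition sec_num G p u v : R := bilin (G p *m curv_op G p u v) u v.

Lemma sectional_curvatureE G p u v : (G p)^T = G p ->
  sectional_curvature G p u v = sec_num G p u v /
   (bilin (G p) u u * bilin (G p) v v - bilin (G p) u v ^+ 2).
Proof.
move=> gT; congr (_ / _); rewrite curvature_vecE /sec_num bilin_tr gT /bilin.
by rewrite trmx_mul trmxK !mulmxA.
Qed.

Lemma alternating_form (S : 'M[R]_n) u : S^T = - S -> bilin S u u = 0.
Proof.
move=> ST; have : bilin S u u = - bilin S u u.
  by rewrite {1}bilin_tr ST /bilin mulmxN mulNmx mxE.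
lra.
Qed.

Lemma curv_op_skew U G p u v : open U -> U p -> metric_on 2 U G ->
  (G p *m curv_op G p u v)^T = - (G p *m curv_op G p u v).
Proof.
move=> Uo Up mG; rewrite mulmx_sumr linear_sum/= -sumrN; apply: eq_bigr => a _.
rewrite mulmx_sumr linear_sum/= -sumrN; apply: eq_bigr => b _.
by rewrite -scalemxAr linearZ/= (curv_skew a b Uo Up mG) scalerN.
Qed.

(** Under a triangular change of basis the numerator scales like the squared
    area: the off-diagonal terms vanish because the curvature is alternating
    in both pairs of arguments. *)
Lemma sec_num_triangular U G p u v (a b c : R) :
  open U -> U p -> metric_on 2 U G ->
  sec_num G p (a *: u) (b *: v + c *: u) = (a * b) ^+ 2 * sec_num G p u v.
Proof.
move=> Uo Up mG; rewrite /sec_num curv_opZl curv_opDr !curv_opZr curv_op_alt.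
rewrite scaler0 addr0 scalerA -scalemxAr.
rewrite bilinDr !bilinZr !bilinZl.
have bz (k : R) (S : 'M[R]_n) x y : bilin (k *: S) x y = k * bilin S x y.
  by rewrite /bilin -scalemxAr -scalemxAl mxE.
by rewrite !bz (alternating_form _ (curv_op_skew u v Uo Up mG)); ring.
Qed.

Lemma row_free_pair u v (c : R) : row_free (col_mx u v) -> u != 0 /\ v + c *: u != 0.
Proof.
move=> uv; split; apply/eqP => E.
- have : row_mx 1%:M 0 *m col_mx u v == 0 :> 'rV[R]_n.
    by rewrite mul_row_col mul1mx mul0mx addr0 E.
  rewrite (mulmx_free_eq0 _ uv) => /eqP/rowP/(_ (lshift 1 0)).
  by rewrite row_mxEl !mxE eqxx => /eqP; rewrite oner_eq0.
- have : row_mx c%:M 1%:M *m col_mx u v == 0 :> 'rV[R]_n.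
    by rewrite mul_row_col mul1mx mul_scalar_mx addrC E.
  rewrite (mulmx_free_eq0 _ uv) => /eqP/rowP/(_ (rshift 1 0)).
  by rewrite row_mxEr !mxE eqxx => /eqP; rewrite oner_eq0.
Qed.

(** Gram-Schmidt is a triangular change of basis, so sec_num_triangular
    applies, and it turns the denominator into 1. *)
Lemma sectional_orthonormal U G p u v : open U -> U p -> metric_on 2 U G ->
  (forall w, w != 0 -> 0 < bilin (G p) w w) -> row_free (col_mx u v) ->
  exists u' v', [/\ bilin (G p) u' u' = 1, bilin (G p) v' v' = 1,
    bilin (G p) u' v' = 0 & sectional_curvature G p u v = sec_num G p u' v'].
Proof.
move=> Uo Up mG pG uv.
have gT : (G p)^T = G p by case: mG => _ + _; exact.
have [u0 _] := row_free_pair 0 uv.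
have uu := pG u u0; set A := bilin (G p) u u in uu.
set B := bilin (G p) u v.
have [_ w0] := row_free_pair (- (B / A)) uv.
have ww := pG _ w0; set w := v + _ in w0 ww.
have uw : bilin (G p) u w = 0.
  by rewrite bilinDr bilinZr -/A -/B; field; rewrite gt_eqF.
have wv : bilin (G p) w w = bilin (G p) v v - B ^+ 2 / A.
  rewrite {1}/w bilinDl bilinZl uw mulr0 addr0 bilinDr bilinZr.
  by rewrite (bilinC v u gT) -/B; field; rewrite gt_eqF.
set W := bilin (G p) w w in ww wv.
set a := (Num.sqrt A)^-1; set b := (Num.sqrt W)^-1.
have a2 : a ^+ 2 = A^-1 by rewrite exprVn sqr_sqrtr// ltW.
have b2 : b ^+ 2 = W^-1 by rewrite exprVn sqr_sqrtr// ltW.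
exists (a *: u), (b *: w); split.
- by rewrite bilinZl bilinZr mulrA -expr2 a2 mulVf// gt_eqF.
- by rewrite bilinZl bilinZr mulrA -expr2 b2 mulVf// gt_eqF.
- by rewrite bilinZl bilinZr uw !mulr0.
rewrite sectional_curvatureE// -/A -/B.
have -> : b *: w = b *: v + (- (b * (B / A))) *: u.
  by rewrite scalerDr scalerA mulrN.
rewrite (sec_num_triangular _ _ _ _ _ Uo Up mG) exprMn a2 b2.
have -> : A * bilin (G p) v v - B ^+ 2 = A * W.
  by rewrite wv; field; rewrite gt_eqF.
by rewrite invfM mulrC.
Qed.

End Sectional.

Section SectionalPullback.
Context {R : realType} {n : nat}.
Variables (V U : set 'rV[R]_n) (Phi : 'rV[R]_n -> 'rV[R]_n).
Variables (G H : 'rV[R]_n -> 'M[R]_n).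
Hypotheses (Vo : open V) (Uo : open U) (VU : forall q, V q -> U (Phi q)).
Hypothesis CPhi : forall k, C_open 3 V (fun q => Phi q 0 k).
Hypotheses (mG : metric_on 2 V G) (mH : metric_on 2 U H).
Hypothesis GH : forall q, V q ->
  G q = (jacobian_mx Phi q)^T *m H (Phi q) *m jacobian_mx Phi q.

(** The Jacobian carries one metric and one curvature endomorphism to the
    other, hence also the numerator and the denominator. *)
Lemma sectional_pullback p u v : V p ->
  sectional_curvature G p u v =
  sectional_curvature H (Phi p) (u *m (jacobian_mx Phi p)^T) (v *m (jacobian_mx Phi p)^T).
Proof.
move=> Vp; set J := jacobian_mx Phi p.
have gT : (G p)^T = G p by case: mG => _ + _; exact.
have hT : (H (Phi p))^T = H (Phi p) by case: mH => _ + _; apply; exact: VU.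
have B x y : bilin (G p) x y = bilin (H (Phi p)) (x *m J^T) (y *m J^T).
  by rewrite GH// bilin_mulmx.
rewrite !sectional_curvatureE// -!B; congr (_ / _).
have JC : J *m curv_op G p u v = curv_op H (Phi p) (u *m J^T) (v *m J^T) *m J.
  rewrite /curv_op mulmx_sumr.
  transitivity ((\sum_a \sum_b \sum_i \sum_j (u 0 a * v 0 b * (J i a * J j b))
      *: curv H i j (Phi p)) *m J).
    rewrite mulmx_suml; apply: eq_bigr => a _.
    rewrite mulmx_sumr mulmx_suml; apply: eq_bigr => b _.
    rewrite -scalemxAr (curv_pullback Vo Uo VU CPhi mG mH GH a b Vp) scalemxAl.
    congr (_ *m _); rewrite scaler_sumr; apply: eq_bigr => i _.
    by rewrite scaler_sumr; apply: eq_bigr => j _; rewrite scalerA.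
  congr (_ *m _).
  under eq_bigr do rewrite exchange_big/=.
  rewrite exchange_big/=; apply: eq_bigr => i _.
  under eq_bigr do rewrite exchange_big/=.
  rewrite exchange_big/=; apply: eq_bigr => j _.
  rewrite !mxE mulr_suml scaler_suml; apply: eq_bigr => a _.
  rewrite mulr_sumr scaler_suml; apply: eq_bigr => b _.
  by rewrite !mxE; congr (_ *: _); ring.
rewrite /sec_num GH// -/J -mulmxA JC /bilin trmx_mul trmxK.
by rewrite !mulmxA.
Qed.

End SectionalPullback.

(** * Conformal changes of metric *)

Section ConformalAlgebra.
Context {R : realType} {n : nat}.
Implicit Types (g X : 'M[R]_n) (e eta D : 'cV[R]_n) (xi : 'rV[R]_n).

(** With xi = dr, eta = grad r and e a vector, this is the endomorphism by
    which, up to scalar terms and the factor r^-1, the Levi-Civita connections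
    of g and r^-2 g differ in the direction e. *)
Definition conf_E g xi eta e : 'M[R]_n := e *m xi - eta *m (g *m e)^T.

(** The covariant derivative of conf_E in a direction with connection matrix
    X. The metric is parallel, so only the Hessian of r, contracted with that
    direction to h, and the change of e itself contribute. *)
Lemma conf_E_covariant g X xi eta e (Dxi : 'rV[R]_n) (Deta : 'cV[R]_n) :
  g^T = g -> g \in unitmx -> g *m eta = xi^T ->
  let DG := g *m X + (g *m X)^T in
  DG *m eta + g *m Deta = Dxi^T ->
  let h := Dxi^T - X^T *m xi^T in
  e *m Dxi - (Deta *m (g *m e)^T + eta *m (DG *m e)^T)
    + (X *m conf_E g xi eta e - conf_E g xi eta e *m X) =
  e *m h^T - invmx g *m h *m (g *m e)^T
    + ((X *m e) *m xi - eta *m (g *m (X *m e))^T).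
Proof.
move=> gT gu geta DG HD h.
have D1 : Deta = invmx g *m h - X *m eta.
  rewrite -[LHS](mulKmx gu) -[X *m eta](mulKmx gu) -mulmxBr; congr (_ *m _).
  rewrite /h -HD -geta /DG trmx_mul gT mulmxDl !mulmxA.
  move: (g *m X *m eta) (X^T *m g *m eta) (g *m Deta) => x y z.
  by apply/matrixP => i j; rewrite !mxE; ring.
have -> : h^T = Dxi - xi *m X by rewrite /h linearB/= trmx_mul !trmxK.
have T1 : (DG *m e)^T = (g *m (X *m e))^T + (g *m e)^T *m X.
  rewrite /DG mulmxDl linearD/= mulmxA; congr (_ + _).
  by rewrite trmx_mul trmxK trmx_mul gT mulmxA.
rewrite T1 D1 /conf_E; clear T1 D1; clearbody h.
rewrite !(mulmxBl, mulmxBr, mulmxDr, mulmxN, mulmxA).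
move: (e *m Dxi) (invmx g *m h *m (g *m e)^T) (X *m eta *m (g *m e)^T).
move: (eta *m (g *m X *m e)^T) (eta *m (g *m e)^T *m X) (X *m e *m xi) (e *m xi *m X).
by move=> *; apply/matrixP => i j; rewrite !mxE; ring.
Qed.

(** The quadratic part of the curvature of the difference of the two
    connections; s is the squared length of grad r and produces the constant
    curvature term. *)
Lemma conf_E_commutator g xi eta (ea eb : 'cV[R]_n) (ra rb s : R) :
  g^T = g -> g *m eta = xi^T -> xi *m ea = ra%:M -> xi *m eb = rb%:M ->
  xi *m eta = s%:M ->
  conf_E g xi eta ea *m conf_E g xi eta eb - conf_E g xi eta eb *m conf_E g xi eta ea =
  rb *: conf_E g xi eta ea - ra *: conf_E g xi eta eb
    - s *: (ea *m (g *m eb)^T - eb *m (g *m ea)^T).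
Proof.
move=> gT geta Ha Hb Hs.
have row_eta (e : 'cV[R]_n) (r : R) : xi *m e = r%:M -> (g *m e)^T *m eta = r%:M.
  move=> He; rewrite trmx_mul gT -mulmxA geta -[RHS]tr_scalar_mx -He.
  by rewrite trmx_mul.
have gs : (g *m ea)^T *m eb = (g *m eb)^T *m ea.
  by rewrite -[LHS]trmx11 trmx_mul trmxK trmx_mul gT mulmxA.
have prod (e f : 'cV[R]_n) (re rf : R) : xi *m e = re%:M -> xi *m f = rf%:M ->
    conf_E g xi eta e *m conf_E g xi eta f =
    rf *: (e *m xi) - s *: (e *m (g *m f)^T)
     - (eta *m ((g *m e)^T *m f) *m xi - re *: (eta *m (g *m f)^T)).
  move=> He Hf; rewrite /conf_E mulmxBl !mulmxBr.
  rewrite -[e *m xi *m (f *m xi)]mulmxA [xi *m (f *m xi)]mulmxA Hf mul_scalar_mx.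
  rewrite -[e *m xi *m (eta *m _)]mulmxA [xi *m (eta *m _)]mulmxA Hs mul_scalar_mx.
  rewrite -[eta *m _ *m (eta *m _)]mulmxA [_ *m (eta *m (g *m f)^T)]mulmxA.
  by rewrite (row_eta _ _ He) mul_scalar_mx -!scalemxAr !mulmxA.
rewrite (prod _ _ _ _ Ha Hb) (prod _ _ _ _ Hb Ha) gs /conf_E.
move: (eta *m ((g *m eb)^T *m ea) *m xi) (ea *m xi) (eb *m xi).
move: (ea *m (g *m eb)^T) (eb *m (g *m ea)^T) (eta *m (g *m eb)^T) (eta *m (g *m ea)^T).
by move=> *; apply/matrixP => i j; rewrite !mxE; ring.
Qed.

(** The curvature of the connection Xa - Ba, with Ba and Bb the two values of
    the difference tensor and DaBb, DbBa their derivatives. The scalar parts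
    ra and rb commute with everything, and the second derivative rab
    cancels. *)
Lemma conf_curvature_algebra (Xa Xb DaXb DbXa Ea Eb DaEb DbEa : 'M[R]_n)
    (ra rb rab r : R) : r != 0 ->
  let Ba := r^-1 *: (ra%:M + Ea) in
  let Bb := r^-1 *: (rb%:M + Eb) in
  let DaBb := - (r ^- 2 * ra) *: (rb%:M + Eb) + r^-1 *: (rab%:M + DaEb) in
  let DbBa := - (r ^- 2 * rb) *: (ra%:M + Ea) + r^-1 *: (rab%:M + DbEa) in
  (DaXb - DaBb) - (DbXa - DbBa)
    + ((Xa - Ba) *m (Xb - Bb) - (Xb - Bb) *m (Xa - Ba)) =
  (DaXb - DbXa + (Xa *m Xb - Xb *m Xa))
  + r ^- 2 *: (ra *: Eb - rb *: Ea + (Ea *m Eb - Eb *m Ea))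
  - r^-1 *: ((DaEb + (Xa *m Eb - Eb *m Xa)) - (DbEa + (Xb *m Ea - Ea *m Xb))).
Proof.
move=> r0 /=; rewrite !mulmxBl !mulmxBr -!scalemxAl -!scalemxAr !mulmxDl !mulmxDr.
have sc (x : R) : x%:M = x *: (1%:M : 'M[R]_n) by rewrite scalemx1.
rewrite !mul_scalar_mx !mul_mx_scalar (sc ra) (sc rb) (sc rab).
move: (Xa *m Xb) (Xb *m Xa) (Ea *m Eb) (Eb *m Ea) (Xa *m Eb) (Eb *m Xa) (Xb *m Ea) (Ea *m Xb).
move: (1%:M : 'M[R]_n).
by move=> *; apply/matrixP => i j; rewrite !mxE; field.
Qed.

(** The algebraic curvature tensor built from a symmetric form P by the
    Kulkarni-Nomizu product with g, as an endomorphism for each pair (a,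
    b). *)
Definition kulkarni_nomizu g (P : 'M[R]_n) (a b : 'I_n) : 'M[R]_n :=
  (evec R a)^T *m row b P - (evec R b)^T *m row a P
  + (invmx g *m P *m (evec R a)^T) *m row b g
  - (invmx g *m P *m (evec R b)^T) *m row a g.

Lemma evecTE (a i : 'I_n) j : (evec R a)^T i j = (i == a)%:R.
Proof. by rewrite mxE ord1 evecE. Qed.

Lemma mul_evecT m (X : 'M[R]_(m, n)) (a : 'I_n) i j : (X *m (evec R a)^T) i j = X i a.
Proof.
rewrite mxE (bigD1 a)//= evecTE eqxx mulr1 big1 ?addr0// => k ka.
by rewrite evecTE (negbTE ka) mulr0.
Qed.

Lemma evecT_mul m (X : 'M[R]_(1, m)) (a i : 'I_n) j :
  ((evec R a)^T *m X) i j = (i == a)%:R * X 0 j.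
Proof. by rewrite mxE big_ord1 evecTE. Qed.

(** The product of g with itself is twice the curvature tensor of constant
    curvature 1. *)
Lemma kulkarni_nomizu_shift g (P : 'M[R]_n) (x y : R) (a b : 'I_n) :
  g \in unitmx ->
  kulkarni_nomizu g (x *: P + y *: g) a b =
  x *: kulkarni_nomizu g P a b
  + (2 * y) *: ((evec R a)^T *m row b g - (evec R b)^T *m row a g).
Proof.
move=> gu.
have rowE c : row c (x *: P + y *: g) = x *: row c P + y *: row c g.
  by rewrite linearD/= !linearZ.
have invE : invmx g *m (x *: P + y *: g) = x *: (invmx g *m P) + y *: 1%:M.
  by rewrite mulmxDr -!scalemxAr mulVmx.
rewrite /kulkarni_nomizu !rowE invE !(mulmxDl, mulmxDr) -!(scalemxAl, scalemxAr) !mul1mx.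
move: ((evec R a)^T *m row b P) ((evec R b)^T *m row a P).
move: (invmx g *m P *m (evec R a)^T *m row b g) (invmx g *m P *m (evec R b)^T *m row a g).
move: ((evec R a)^T *m row b g) ((evec R b)^T *m row a g).
by move=> *; apply/matrixP => i j; rewrite !mxE; ring.
Qed.

Lemma row_evec m (X : 'M[R]_(n, m)) (a : 'I_n) : row a X = evec R a *m X.
Proof. by rewrite /evec -rowE. Qed.

Lemma kulkarni_nomizuE g (P : 'M[R]_n) (a b d c : 'I_n) :
  kulkarni_nomizu g P a b d c =
  (d == a)%:R * P b c - (d == b)%:R * P a c
  + (invmx g *m P) d a * g b c - (invmx g *m P) d b * g a c.
Proof.
rewrite /kulkarni_nomizu; set u := _ *m (evec R a)^T; set v := _ *m (evec R b)^T.
have entry (X Y Z W : 'M[R]_n) : (X - Y + Z - W) d c = X d c - Y d c + Z d c - W d c.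
  by rewrite !mxE.
rewrite entry !evecT_mul ![(row _ _) 0 c]mxE.
by rewrite [(u *m _) d c]mxE [(v *m _) d c]mxE !big_ord1 !mul_evecT !mxE.
Qed.

End ConformalAlgebra.

Section Conformal.
Context {R : realType} {n : nat}.
Implicit Types (a b c d : 'I_n).
Variables (V : set 'rV[R]_n) (G : 'rV[R]_n -> 'M[R]_n) (r : 'rV[R]_n -> R).
Hypotheses (Vo : open V) (mG : metric_on 2 V G) (Cr : C_open 2 V r).
Hypothesis r0 : forall q, V q -> r q != 0.

Let CG : mxC 2 V G. Proof. by case: mG. Qed.
Let Gu q : V q -> G q \in unitmx. Proof. by case: mG => _ _; exact. Qed.
Let Gs q : V q -> (G q)^T = G q. Proof. by case: mG => _ + _; exact. Qed.

Definition conformal (q : 'rV[R]_n) : 'M[R]_n := r q ^- 2 *: G q.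
Definition grad_covector (q : 'rV[R]_n) : 'rV[R]_n := \row_b 'D_(evec R b) r q.
Definition hessian (q : 'rV[R]_n) : 'M[R]_n :=
  \matrix_(a, b) ('D_(evec R a) (fun q => 'D_(evec R b) r q) q
                  - \sum_c christoffel G c a b q * 'D_(evec R c) r q).
Definition grad_norm2 (q : 'rV[R]_n) : R :=
  bilin (invmx (G q)) (grad_covector q) (grad_covector q).

Lemma conformal_metric : metric_on 2 V conformal.
Proof.
split.
- apply: mxC_scale Vo _ CG; apply: C_openV Vo _ _.
    by move=> q Vq; rewrite expf_neq0// r0.
  by under eq_fun do rewrite expr2; exact: C_openM.
- by move=> q Vq; rewrite linearZ/= Gs.
- move=> q Vq; rewrite unitmxE detZ unitrM -unitmxE Gu// andbT.
  by rewrite unitfE expf_neq0// invr_eq0 expf_neq0// r0.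
Qed.

Let xi := grad_covector.
Let eta (q : 'rV[R]_n) : 'cV[R]_n := invmx (G q) *m (xi q)^T.
Let rd a q := 'D_(evec R a) r q.
Let e a : 'cV[R]_n := (evec R a)^T.
Let E a (q : 'rV[R]_n) := conf_E (G q) (xi q) (eta q) (e a).
Let B a (q : 'rV[R]_n) : 'M[R]_n := (r q)^-1 *: ((rd a q)%:M + E a q).

Let Cxi : mxC 1 V xi.
Proof.
by move=> i b; under eq_fun do rewrite mxE; exact: C_open_derive Cr.
Qed.

Let CxiT : mxC 1 V (fun q => (xi q)^T).
Proof. by move=> i j; under eq_fun do rewrite mxE; exact: Cxi. Qed.

Let Ceta : mxC 1 V eta.
Proof.
apply: mxC_mulmx => //; apply: mxC_inv => //; exact: mxC_le CG.
Qed.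

Let Geta q : V q -> G q *m eta q = (xi q)^T.
Proof. by move=> Vq; rewrite mulKVmx// Gu. Qed.

Let dr a q : V q -> is_derive q (evec R a) r (rd a q).
Proof. by move=> Vq; apply/derivableP; exact: C_open_derivable Cr Vq. Qed.

Let drV a q : V q -> is_derive q (evec R a) (fun q => (r q)^-1) (- (r q ^- 2 * rd a q)).
Proof.
move=> Vq; have dr1 : derivable r q (evec R a) by have [] := dr a Vq.
split; first by apply: derivableV => //; exact: r0.
by rewrite deriveV ?r0// scaleNr.
Qed.

(** The right-hand side has the symmetry and compatibility that characterize
    the connection of r^-2 G by conn_unique. *)
Lemma conn_conformal a q : V q -> conn conformal a q = conn G a q - B a q.
Proof.
move=> Vq; have mH := conformal_metric.
have Hu : conformal q \in unitmx by case: mH => _ _; exact.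
have [T TD] : exists T : 'I_n -> 'M[R]_n,
    forall c, T c = conformal q *m (conn G c q - B c q).
  by exists (fun c => conformal q *m (conn G c q - B c q)).
have TE c x y : T c x y = r q ^- 2 * ((G q *m conn G c q) x y
   - (r q)^-1 * (rd c q * G q x y + (G q x c * rd y q - rd x q * G q y c))).
  rewrite TD /B /conformal -scalemxAl mxE; congr (_ * _).
  rewrite mulmxBr mxE; congr (_ + _).
  rewrite [LHS]mxE -scalemxAr [in LHS]mxE; congr (- (_ * _)).
  rewrite mulmxDr mul_mx_scalar mxE [X in X + _]mxE; congr (_ + _).
  rewrite /E /conf_E mulmxBr mulmxA [G q *m (eta q *m _)]mulmxA (Geta Vq).
  have sub (X Y : 'M[R]_n) : (X - Y) x y = X x y - Y x y by rewrite !mxE.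
  rewrite sub [X in X - _]mxE [X in _ - X]mxE !big_ord1 mul_evecT.
  by rewrite [((xi q)^T) x 0]mxE [((_ *m _)^T) 0 y]mxE mul_evecT !(mxE _ (fun=> _)).
have : conformal q *m conn conformal a q = T a.
  apply: (@conn_unique _ _ V conformal 1 mH q T a Vq).
    move=> x y k; rewrite !TE; congr (_ * _).
    have GX : (G q *m conn G x q) k y = (G q *m conn G y q) k x.
      rewrite [LHS]mxE [RHS]mxE; apply: eq_bigr => l _.
      by rewrite (conn_torsion_free Vo mG x y l Vq).
    rewrite GX.
    have -> : G q y x = G q x y by rewrite -[in LHS](Gs Vq) mxE.
    move: (rd x q) (rd y q) (rd k q) (G q k y) (G q k x) (G q x y) => *.
    by congr (_ - _ * _); ring.
  move=> c.
  have dG := mxC_is_derive c CG Vq.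
  have dV := drV c Vq.
  have dV2 := is_deriveM_fun dV dV.
  have dH := is_derive_scalemx dV2 dG.
  have D := @derive_val _ _ _ _ _ _ _ dH.
  transitivity ('D_(evec R c) (fun q => ((r q)^-1 * (r q)^-1) *: G q) q).
    apply: (near_eq_derive_open c Vo Vq) => q' _.
    by rewrite /conformal -invfM -expr2.
  apply: (etrans D); rewrite (conn_compat Vo mG c Vq).
  apply/matrixP => i j; have := TE c i j; have := TE c j i.
  have GC : G q j i = G q i j by rewrite -[in LHS](Gs Vq) mxE.
  move: (T c) (G q *m conn G c q) => t k; rewrite GC.
  move=> tji tij; rewrite !mxE tji tij.
  by have := r0 Vq; move: (r q) (rd c q) (rd i q) (rd j q) => *; field.
by rewrite TD => /(congr1 (mulmx (invmx (conformal q)))); rewrite !mulKmx.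
Qed.

Let dxi a q : V q -> is_derive q (evec R a) xi ('D_(evec R a) xi q).
Proof. exact: mxC_is_derive Cxi. Qed.
Let deta a q : V q -> is_derive q (evec R a) eta ('D_(evec R a) eta q).
Proof. exact: mxC_is_derive Ceta. Qed.
Let dG a q : V q -> is_derive q (evec R a) G ('D_(evec R a) G q).
Proof. exact: mxC_is_derive CG. Qed.

Let dEab a b q : 'M[R]_n := e b *m 'D_(evec R a) xi q
  - ('D_(evec R a) eta q *m (G q *m e b)^T + eta q *m ('D_(evec R a) G q *m e b)^T).

Let dE a b q : V q -> is_derive q (evec R a) (E b) (dEab a b q).
Proof.
move=> Vq; apply: is_deriveB_fun.
  have H := is_derive_mulmx (is_derive_cst (e b) q (evec R a)) (dxi a Vq).
  by rewrite mul0mx add0r in H.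
have H := is_derive_mulmx (dG a Vq) (is_derive_cst (e b) q (evec R a)).
rewrite mulmx0 addr0 in H.
exact: is_derive_mulmx (deta a Vq) (is_derive_trmx H).
Qed.

Let rdd a b q := 'D_(evec R a) (fun q => 'D_(evec R b) r q) q.

Let dBab a b q : 'M[R]_n := - (r q ^- 2 * rd a q) *: ((rd b q)%:M + E b q)
  + (r q)^-1 *: ((rdd a b q)%:M + dEab a b q).

Let dB a b q : V q -> is_derive q (evec R a) (B b) (dBab a b q).
Proof.
move=> Vq; apply: is_derive_scalemx; first exact: drV.
apply: is_deriveD_fun; last exact: dE.
have drd : is_derive q (evec R a) (rd b) (rdd a b q).
  by apply/derivableP; exact: C_open_derivable (C_open_derive b Cr) Vq.
have H := is_derive_scalemx drd (is_derive_cst (1%:M : 'M[R]_n) q (evec R a)).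
rewrite scaler0 addr0 scalemx1 in H.
have -> : (fun q0 => (rd b q0)%:M) = (fun q0 => rd b q0 *: (1%:M : 'M[R]_n)).
  by apply/funext => q'; rewrite scalemx1.
exact: H.
Qed.

Lemma hessian_sym q : V q -> (hessian q)^T = hessian q.
Proof.
move=> Vq; apply/matrixP => a b.
have T c : christoffel G c b a q = christoffel G c a b q.
  by have := conn_torsion_free Vo mG b a c Vq; rewrite !mxE.
have D : rdd b a q = rdd a b q by exact: derive_comm Vo Vq Cr.
rewrite mxE !mxE; apply: (etrans (congr1 (fun x => x - _) D)).
by congr (_ - _); apply: eq_bigr => c _; rewrite T.
Qed.

Let hess_row a q : V q ->
  row a (hessian q) = ('D_(evec R a) xi q - xi q *m conn G a q).
Proof.
move=> Vq; apply/rowP => i.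
have H : 'D_(evec R a) xi q 0 i = rdd a i q.
  apply: (etrans (derive_mxE _ _ _)); first exact: mxC_derivable Cxi Vq.
  by apply: (near_eq_derive_open a Vo Vq) => q' _; rewrite mxE.
have sub (X Y : 'rV[R]_n) : (X - Y) 0 i = X 0 i - Y 0 i by rewrite !mxE.
rewrite sub; apply: esym; apply: (etrans (congr1 (fun x => x - _) H)).
rewrite [in RHS]mxE [in RHS]mxE; congr (_ - _); rewrite mxE; apply: eq_bigr => c _.
by rewrite !mxE mulrC.
Qed.

Let row_G a q : V q -> (G q *m e a)^T = row a (G q).
Proof. by move=> Vq; rewrite trmx_mul trmxK Gs// row_evec. Qed.

Let xi_e a q : xi q *m e a = (rd a q)%:M.
Proof. by rewrite [LHS]mx11_scalar mul_evecT mxE. Qed.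

(** Inserting conn_conformal into the structure equation, the derivative of
    the difference tensor contributes the Hessian of r (conf_E_covariant) and
    its square contributes |dr|^2 (conf_E_commutator). *)
Lemma curv_conformal a b q : V q ->
  curv conformal a b q = curv G a b q + kulkarni_nomizu (G q)
    ((r q)^-1 *: hessian q + (- (grad_norm2 q / (2 * r q ^+ 2))) *: G q) a b.
Proof.
move=> Vq; have mH := conformal_metric.
have dconn (K : 'rV[R]_n -> 'M[R]_n) x y : metric_on 2 V K ->
    derivable (conn K x) q (evec R y).
  by move=> [CK _ Ku]; apply: mxC_derivable (mxC_conn x Vo Ku CK) Vq.
have DH x y : 'D_(evec R x) (conn conformal y) q =
    'D_(evec R x) (conn G y) q - dBab x y q.
  have dX : is_derive q (evec R x) (conn G y) ('D_(evec R x) (conn G y) q).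
    by apply: is_derive_fun; exact: dconn.
  have [_ D] := is_deriveB_fun dX (dB x y Vq).
  apply: etrans D; apply: (near_eq_derive_open x Vo Vq) => q' Vq'.
  exact: conn_conformal.
rewrite (curvE (dconn _ a b mH) (dconn _ b a mH)) !DH !conn_conformal//.
rewrite (curvE (dconn _ a b mG) (dconn _ b a mG)).
have rab : rdd b a q = rdd a b q by exact: derive_comm Vo Vq Cr.
have dBba : dBab b a q = - (r q ^- 2 * rd b q) *: ((rd a q)%:M + E a q)
    + (r q)^-1 *: ((rdd a b q)%:M + dEab b a q).
  exact: (congr1 (fun z => - (r q ^- 2 * rd b q) *: ((rd a q)%:M + E a q)
    + (r q)^-1 *: (z%:M + dEab b a q)) rab).
rewrite dBba.
have X := conf_curvature_algebra (conn G a q) (conn G b q) ('D_(evec R a) (conn G b) q)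
  ('D_(evec R b) (conn G a) q) (E a q) (E b q) (dEab a b q) (dEab b a q)
  (rd a q) (rd b q) (rdd a b q) (r0 Vq).
cbv zeta in X; apply: (etrans X); clear X dBba.
have cancel (Z X Y K : 'M[R]_n) : X - Y = K -> Z + X - Y = Z + K.
  by move=> <-; rewrite addrA.
apply: cancel.
have xe : xi q *m eta q = (grad_norm2 q)%:M.
  by rewrite [LHS]mx11_scalar /grad_norm2 /bilin /eta mulmxA.
rewrite (conf_E_commutator (Gs Vq) (Geta Vq) (xi_e a q) (xi_e b q) xe).
have cov x y : dEab x y q + (conn G x q *m E y q - E y q *m conn G x q) =
    e y *m row x (hessian q) - invmx (G q) *m (hessian q *m e x) *m row y (G q)
    + ((conn G x q *m e y) *m xi q - eta q *m (G q *m (conn G x q *m e y))^T).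
  have HD : 'D_(evec R x) G q *m eta q + G q *m 'D_(evec R x) eta q = ('D_(evec R x) xi q)^T.
    have [_ D1] := is_derive_mulmx (dG x Vq) (deta x Vq).
    have [_ D2] := is_derive_trmx (dxi x Vq).
    apply: (etrans (esym D1)); apply: etrans D2.
    by apply: (near_eq_derive_open x Vo Vq) => q' Vq'; exact: Geta.
  have HG := conn_compat Vo mG x Vq.
  have := @conf_E_covariant _ _ (G q) (conn G x q) (xi q) (eta q) (e y)
    ('D_(evec R x) xi q) ('D_(evec R x) eta q) (Gs Vq) (Gu Vq) (Geta Vq).
  rewrite -HG => /(_ HD) ->.
  have hx : ('D_(evec R x) xi q)^T - (conn G x q)^T *m (xi q)^T = hessian q *m e x.
    have := hess_row x Vq => /(congr1 trmx); rewrite linearB/= trmx_mul => <-.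
    by rewrite row_evec trmx_mul hessian_sym.
  have hrow : (hessian q *m e x)^T = row x (hessian q).
    by rewrite trmx_mul (hessian_sym Vq) trmxK row_evec.
  by rewrite hx hrow (row_G y Vq).
rewrite !cov.
have tors : conn G a q *m e b = conn G b q *m e a.
  apply/matrixP => i j; rewrite !mul_evecT.
  by rewrite (conn_torsion_free Vo mG a b i Vq).
rewrite tors (kulkarni_nomizu_shift _ _ _ _ _ (Gu Vq)) /kulkarni_nomizu.
rewrite (row_G a Vq) (row_G b Vq).
change ((evec R a)^T) with (e a); change ((evec R b)^T) with (e b).
change (conf_E (G q) (xi q) (eta q) (e a)) with (E a q).
change (conf_E (G q) (xi q) (eta q) (e b)) with (E b q).
rewrite !mulmxA; have := r0 Vq.
move: (e a *m row b (G q)) (e b *m row a (G q)) (e b *m row a (hessian q)) (e a *m row b (hessian q)).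
move: (invmx (G q) *m hessian q *m e a *m row b (G q)) (invmx (G q) *m hessian q *m e b *m row a (G q)).
move: (conn G b q *m e a *m xi q) (eta q *m (G q *m conn G b q *m e a)^T).
move: (E a q) (E b q) (rd a q) (rd b q) (r q) (grad_norm2 q) => *.
by apply/matrixP => i j; rewrite !mxE; field.
Qed.

End Conformal.

(** * Orthonormal frames and traces *)

Section Frames.
Context {R : realType} {n : nat}.
Variable g : 'M[R]_n.
Hypotheses (gT : g^T = g) (gpos : forall w : 'rV[R]_n, w != 0 -> 0 < bilin g w w).

Definition orthonormal_upto (k : nat) (f : nat -> 'rV[R]_n) : Prop :=
  forall i j, (i < k)%N -> (j < k)%N -> bilin g (f i) (f j) = (i == j)%:R.

Lemma posdef_unit : g \in unitmx.
Proof.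
rewrite -row_free_unit -kermx_eq0; apply/eqP/row_matrixP => i; rewrite row0.
have K : row i (kermx g) *m g = 0 by apply/sub_kermxP; exact: row_sub.
have [//|/gpos] := eqVneq (row i (kermx g)) 0.
by rewrite /bilin K mul0mx mxE ltxx.
Qed.

(** Fewer than n linear conditions leave a nonzero vector orthogonal to the
    family. *)
Lemma orthonormal_step k f : (k < n)%N -> orthonormal_upto k f ->
  exists w, orthonormal_upto k.+1 (fun i => if i == k then w else f i).
Proof.
move=> kn fo.
pose M : 'M[R]_(n, k) := \matrix_(i, j) (g *m (f j)^T) i 0.
(* the rows of kermx M are orthogonal to f 0, ..., f (k - 1) *)
pose w := nz_row (kermx M).
have w0 : w != 0.
  rewrite nz_row_eq0 -mxrank_eq0 mxrank_ker -lt0n subn_gt0.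
  exact: leq_ltn_trans (rank_leq_col M) kn.
have wM : w *m M = 0 by apply/sub_kermxP; exact: nz_row_sub.
have wf j : (j < k)%N -> bilin g w (f j) = 0.
  move=> jk; move/rowP: wM => /(_ (Ordinal jk)); rewrite [RHS]mxE => <-.
  by rewrite /bilin -mulmxA !mxE; apply: eq_bigr => i _; rewrite !mxE.
have ww := gpos w0; pose c := (Num.sqrt (bilin g w w))^-1.
have c2 : c * c * bilin g w w = 1.
  by rewrite -expr2 exprVn sqr_sqrtr ?ltW// mulVf// gt_eqF.
exists (c *: w) => i j; rewrite !ltnS => ik jk.
have [Ei|ni] := eqVneq i k; have [Ej|nj] := eqVneq j k.
- by rewrite Ei Ej eqxx bilinZl bilinZr mulrA c2.
- have jk' : (j < k)%N by rewrite ltn_neqAle nj.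
  by rewrite bilinZl wf// mulr0 Ei eq_sym (negbTE nj).
- have ik' : (i < k)%N by rewrite ltn_neqAle ni.
  by rewrite bilinZr bilinC// wf// mulr0 Ej (negbTE ni).
- by apply: fo; rewrite ltn_neqAle ?ni ?nj.
Qed.

Lemma orthonormal_extend k f : (k <= n)%N -> orthonormal_upto k f ->
  exists f', orthonormal_upto n f' /\ forall i, (i < k)%N -> f' i = f i.
Proof.
move=> kn; have [m] := ubnP (n - k); elim: m k f kn => // m IH k f kn.
rewrite ltnS => nk fo; move: kn; rewrite leq_eqVlt => /orP[/eqP kn|kn].
  by exists f; split=> // i j ni nj; apply: fo; rewrite kn.
have [w wo] := orthonormal_step kn fo.
have [|f' [fo' ff]] := IH _ _ kn _ wo.
  by apply: leq_trans nk; rewrite subnS prednK// subn_gt0.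
exists f'; split=> // i ik; rewrite ff ?ltn_eqF//.
exact: ltnW.
Qed.

(** If the rows of Q form an orthonormal frame then Q g Q^T = 1, so the
    inverse of g is Q^T Q. *)
Lemma frame_trace f (P : 'M[R]_n) : orthonormal_upto n f ->
  \tr (invmx g *m P) = \sum_(i < n) bilin P (f i) (f i).
Proof.
move=> fo; pose Q : 'M[R]_n := \matrix_(i < n) f i.
have entry (S : 'M[R]_n) i j : (Q *m S *m Q^T) i j = bilin S (f i) (f j).
  rewrite /bilin !mxE; apply: eq_bigr => c _; rewrite !mxE.
  by congr (_ * _); apply: eq_bigr => l _; rewrite !mxE.
have QgQ : Q *m g *m Q^T = 1%:M.
  by apply/matrixP => i j; rewrite entry fo// mxE.
have gQ : g *m (Q^T *m Q) = 1%:M.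
  by rewrite mulmxA; apply: mulmx1C; rewrite mulmxA.
have -> : invmx g = Q^T *m Q.
  by rewrite -[RHS](mulKmx posdef_unit) gQ mulmx1.
rewrite -mulmxA mxtrace_mulC /mxtrace; apply: eq_bigr => i _.
by rewrite -entry.
Qed.

(** The case of frame_trace with a rank one form; all the other terms of the
    sum are squares. *)
Lemma frame_diag_inv f (i a : 'I_n) : orthonormal_upto n f ->
  f i 0 a ^+ 2 <= invmx g a a.
Proof.
move=> fo.
have := frame_trace (delta_mx a a) fo.
have -> : \tr (invmx g *m delta_mx a a) = invmx g a a.
  rewrite /mxtrace (bigD1 a)//= [X in X + _]mxE (bigD1 a)//= mxE !eqxx mulr1.
  rewrite big1 ?addr0 => [|k /negbTE ka]; last by rewrite mxE ka mulr0.
  rewrite big1 ?addr0// => k /negbTE ka; rewrite mxE big1// => l _.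
  by rewrite mxE ka andbF mulr0.
have sq j : bilin (delta_mx a a) (f j) (f j) = f j 0 a ^+ 2.
  rewrite bilinE (bigD1 a)//= (bigD1 a)//= mxE !eqxx mulr1 expr2.
  rewrite big1 ?addr0 => [|k /negbTE ka]; last by rewrite mxE ka andbF mulr0.
  rewrite big1 ?addr0// => k /negbTE ka; rewrite big1// => l _.
  by rewrite mxE ka mulr0.
move=> ->; rewrite (bigD1 i)//= sq lerDl; apply: sumr_ge0 => j _.
by rewrite sq sqr_ge0.
Qed.

End Frames.

Section Traces.
Context {R : realType} {n : nat}.
Implicit Types (g P : 'M[R]_n).

Lemma kulkarni_nomizu_trace g P b c : g^T = g -> g \in unitmx -> P^T = P ->
  \sum_a kulkarni_nomizu g P a b a c =
  (n%:R - 2) * P b c + \tr (invmx g *m P) * g b c.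
Proof.
move=> gT gu PT.
under eq_bigr do rewrite kulkarni_nomizuE.
rewrite sumrB big_split/= sumrB.
have -> : \sum_(i < n) (i == i)%:R * P b c = n%:R * P b c.
  by under eq_bigr do rewrite eqxx mul1r; rewrite sumr_const card_ord mulr_natl.
have -> : \sum_(i < n) (i == b)%:R * P i c = P b c.
  rewrite (bigD1 b)//= eqxx mul1r big1 ?addr0// => i /negbTE ->.
  by rewrite mul0r.
have -> : \sum_(i < n) (invmx g *m P) i i * g b c = \tr (invmx g *m P) * g b c.
  by rewrite /mxtrace mulr_suml.
have -> : \sum_(i < n) (invmx g *m P) i b * g i c = P b c.
  transitivity ((g *m (invmx g *m P)) c b); last by rewrite mulKVmx// -[in LHS]PT mxE.
  have gs i : g i c = g c i by rewrite -[in LHS]gT mxE.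
  by rewrite [RHS]mxE; apply: eq_bigr => i _; rewrite mulrC gs.
ring.
Qed.

Lemma trace_pairing g P : P^T = P ->
  \sum_(b < n) \sum_(c < n) g b c * P b c = \tr (g *m P).
Proof.
move=> PT; apply: eq_bigr => b _; rewrite mxE; apply: eq_bigr => c _.
by rewrite -[in LHS]PT mxE.
Qed.

(** On an orthonormal pair the cross terms vanish and two of the four terms
    survive. *)
Lemma kulkarni_nomizu_sec g P (u v : 'rV[R]_n) : g^T = g -> g \in unitmx -> P^T = P ->
  bilin g u u = 1 -> bilin g v v = 1 -> bilin g u v = 0 ->
  bilin (g *m \sum_a \sum_b (u 0 a * v 0 b) *: kulkarni_nomizu g P a b) u v =
  bilin P u u + bilin P v v.
Proof.
move=> gT gu PT uu vv uv.
have ue (w : 'rV[R]_n) : \sum_a w 0 a *: (evec R a)^T = w^T.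
  apply/colP => i; rewrite summxE [RHS]mxE (bigD1 i)//= mxE evecTE eqxx mulr1.
  by rewrite big1 ?addr0// => j ji; rewrite mxE evecTE eq_sym (negbTE ji) mulr0.
have re (S : 'M[R]_n) (w : 'rV[R]_n) : \sum_b w 0 b *: row b S = w *m S.
  apply/rowP => i; rewrite summxE mxE; apply: eq_bigr => b _.
  by rewrite !mxE.
have -> : \sum_a \sum_b (u 0 a * v 0 b) *: kulkarni_nomizu g P a b =
    u^T *m (v *m P) - v^T *m (u *m P)
    + (invmx g *m P *m u^T) *m (v *m g) - (invmx g *m P *m v^T) *m (u *m g).
  have prod (w z : 'rV[R]_n) (X S : 'M[R]_n) :
      \sum_a \sum_b (w 0 a * z 0 b) *: (X *m (evec R a)^T *m row b S) =
      X *m w^T *m (z *m S).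
    rewrite -(ue w) [X *m _]mulmx_sumr mulmx_suml; apply: eq_bigr => a _.
    rewrite -(re S z) mulmx_sumr; apply: eq_bigr => b _.
    by rewrite -!scalemxAr -!scalemxAl scalerA mulrC.
  transitivity (\sum_a \sum_b ((u 0 a * v 0 b) *: (1%:M *m (evec R a)^T *m row b P)
    - (v 0 b * u 0 a) *: (1%:M *m (evec R b)^T *m row a P)
    + (u 0 a * v 0 b) *: (invmx g *m P *m (evec R a)^T *m row b g)
    - (v 0 b * u 0 a) *: (invmx g *m P *m (evec R b)^T *m row a g))).
    apply: eq_bigr => a _; apply: eq_bigr => b _; rewrite /kulkarni_nomizu.
    by rewrite !mul1mx [v 0 b * _]mulrC -scalerBr -scalerDr -scalerBr.
  have split4 (X Y Z W : 'I_n -> 'I_n -> 'M[R]_n) :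
      \sum_a \sum_b (X a b - Y a b + Z a b - W a b) =
      \sum_a \sum_b X a b - \sum_b \sum_a Y a b + \sum_a \sum_b Z a b
      - \sum_b \sum_a W a b.
    rewrite [\sum_b \sum_a Y a b]exchange_big/= [\sum_b \sum_a W a b]exchange_big/=.
    rewrite -sumrB -big_split/= -sumrB; apply: eq_bigr => a _.
    by rewrite -sumrB -big_split/= -sumrB.
  by rewrite split4 !prod !mul1mx.
have outer (x z : 'rV[R]_n) (y w : 'rV[R]_n) (S : 'M[R]_n) (T : 'M[R]_n) :
    (u *m (S *m x^T *m (z *m T)) *m v^T) 0 0 = bilin S u x * bilin T z v.
  rewrite /bilin mulmxA -[u *m (S *m x^T) *m (z *m T) *m v^T]mulmxA.
  by rewrite [LHS]mxE big_ord1 !mulmxA.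
have distr : bilin (g *m (u^T *m (v *m P) - v^T *m (u *m P)
    + (invmx g *m P *m u^T) *m (v *m g) - (invmx g *m P *m v^T) *m (u *m g))) u v =
    bilin g u u * bilin P v v - bilin g u v * bilin P u v
    + bilin P u u * bilin g v v - bilin P u v * bilin g u v.
  have K (w z : 'rV[R]_n) : g *m (invmx g *m P *m w^T *m (z *m g)) =
      P *m w^T *m (z *m g) by rewrite !mulmxA mulmxV// mul1mx.
  rewrite /bilin !(mulmxDr, mulmxN) !K !(mulmxDr, mulmxN, mulmxDl, mulNmx) !mulmxA.
  have sub4 (X Y Z W : 'M[R]_1) : (X - Y + Z - W) 0 0 = X 0 0 - Y 0 0 + Z 0 0 - W 0 0.
    by rewrite !mxE.
  have o2 (x z : 'rV[R]_n) (S T : 'M[R]_n) :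
      (u *m S *m x^T *m z *m T *m v^T) 0 0 = bilin S u x * bilin T z v.
    by rewrite -(outer x z u v) !mulmxA.
  by rewrite sub4 !o2.
by rewrite distr uu vv uv; ring.
Qed.

End Traces.

(** * The curvature of r^-2 G compared with that of hyperbolic space *)

Section BilinMatrix.
Context {R : realType} {n : nat}.
Implicit Types (S T : 'M[R]_n) (u v : 'rV[R]_n).

Lemma bilin_addmx S T u v : bilin (S + T) u v = bilin S u v + bilin T u v.
Proof. by rewrite /bilin mulmxDr mulmxDl mxE. Qed.

Lemma bilin_scalemx (k : R) S u v : bilin (k *: S) u v = k * bilin S u v.
Proof. by rewrite /bilin -scalemxAr -scalemxAl mxE. Qed.

End BilinMatrix.

Section ConformalConsequences.
Context {R : realType} {n : nat}.
Variables (V : set 'rV[R]_n) (G : 'rV[R]_n -> 'M[R]_n) (r : 'rV[R]_n -> R).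
Hypotheses (Vo : open V) (mG : metric_on 2 V G) (Cr : C_open 2 V r).
Hypothesis r0 : forall q, V q -> r q != 0.
Let H := conformal G r.

Definition laplacian (q : 'rV[R]_n) : R := \tr (invmx (G q) *m hessian G r q).

(** By trace_defect_form this is r^2 times the trace of defect_form; in this
    form it is regular where r vanishes. *)
Definition hyperbolic_defect (q : 'rV[R]_n) : R :=
  r q * laplacian q + n%:R / 2 * (1 - grad_norm2 G r q).

(** The form of curv_conformal is this one minus half of the metric r^-2 G,
    and that half accounts exactly for a constant curvature -1. *)
Definition defect_form (q : 'rV[R]_n) : 'M[R]_n :=
  (r q)^-1 *: hessian G r q + ((1 - grad_norm2 G r q) / (2 * r q ^+ 2)) *: G q.

Let P (q : 'rV[R]_n) : 'M[R]_n :=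
  (r q)^-1 *: hessian G r q + (- (grad_norm2 G r q / (2 * r q ^+ 2))) *: G q.

Variable q : 'rV[R]_n.
Hypothesis Vq : V q.

Let Gu : G q \in unitmx. Proof. by case: mG => _ _; exact. Qed.
Let Gs : (G q)^T = G q. Proof. by case: mG => _ + _; exact. Qed.
Let rq0 : r q != 0. Proof. exact: r0. Qed.
Let mH : metric_on 2 V H. Proof. exact: conformal_metric. Qed.

Let Psym : (P q)^T = P q.
Proof. by rewrite /P linearD/= !linearZ/= (hessian_sym Vo mG Cr Vq) Gs. Qed.

Let PE : P q = defect_form q + (- (2 * r q ^+ 2)^-1) *: G q.
Proof.
rewrite /P /defect_form; have := rq0.
move: (hessian G r q) (grad_norm2 G r q) (G q) (r q) => h s g x x0.
by apply/matrixP => i j; rewrite !mxE; field.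
Qed.

Let trg : \tr (invmx (G q) *m G q) = n%:R.
Proof. by rewrite mulVmx// mxtrace1. Qed.

Lemma trace_defect_form :
  r q ^+ 2 * \tr (invmx (G q) *m defect_form q) = hyperbolic_defect q.
Proof.
rewrite /defect_form mulmxDr -!scalemxAr linearD/= !linearZ/= trg.
rewrite -/(laplacian q) /hyperbolic_defect; have := rq0.
by move: (laplacian q) (grad_norm2 G r q) (r q) => l s x x0; field.
Qed.

Let trP : r q ^+ 2 * \tr (invmx (G q) *m P q) = hyperbolic_defect q - n%:R / 2.
Proof.
rewrite PE mulmxDr -scalemxAr linearD/= linearZ/= trg mulrDr trace_defect_form.
by have := rq0; move: (hyperbolic_defect q) (r q) => l x x0; field.
Qed.

Let ricci_entry K b c : ricci K q b c = \sum_a curv K a b q a c.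
Proof. by rewrite [LHS]mxE; apply: eq_bigr => a _; rewrite mxE. Qed.

Let ricci_conformal : ricci H q =
  ricci G q + (n%:R - 2) *: P q + \tr (invmx (G q) *m P q) *: G q.
Proof.
apply/matrixP => b c; rewrite [LHS]ricci_entry.
have E a : curv H a b q a c = curv G a b q a c + kulkarni_nomizu (G q) (P q) a b a c.
  by rewrite (curv_conformal Vo mG Cr r0 a b Vq) mxE.
rewrite (eq_bigr _ (fun a _ => E a)) big_split/=.
rewrite (kulkarni_nomizu_trace b c Gs Gu Psym) -ricci_entry.
by move: (ricci G q) => S; rewrite !mxE addrA.
Qed.

(** Passing from P to the defect form cancels the term (n - 1) H, so a lower
    bound on the Ricci curvature is a lower bound on the defect form. *)
Lemma ricci_conformal_form w : r q ^+ 2 *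
  (bilin (ricci H q) w w + (n%:R - 1) * bilin (H q) w w) =
  r q ^+ 2 * bilin (ricci G q) w w
  + (n%:R - 2) * (r q ^+ 2 * bilin (defect_form q) w w)
  + hyperbolic_defect q * bilin (G q) w w.
Proof.
have comb (A B C : 'M[R]_n) (k t : R) : bilin (A + k *: B + t *: C) w w =
    bilin A w w + k * bilin B w w + t * bilin C w w.
  by rewrite !bilin_addmx !bilin_scalemx.
have RB : bilin (ricci H q) w w = bilin (ricci G q) w w
    + (n%:R - 2) * bilin (P q) w w + \tr (invmx (G q) *m P q) * bilin (G q) w w.
  by rewrite ricci_conformal; exact: comb.
have PB : bilin (P q) w w = bilin (defect_form q) w w
    + (- (2 * r q ^+ 2)^-1) * bilin (G q) w w.
  rewrite PE; move: (defect_form q) (- _) => D k.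
  by rewrite bilin_addmx bilin_scalemx.
have HB : bilin (H q) w w = r q ^- 2 * bilin (G q) w w by exact: bilin_scalemx.
rewrite RB PB HB; have := trP; have := rq0.
move: (bilin (G q) w w) (bilin (defect_form q) w w) (bilin (ricci G q) w w).
move: (\tr _) (hyperbolic_defect q) (r q) => t d x g1 g2 g3 x0 Et.
have -> : d = x ^+ 2 * t + n%:R / 2 by rewrite Et subrK.
by field.
Qed.

(** The trace of the Ricci formula; the scalar curvature hypothesis is thereby
    one on hyperbolic_defect. *)
Lemma scalar_conformal : scalar_curvature H q + n%:R * (n%:R - 1) =
  r q ^+ 2 * scalar_curvature G q + 2 * (n%:R - 1) * hyperbolic_defect q.
Proof.
have inv : invmx (H q) = r q ^+ 2 *: invmx (G q).
  have Hu : H q \in unitmx by case: mH => _ _; exact.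
  have HV : H q *m (r q ^+ 2 *: invmx (G q)) = 1%:M.
    rewrite /H /conformal -scalemxAl -scalemxAr scalerA mulmxV//.
    by rewrite mulVf ?expf_neq0// scale1r.
  by rewrite -[RHS](mulKmx Hu) HV mulmx1.
have E : scalar_curvature H q = r q ^+ 2 * (scalar_curvature G q
    + (n%:R - 2) * \sum_(b < n) \sum_(c < n) invmx (G q) b c * P q b c
    + \tr (invmx (G q) *m P q) * \sum_(b < n) \sum_(c < n) invmx (G q) b c * G q b c).
  rewrite /scalar_curvature inv ricci_conformal !mulrDr.
  rewrite !mulr_sumr -!big_split/=; apply: eq_bigr => b _.
  rewrite !mulr_sumr -!big_split/=; apply: eq_bigr => c _.
  move: (ricci G q) (P q) (invmx (G q)) (G q) (\tr _) => X Y Z W t.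
  by rewrite !mxE; ring.
rewrite E (trace_pairing _ Psym) (trace_pairing _ Gs) trg.
have := trP; move: (\tr _) (scalar_curvature G q) (hyperbolic_defect q) => t s d Et.
have -> : d = r q ^+ 2 * t + n%:R / 2 by rewrite Et subrK.
by field.
Qed.

Lemma sec_num_conformal u v : bilin (G q) u u = 1 -> bilin (G q) v v = 1 ->
  bilin (G q) u v = 0 ->
  sec_num H q (r q *: u) (r q *: v) + 1 = r q ^+ 2 * sec_num G q u v
    + r q ^+ 2 * (bilin (defect_form q) u u + bilin (defect_form q) v v).
Proof.
move=> uu vv uv.
have := @sec_num_triangular _ _ V H q u v (r q) (r q) 0 Vo Vq mH.
rewrite scale0r addr0 => ->.
have opE : curv_op H q u v = curv_op G q u v +
    \sum_a \sum_b (u 0 a * v 0 b) *: kulkarni_nomizu (G q) (P q) a b.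
  rewrite /curv_op -big_split/=; apply: eq_bigr => a _.
  rewrite -big_split/=; apply: eq_bigr => b _.
  by rewrite (curv_conformal Vo mG Cr r0 a b Vq) scalerDr.
rewrite /sec_num opE {1}/H /conformal -scalemxAl mulmxDr scalerDr bilin_addmx.
rewrite !bilin_scalemx (kulkarni_nomizu_sec Gs Gu Psym uu vv uv) PE.
rewrite !bilin_addmx !bilin_scalemx uu vv; have := rq0.
move: (bilin _ u v) (bilin _ u u) (bilin _ v v) (r q) => A B C x x0.
by field.
Qed.

Hypothesis n2 : (2 <= n)%N.
Hypothesis Gpos : forall w, w != 0 -> 0 < bilin (G q) w w.

(** Traces against an orthonormal frame turn the lower bound on the Ricci
    curvature into a two-sided bound on the defect form: values that are
    bounded below and have a bounded sum are bounded. *)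
Lemma sectional_conformal_bound (K : R) :
  (forall u v, bilin (G q) u u = 1 -> bilin (G q) v v = 1 -> bilin (G q) u v = 0 ->
     `|sec_num G q u v| <= K) ->
  (forall w, bilin (G q) w w = 1 -> `|bilin (ricci G q) w w| <= K) ->
  (forall w, - (n%:R - 1) * bilin (H q) w w <= bilin (ricci H q) w w) ->
  forall u v, row_free (col_mx u v) ->
    `|sectional_curvature H q u v + 1| <=
    n.+1%:R * K * r q ^+ 2 + n%:R * `|hyperbolic_defect q|.
Proof.
move=> Hsec Hric Hlow u' v' uvf.
have r2 : 0 < r q ^+ 2 by rewrite exprn_even_gt0.
have Hpos w : w != 0 -> 0 < bilin (H q) w w.
  by move=> w0; rewrite bilin_scalemx mulr_gt0 ?invr_gt0// Gpos.
have [u1 [v1 [uu1 vv1 uv1 ->]]] := sectional_orthonormal Vo Vq mH Hpos uvf.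
pose u := (r q)^-1 *: u1; pose v := (r q)^-1 *: v1.
have uE : u1 = r q *: u by rewrite scalerA divff// scale1r.
have vE : v1 = r q *: v by rewrite scalerA divff// scale1r.
have HG x y : bilin (H q) (r q *: x) (r q *: y) = bilin (G q) x y.
  rewrite [LHS]bilin_scalemx bilinZl bilinZr; have := rq0.
  by move: (bilin _ _ _) (r q) => b c c0; field.
have uu : bilin (G q) u u = 1 by rewrite -HG -uE.
have vv : bilin (G q) v v = 1 by rewrite -HG -vE.
have uv : bilin (G q) u v = 0 by rewrite -HG -uE -vE.
rewrite uE vE sec_num_conformal//.
(* complete u, v to a frame, whose values s k of the defect form add up to the
   hyperbolic defect *)
have [f [fo f2]] : exists f, orthonormal_upto (G q) n f /\
    forall i, (i < 2)%N -> f i = if i == 0%N then u else v.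
  apply: (orthonormal_extend Gs Gpos n2 (f := fun i => if i == 0%N then u else v)).
  move=> [|[|//]] [|[|//]] _ _ /=; rewrite ?uu ?vv ?uv//.
  by rewrite (bilinC _ _ Gs).
pose s (k : nat) := r q ^+ 2 * bilin (defect_form q) (f k) (f k).
have sum_s : \sum_(k < n) s k = hyperbolic_defect q.
  by rewrite -mulr_sumr -(frame_trace Gpos _ fo) trace_defect_form.
have ff k : (k < n)%N -> bilin (G q) (f k) (f k) = 1.
  by move=> kn; rewrite fo// eqxx.
have slow k : (k < n)%N ->
    - (`|hyperbolic_defect q| + r q ^+ 2 * K) <= (n%:R - 2) * s k.
  move=> kn; have Hl : 0 <= r q ^+ 2 * (bilin (ricci H q) (f k) (f k)
      + (n%:R - 1) * bilin (H q) (f k) (f k)).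
    by rewrite mulr_ge0 ?(ltW r2)// -lerBlDr sub0r -mulNr.
  rewrite ricci_conformal_form ff// mulr1 -/(s k) in Hl.
  have : r q ^+ 2 * bilin (ricci G q) (f k) (f k) <= r q ^+ 2 * K.
    rewrite ler_wpM2l ?(ltW r2)//; apply: le_trans (Hric _ (ff k kn)).
    exact: ler_norm.
  have := ler_norm (hyperbolic_defect q); lra.
have K0 : 0 <= K by apply: le_trans (Hsec u v uu vv uv).
set D := `|_| + _ in slow.
have D0 : 0 <= D by rewrite addr_ge0// mulr_ge0// ltW.
have n2R : 2 <= n%:R :> R by rewrite (ler_nat _ 2).
have s01 : s 0%N + s 1%N = r q ^+ 2 * (bilin (defect_form q) u u + bilin (defect_form q) v v).
  by rewrite /s !f2//= mulrDr.
have split_sum : s 0%N + s 1%N + \sum_(2 <= k < n) s k = hyperbolic_defect q.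
  rewrite -sum_s -(big_mkord xpredT s) (big_ltn (leq_trans _ n2))//.
  by rewrite (big_ltn n2) addrA.
have bound : `|s 0%N + s 1%N| <= n%:R * D.
  have hd : `|hyperbolic_defect q| <= D by rewrite lerDl mulr_ge0// ltW.
  (* for n = 2 the inequality slow is empty, but the two values are the whole
     trace *)
  have [n2E|n3] := eqVneq n 2%N.
    have -> : s 0%N + s 1%N = hyperbolic_defect q.
      by rewrite -split_sum big_geq ?addr0// n2E.
    apply: le_trans hd _; nra.
  have n3R : 3 <= n%:R :> R by rewrite (ler_nat _ 3) ltn_neqAle eq_sym n3.
  have sl k : (k < n)%N -> - D <= s k.
    by move=> /slow; move: (s k) => x; nra.
  have low : - D *+ (n - 2) <= \sum_(2 <= k < n) s k.
    rewrite -sumr_const_nat big_nat [leRHS]big_nat; apply: ler_sum => k /andP[_].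
    exact: sl.
  rewrite -mulr_natr natrB// in low.
  rewrite ler_norml; apply/andP; split.
    have := sl 0%N (leq_trans _ n2); have := sl 1%N n2; move=> a /(_ isT) b.
    nra.
  have := ler_norm (hyperbolic_defect q); nra.
rewrite -s01; apply: le_trans (ler_normD _ _) _.
rewrite normrM (ger0_norm (ltW r2)).
have := Hsec u v uu vv uv => Hs.
have : r q ^+ 2 * `|sec_num G q u v| <= r q ^+ 2 * K by rewrite ler_wpM2l// ltW.
move: bound; rewrite /D -natr1; move: (`|s _ + _|) (`|hyperbolic_defect q|) (`|sec_num _ _ _ _|).
by move=> x y z b1 b2; lra.
Qed.

End ConformalConsequences.

(** * Local bounds on curvature *)

Section Bounds.
Context {R : realType}.

Lemma ler_norm_sum_const n (f : 'I_n -> R) (C : R) :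
  (forall i, `|f i| <= C) -> `|\sum_i f i| <= n%:R * C.
Proof.
move=> fC; apply: le_trans (ler_norm_sum _ _ _) _.
apply: le_trans (ler_sum _ (fun i _ => fC i)) _.
by rewrite sumr_const card_ord mulr_natl.
Qed.

Lemma ler_normM2 (x y a b : R) : `|x| <= a -> `|y| <= b -> `|x * y| <= a * b.
Proof. by move=> xa yb; rewrite normrM ler_pM. Qed.

(** The index set is finite, so one neighbourhood serves for all the
    components of a tensor. *)
Lemma near_bounded n (I : finType) (F : I -> 'rV[R]_n -> R) (p : 'rV[R]_n) :
  (forall i, {for p, continuous (F i)}) ->
  exists2 B : R, 1 <= B & \forall q \near p, forall i, `|F i q| <= B.
Proof.
move=> Fc; exists (1 + \sum_i `|F i p|).
  by rewrite lerDl sumr_ge0.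
apply: (@filter_forall _ I
  (fun i => [set q | `|F i q| <= 1 + \sum_i `|F i p|]) (nbhs p)) => i.
move/cvgrPdist_lt : (Fc i) => /(_ 1 ltr01); apply: filterS => q Fq /=.
have -> : F i q = F i p - (F i p - F i q) by rewrite opprB addrC subrK.
apply: le_trans (ler_normB _ _) _.
rewrite addrC; apply: lerD; first exact: ltW.
by rewrite (bigD1 i)//= lerDl sumr_ge0.
Qed.

Lemma near_bounded1 n (F : 'rV[R]_n -> R) (p : 'rV[R]_n) :
  {for p, continuous F} ->
  exists2 B : R, 1 <= B & \forall q \near p, `|F q| <= B.
Proof.
move=> Fc; have [B B1 nB] := @near_bounded n unit (fun=> F) p (fun=> Fc).
by exists B => //; apply: filterS nB => q /(_ tt).
Qed.

End Bounds.

Section CurvatureBounds.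
Context {R : realType} {n : nat}.
Implicit Types (G : 'rV[R]_n -> 'M[R]_n) (p q u v w : 'rV[R]_n).

Lemma C_open_riemann (k : nat) (U : set 'rV[R]_n) G (d c a b : 'I_n) : open U ->
  (forall p, U p -> G p \in unitmx) -> mxC k.+2 U G ->
  C_open k U (riemann G d c a b).
Proof.
move=> Uo Gu CG.
have Cc e f g' : C_open k.+1 U (christoffel G e f g') by exact: C_open_christoffel.
apply: C_openD => //; first by apply: C_openB => //; exact: C_open_derive (Cc _ _ _).
apply: C_open_sum => // e.
by apply: C_openB => //; apply: C_openM => //; exact: C_openW (Cc _ _ _).
Qed.

Lemma sec_num_bound G q u v (B : R) : 
  (forall a, `|u 0 a| <= B) -> (forall a, `|v 0 a| <= B) ->
  (forall a b, `|G q a b| <= B) -> (forall d c a b, `|riemann G d c a b q| <= B) ->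
  `|sec_num G q u v| <= n%:R * (n%:R * (B * B * (n%:R * (B * (n%:R * (n%:R * (B * B * B))))))).
Proof.
move=> uB vB GB RB; rewrite /sec_num bilinE.
apply: ler_norm_sum_const => i; apply: ler_norm_sum_const => j.
apply: ler_normM2; first exact: ler_normM2.
rewrite mxE; apply: ler_norm_sum_const => k; apply: ler_normM2 => //.
rewrite summxE; apply: ler_norm_sum_const => a.
rewrite summxE; apply: ler_norm_sum_const => b.
by rewrite !mxE; apply: ler_normM2 => //; exact: ler_normM2.
Qed.

Lemma ricci_bound G q b c (B : R) : 
  (forall d c a b, `|riemann G d c a b q| <= B) -> `|ricci G q b c| <= n%:R * B.
Proof. by move=> RB; rewrite mxE; exact: ler_norm_sum_const. Qed.

(** Completing w to a frame, frame_diag_inv bounds the squared components of w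
    by the diagonal of the inverse metric. *)
Lemma unit_vector_bound (g : 'M[R]_n) w (B : R) : (0 < n)%N ->
  g^T = g -> (forall w, w != 0 -> 0 < bilin g w w) -> 1 <= B ->
  (forall a b, `|invmx g a b| <= B) -> bilin g w w = 1 -> forall a, `|w 0 a| <= B.
Proof.
move=> n0 gT gpos B1 gB ww a.
have [f [fo f0]] : exists f, orthonormal_upto g n f /\
    forall i, (i < 1)%N -> f i = w.
  apply: (orthonormal_extend gT gpos n0 (f := fun=> w)).
  by move=> [|//] [|//] _ _ /=.
have := frame_diag_inv gpos (Ordinal n0) a fo; rewrite /= f0// => wa.
have := le_trans wa (le_trans (ler_norm _) (gB a a)).
rewrite -real_normK ?num_real//; have := normr_ge0 (w 0 a).
move: (`|w 0 a|) => z z0 zB.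
have BB : B <= B ^+ 2 by nra.
by rewrite -(ler_pXn2r (ltn0Sn 1)) ?nnegrE ?(le_trans zB)//; lra.
Qed.

(** The components of the metric, of its inverse and of the curvature are
    continuous. Symmetry and positivity are required pointwise only, because
    at a boundary point G is an extension across the boundary. *)
Lemma curvature_near_bounded (U : set 'rV[R]_n) G p : (0 < n)%N -> open U -> U p ->
  (forall p, U p -> G p \in unitmx) -> mxC 2 U G ->
  exists2 K : R, 0 <= K & \forall q \near p, (G q)^T = G q ->
    (forall w, w != 0 -> 0 < bilin (G q) w w) ->
    [/\ forall u v, bilin (G q) u u = 1 -> bilin (G q) v v = 1 -> `|sec_num G q u v| <= K,
        forall w, bilin (G q) w w = 1 -> `|bilin (ricci G q) w w| <= K
      & `|scalar_curvature G q| <= K].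
Proof.
move=> n0 Uo Up Gu CG.
have [B1 B11 nG] := @near_bounded R n ('I_n * 'I_n)%type
  (fun ij q => G q ij.1 ij.2) p (fun ij => C_open_continuous (CG ij.1 ij.2) Up).
have [B2 B21 nI] := @near_bounded R n ('I_n * 'I_n)%type
  (fun ij q => invmx (G q) ij.1 ij.2) p
  (fun ij => C_open_continuous (mxC_inv Uo Gu CG ij.1 ij.2) Up).
have [B3 B31 nR] := @near_bounded R n ('I_n * 'I_n * ('I_n * 'I_n))%type
  (fun ij => riemann G ij.1.1 ij.1.2 ij.2.1 ij.2.2) p
  (fun ij => C_open_continuous (C_open_riemann ij.1.1 ij.1.2 ij.2.1 ij.2.2 Uo Gu CG) Up).
pose B := B1 + B2 + B3.
have B1l : 1 <= B by rewrite /B; lra.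
have B0 : 0 <= B by lra.
pose N : R := n%:R.
have N0 : 0 <= N by exact: ler0n.
pose K1 := N * (N * (B * B * (N * (B * (N * (N * (B * B * B))))))).
pose K2 := N * (N * (B * B * (N * B))).
pose K3 := N * (N * (B * (N * B))).
have K10 : 0 <= K1 by rewrite !mulr_ge0.
have K20 : 0 <= K2 by rewrite !mulr_ge0.
have K30 : 0 <= K3 by rewrite !mulr_ge0.
exists (K1 + K2 + K3); first by rewrite !addr_ge0.
near=> q => gT gpos.
have GB a b : `|G q a b| <= B.
  have : `|G q a b| <= B1 by move: (a) (b) => a' b'; exact: (near nG q _ (a', b')).
  by rewrite /B; lra.
have IB a b : `|invmx (G q) a b| <= B.
  have : `|invmx (G q) a b| <= B2 by exact: (near nI q _ (a, b)).
  by rewrite /B; lra.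
have RB d c a b : `|riemann G d c a b q| <= B.
  have : `|riemann G d c a b q| <= B3 by exact: (near nR q _ (d, c, (a, b))).
  by rewrite /B; lra.
have wB := fun w ww => @unit_vector_bound (G q) w B n0 gT gpos B1l IB ww.
split=> [u v uu vv|w ww|].
- have := sec_num_bound (wB u uu) (wB v vv) GB RB; rewrite -/N -/K1; lra.
- suff : `|bilin (ricci G q) w w| <= K2 by lra.
  rewrite bilinE; apply: ler_norm_sum_const => i; apply: ler_norm_sum_const => j.
  by apply: ler_normM2; [apply: ler_normM2; exact: wB|exact: ricci_bound].
- suff : `|scalar_curvature G q| <= K3 by lra.
  apply: ler_norm_sum_const => i; apply: ler_norm_sum_const => j.
  by apply: ler_normM2; [exact: IB|exact: ricci_bound].
Unshelve. all: by end_near. Qed.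

End CurvatureBounds.

(** * Taylor expansion normal to the boundary *)

Section NormalTaylor.
Context {R : realType} {n : nat}.
Implicit Types (F : 'rV[R]_n -> R) (p q y v : 'rV[R]_n) (a : 'I_n).

Lemma derive_right_eq F y v (l : R) : derivable F y v ->
  (forall eps : R, 0 < eps -> exists2 delta : R, 0 < delta &
     forall h, 0 < h -> h < delta -> `|F (y + h *: v) - F y - h * l| <= eps * h) ->
  'D_v F y = l.
Proof.
move=> dF Fl; apply/eqP; rewrite -subr_eq0 -normr_le0; apply/ler_addgt0Pr => e e0.
rewrite add0r; have e2 : 0 < e / 2 by rewrite divr_gt0.
have /cvgrPdist_lt/(_ _ e2) : h^-1 *: ((F \o shift y) (h *: v) - F y) @[h --> 0^'] -->
  'D_v F y by exact: dF.
move=> /nbhs_ballP[r /= r0 Hr].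
have [d d0 Hd] := Fl _ e2.
pose h := Num.min r d / 2.
have m0 : 0 < Num.min r d by rewrite lt_min r0 d0.
have h0 : 0 < h by rewrite divr_gt0.
have hm : h < Num.min r d by rewrite /h; lra.
have hr : h < r by apply: lt_le_trans hm _; rewrite ge_min lexx.
have hd : h < d by apply: lt_le_trans hm _; rewrite ge_min lexx orbT.
have := Hd h h0 hd.
have : `|'D_v F y - h^-1 *: ((F \o shift y) (h *: v) - F y)| < e / 2.
  apply: Hr; last by rewrite gt_eqF.
  by rewrite /ball/= sub0r normrN gtr0_norm.
rewrite /= addrC [_ *: _ + _]addrC /GRing.scale/=.
move: ('D_v F y) (F (y + _)) (F y) => D A C H1 H2.
have H3 : `|h^-1 * (A - C) - l| <= e / 2.
  have -> : h^-1 * (A - C) - l = h^-1 * (A - C - h * l).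
    by field; rewrite gt_eqF.
  by rewrite normrM gtr0_norm ?invr_gt0// mulrC ler_pdivrMr.
have -> : D - l = (- (h^-1 * (A - C)) + D) + (h^-1 * (A - C) - l) by ring.
by rewrite [e]splitr; apply: le_trans (ler_normD _ _) (lerD (ltW H1) H3).
Qed.

Lemma MVT_normal F y a (t B : R) : 0 <= t ->
  (forall s, 0 <= s <= t -> derivable F (y + s *: evec R a) (evec R a)) ->
  (forall s, 0 <= s <= t -> `|'D_(evec R a) F (y + s *: evec R a)| <= B) ->
  F y = 0 -> `|F (y + t *: evec R a)| <= B * t.
Proof.
move=> t0 dF FB Fy.
have [s st E] := MVT_line_ge0 t0 dF.
rewrite Fy subr0 in E; rewrite E normrM ger0_norm// mulrC.
by rewrite ler_wpM2r// FB.
Qed.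

Definition foot a q : 'rV[R]_n := q - q 0 a *: evec R a.

Lemma foot0 a q : foot a q 0 a = 0.
Proof. by rewrite !mxE /evec !eqxx mulr1 subrr. Qed.

Lemma footK a q : foot a q + q 0 a *: evec R a = q.
Proof. exact: subrK. Qed.

Lemma foot_dist a p q (s : R) : p 0 a = 0 -> 0 <= s <= q 0 a ->
  `|foot a q + s *: evec R a - p| <= `|q - p|.
Proof.
move=> p0 /andP[s0 sq]; apply: row_norm_le => // j.
rewrite !mxE; have := coord_norm_le (q - p) j; rewrite !mxE eqxx /=.
have [->|ja] := eqVneq j a; last by rewrite !mulr0 subr0 addr0.
rewrite p0 !subr0 => qa; apply: le_trans qa.
have -> : q 0 a - q 0 a * true%:R + s * true%:R = s by rewrite !mulr1 subrr add0r.
by rewrite ger0_norm// (le_trans sq)// ler_norm.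
Qed.

(** The function F = x L + k (1 - s) is only once differentiable, but its
    normal derivative is the sum of a C^1 function m and of x times a
    continuous one. As F = o(t) forces that derivative to vanish on the
    hyperplane, m vanishes there, so m = O(t) and F = O(t^2). *)
Lemma defect_taylor (x L s : 'rV[R]_n -> R) (k : R) a p (rho : R) : 0 < rho ->
  p 0 a = 0 ->
  let W := [set q : 'rV[R]_n | `|q - p| < rho] in
  let F q := x q * L q + k * (1 - s q) in
  C_open 2 W x -> C_open 1 W L -> C_open 2 W s ->
  (forall y, W y -> y 0 a = 0 -> x y = 0 /\ s y = 1) ->
  (forall y, W y -> y 0 a = 0 -> forall eps : R, 0 < eps ->
     exists2 delta : R, 0 < delta & forall h, 0 < h -> h < delta ->
       `|F (y + h *: evec R a)| <= eps * h) ->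
  exists2 C : R, 0 <= C & exists2 rho' : R, 0 < rho' &
    forall q, `|q - p| < rho' -> 0 <= q 0 a -> `|F q| <= C * q 0 a ^+ 2.
Proof.
move=> rho0 pa W F Cx CL Cs xs0 Fo.
have Wo : open W by exact: open_norm_ball.
have Wp : W p by rewrite /W/= subrr normr0.
pose e := evec R a.
(* the part of the normal derivative of F without the factor x *)
pose m q := 'D_e x q * L q - k * 'D_e s q.
have Cm : C_open 1 W m.
  apply: (C_openB Wo); first exact: C_openM Wo (C_open_derive a Cx) CL.
  exact: C_openZ Wo (C_open_derive a Cs).
have dx q : W q -> derivable x q e by exact: C_open_derivable Cx.
have dL q : W q -> derivable L q e by exact: C_open_derivable CL.
have ds q : W q -> derivable s q e by exact: C_open_derivable Cs.
have dF q : W q -> is_derive q e F (m q + x q * 'D_e L q).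
  move=> Wq.
  have H1 := is_deriveM_fun (is_derive_fun (dx q Wq)) (is_derive_fun (dL q Wq)).
  have H2 := is_deriveB_fun (is_derive_cst (1 : R) q e) (is_derive_fun (ds q Wq)).
  have H3 := is_deriveM_fun (is_derive_cst k q e) H2.
  have [dH EH] := is_deriveD_fun H1 H3; split; first exact: dH.
  apply: (etrans EH); rewrite /m /cst.
  by move: ('D_e x q) ('D_e L q) ('D_e s q) => A B D; ring.
have m0 y : W y -> y 0 a = 0 -> m y = 0.
  move=> Wy ya; have [xy sy] := xs0 y Wy ya.
  have [dFy] := dF y Wy; rewrite xy mul0r addr0 => <-.
  apply: derive_right_eq dFy _ => eps eps0.
  have [d d0 Hd] := Fo y Wy ya _ eps0; exists d => // h h0 hd.
  by rewrite {2}/F xy sy mul0r subrr mulr0 addr0 mulr0 !subr0; exact: Hd.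
have [B1 B1l nB1] := near_bounded1 (C_open_continuous (C_open_derive a Cx) Wp).
have [B2 B2l nB2] := near_bounded1 (C_open_continuous (C_open_derive a CL) Wp).
have [B3 B3l nB3] := near_bounded1 (C_open_continuous (C_open_derive a Cm) Wp).
pose B := B1 + B2 + B3.
have /nbhs_ballP[r1 /= r10 Hr1] : \forall q \near p,
    [/\ `|'D_e x q| <= B, `|'D_e L q| <= B & `|'D_e m q| <= B].
  have [h1 h2 h3] : [/\ B1 <= B, B2 <= B & B3 <= B] by rewrite /B; split; lra.
  apply: filterS3 nB1 nB2 nB3 => q b1 b2 b3.
  by split; [exact: le_trans b1 h1|exact: le_trans b2 h2|exact: le_trans b3 h3].
have B1' : 1 <= B by rewrite /B; lra.
pose rho' := Num.min r1 rho.
exists (B + B * B); first by rewrite addr_ge0 ?mulr_ge0//; lra.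
exists rho'; first by rewrite lt_min r10 rho0.
move=> q qr qa0.
pose y := foot a q.
have inW t : 0 <= t <= q 0 a -> W (y + t *: e) /\ `|y + t *: e - p| < r1.
  move=> tq; have := foot_dist pa tq => /le_lt_trans/(_ qr).
  by rewrite lt_min => /andP[].
have bnd t : 0 <= t <= q 0 a -> [/\ `|'D_e x (y + t *: e)| <= B,
    `|'D_e L (y + t *: e)| <= B & `|'D_e m (y + t *: e)| <= B].
  by move=> /inW[_ tr]; apply: Hr1; rewrite -ball_normE /ball_/= distrC.
have Wy : W y.
  by have [] := inW 0 _; rewrite ?scale0r ?addr0// lexx qa0.
have ya : y 0 a = 0 := foot0 a q.
have mono t u : 0 <= u <= t -> t <= q 0 a -> 0 <= u <= q 0 a.
  by move=> /andP[-> ut] tq; exact: le_trans tq.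
have xB t : 0 <= t <= q 0 a -> `|x (y + t *: e)| <= B * t.
  move=> /andP[t0 tq]; apply: MVT_normal => // [u ut|u ut|].
  - by apply: dx; have [] := inW u (mono _ _ ut tq).
  - by have [] := bnd u (mono _ _ ut tq).
  - by have [] := xs0 y Wy ya.
have mB t : 0 <= t <= q 0 a -> `|m (y + t *: e)| <= B * t.
  move=> /andP[t0 tq]; apply: MVT_normal => // [u ut|u ut|].
  - by apply: (C_open_derivable Cm); have [] := inW u (mono _ _ ut tq).
  - by have [] := bnd u (mono _ _ ut tq).
  - exact: m0.
have FB t : 0 <= t <= q 0 a -> `|'D_e F (y + t *: e)| <= (B + B * B) * q 0 a.
  move=> tq; have [Wt _] := inW t tq; have [_ ->] := dF _ Wt.
  have tq' : t <= q 0 a by case/andP: tq.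
  have LB : `|'D_e L (y + t *: e)| <= B by have [] := bnd t tq.
  have := ler_normM2 (xB t tq) LB; have := mB t tq.
  have t0 : 0 <= t by case/andP: tq.
  move: (m _) (x _ * _) => M X M1 X1; apply: le_trans (ler_normD _ _) _; nra.
have E : F y = 0.
  by have [xy sy] := xs0 y Wy ya; rewrite /F xy sy mul0r subrr mulr0 addr0.
have := @MVT_normal F y a (q 0 a) ((B + B * B) * q 0 a) qa0 _ FB E.
rewrite footK expr2 mulrA; apply=> u uq.
by have [Wu _] := inW u uq; have [] := dF _ Wu.
Qed.

End NormalTaylor.

(** * Estimates near a point of the half-space *)

Section LocalEstimates.
Context {R : realType} {n : nat}.
Implicit Types (G : 'rV[R]_n -> 'M[R]_n) (x : 'rV[R]_n -> R) (p q u v w : 'rV[R]_n).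

Lemma open_coord_gt0 (a : 'I_n) : open [set q : 'rV[R]_n | 0 < q 0 a].
Proof.
rewrite openE => q /= qa; apply/nbhs_ballP; exists (q 0 a) => //= z.
rewrite -ball_normE /ball_/= => qz; have := coord_norm_le (q - z) a.
rewrite !mxE => /le_lt_trans/(_ qz); rewrite ltr_norml => /andP[_]; lra.
Qed.

Lemma C_open_grad_norm2 (k : nat) (U : set 'rV[R]_n) G x : open U ->
  (forall q, U q -> G q \in unitmx) -> mxC k U G -> C_open k.+1 U x ->
  C_open k U (grad_norm2 G x).
Proof.
move=> Uo Gu CG Cx; rewrite /grad_norm2; under eq_fun do rewrite bilinE.
apply: (C_open_sum _ _ Uo) => i; apply: (C_open_sum _ _ Uo) => j.
apply: (C_openM Uo); last exact: mxC_inv Uo Gu CG i j.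
under eq_fun do rewrite !mxE.
exact: C_openM Uo (C_open_derive i Cx) (C_open_derive j Cx).
Qed.

(** The Laplacian loses one derivative of the metric, through the Christoffel
    symbols; this is why F is C^1 and no better for a C^2 metric. *)
Lemma C_open_laplacian (k : nat) (U : set 'rV[R]_n) G x : open U ->
  (forall q, U q -> G q \in unitmx) -> mxC k.+1 U G -> C_open k.+2 U x ->
  C_open k U (laplacian G x).
Proof.
move=> Uo Gu CG Cx; rewrite /laplacian /mxtrace.
apply: (C_open_sum _ _ Uo) => a; under eq_fun do rewrite mxE.
apply: (C_open_sum _ _ Uo) => c; apply: (C_openM Uo).
  by apply: (mxC_inv Uo Gu); exact: mxC_le CG.
under eq_fun do rewrite mxE.
apply: (C_openB Uo); first exact: C_open_derive (C_open_derive a Cx).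
apply: (C_open_sum _ _ Uo) => d; apply: (C_openM Uo).
  exact: C_open_christoffel Uo Gu CG.
exact: C_open_derive (C_openW Cx).
Qed.

Lemma interior_estimate (U : set 'rV[R]_n) G p : (2 <= n)%N -> open U -> U p ->
  metric_on 2 U G -> (forall q, U q -> forall w, w != 0 -> 0 < bilin (G q) w w) ->
  exists2 C : R, 0 <= C & \forall q \near p, forall u v, row_free (col_mx u v) ->
    `|sectional_curvature G q u v + 1| <= C.
Proof.
move=> n2 Uo Up mG Gpos; have [CG Gs Gu] := mG.
have [K K0 nK] := curvature_near_bounded (leq_trans (isT : (0 < 2)%N) n2) Uo Up Gu CG.
exists (K + 1); first by rewrite addr_ge0.
have nU : \forall q \near p, U q by exact: open_nbhs_nbhs.
apply: filterS2 nK nU => q Kq Uq u v uv.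
have [KS _ _] := Kq (Gs q Uq) (Gpos q Uq).
have [u1 [v1 [uu vv uv1 ->]]] := sectional_orthonormal Uo Uq mG (Gpos q Uq) uv.
apply: le_trans (ler_normD _ _) _; rewrite normr1.
by apply: lerD; [exact: KS|exact: lexx].
Qed.

(** By scalar_conformal the hypothesis on the scalar curvature gives F = o(t),
    since x = O(t) and the scalar curvature of G is bounded; defect_taylor
    improves this to F = O(t^2), and sectional_conformal_bound concludes. The
    metric is given on a full ball so that derivatives at boundary points are
    ordinary ones. *)
Lemma boundary_estimate (a : 'I_n) p (rho : R) G x :
  let W := [set q : 'rV[R]_n | `|q - p| < rho] in
  let H := conformal G x in
  (2 <= n)%N -> 0 < rho -> p 0 a = 0 ->
  mxC 2 W G -> (forall q, W q -> G q \in unitmx) -> C_open 3 W x ->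
  (forall q, W q -> 0 < q 0 a -> [/\ (G q)^T = G q,
     forall w, w != 0 -> 0 < bilin (G q) w w & 0 < x q]) ->
  (forall y, W y -> y 0 a = 0 -> x y = 0 /\ grad_norm2 G x y = 1) ->
  (forall q, W q -> 0 < q 0 a -> forall w,
     - (n%:R - 1) * bilin (H q) w w <= bilin (ricci H q) w w) ->
  (forall eps : R, 0 < eps -> exists2 delta : R, 0 < delta &
     forall q, W q -> 0 < q 0 a -> q 0 a < delta ->
       `|scalar_curvature H q + n%:R * (n%:R - 1)| <= eps * q 0 a) ->
  exists2 C : R, 0 <= C & exists2 rho' : R, 0 < rho' &
    forall q, `|q - p| < rho' -> 0 < q 0 a ->
    forall u v, row_free (col_mx u v) ->
      `|sectional_curvature H q u v + 1| <= C * q 0 a ^+ 2.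
Proof.
move=> W H n2 rho0 pa CG Gu Cx Gpos bdry Hric Hscal.
have Wo : open W by exact: open_norm_ball.
have Wp : W p by rewrite /W/= subrr normr0.
pose V := W `&` [set q : 'rV[R]_n | 0 < q 0 a].
have Vo : open V by apply: openI => //; exact: open_coord_gt0.
have VW : V `<=` W by move=> q [].
have mG : metric_on 2 V G.
  split; first exact: mxC_sub VW CG.
  - by move=> q [Wq qa]; have [] := Gpos q Wq qa.
  - by move=> q [Wq _]; exact: Gu.
have CxV : C_open 2 V x by exact: C_open_sub VW (C_openW Cx).
have x0V q : V q -> x q != 0.
  by move=> [Wq qa]; have [_ _ x0] := Gpos q Wq qa; rewrite gt_eqF.
have [K K0 nK] := curvature_near_bounded (leq_trans (isT : (0 < 2)%N) n2) Wo Wp Gu CG.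
have [B B1 nB] := near_bounded1 (C_open_continuous (C_open_derive a Cx) Wp).
have [r1 r10 Hr1] : exists2 r1 : R, 0 < r1 & forall q, `|q - p| < r1 ->
   [/\ W q, `|'D_(evec R a) x q| <= B & 0 < q 0 a ->
     [/\ forall u v, bilin (G q) u u = 1 -> bilin (G q) v v = 1 -> `|sec_num G q u v| <= K,
        forall w, bilin (G q) w w = 1 -> `|bilin (ricci G q) w w| <= K
      & `|scalar_curvature G q| <= K]].
  have nW : \forall q \near p, W q by exact: open_nbhs_nbhs.
  have [r1 r10 Hr1] := nbhs_norm_ball (filterI nW (filterI nB nK)).
  exists r1 => // q qp; have [Wq [Bq Kq]] := Hr1 q qp.
  split=> // qa; have [Gs Gp _] := Gpos q Wq qa; exact: Kq.
pose W1 := [set q : 'rV[R]_n | `|q - p| < r1].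
have W1o : open W1 by exact: open_norm_ball.
have W1W : W1 `<=` W by move=> q /Hr1[].
have xB q : W1 q -> 0 <= q 0 a -> `|x q| <= B * q 0 a.
  move=> W1q qa0.
  have inW1 t : 0 <= t <= q 0 a -> W1 (foot a q + t *: evec R a).
    by move=> tq; exact: le_lt_trans (foot_dist pa tq) W1q.
  rewrite -{1}(footK a q); apply: MVT_normal => // [s sq|s sq|].
  - by apply: (C_open_derivable Cx); apply: W1W; exact: inW1.
  - by have [] := Hr1 _ (inW1 s sq).
  - have W1f : W1 (foot a q).
      by have := inW1 0; rewrite scale0r addr0; apply; rewrite lexx qa0.
    by have [] := bdry _ (W1W _ W1f) (foot0 a q).
have n2R : 2 <= n%:R :> R by rewrite (ler_nat _ 2).
have Fo y : W1 y -> y 0 a = 0 -> forall eps : R, 0 < eps ->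
    exists2 delta : R, 0 < delta & forall h, 0 < h -> h < delta ->
       `|hyperbolic_defect G x (y + h *: evec R a)| <= eps * h.
  move=> W1y ya eps eps0.
  have [d d0 Hd] := Hscal _ eps0.
  have [r2 r20 Hr2] := nbhs_ballP_open W1o W1y.
  have M0 : 0 < B ^+ 2 * K + 1 by rewrite ltr_wpDl// mulr_ge0// sqr_ge0.
  pose m := Num.min d (Num.min r2 (eps / (B ^+ 2 * K + 1))).
  exists m; first by rewrite !lt_min d0 r20 divr_gt0.
  move=> h h0; rewrite !lt_min => /and3P[hd hr2 hM].
  set q := y + _.
  have qa : q 0 a = h by rewrite !mxE ya !eqxx mulr1 add0r.
  have W1q : W1 q.
    apply: Hr2; rewrite addrC addKr; apply: le_lt_trans (norm_scale_evec _ _) _.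
    by rewrite gtr0_norm.
  have qa0 : 0 < q 0 a by rewrite qa.
  have [Wq _ /(_ qa0)[_ _ Kq]] := Hr1 q W1q.
  have Vq : V q by split.
  have S := Hd q Wq qa0; rewrite qa in S; have {}S := S hd.
  have E := scalar_conformal Vo mG CxV x0V Vq; rewrite E in S.
  have X := xB q W1q (ltW qa0); rewrite qa in X.
  have X2 : `|x q ^+ 2 * scalar_curvature G q| <= (B * h) * (B * h) * K.
    by rewrite expr2; apply: ler_normM2 => //; exact: ler_normM2.
  have hM' : h * (B ^+ 2 * K + 1) < eps by rewrite -ltr_pdivlMr.
  move: S X2; set Y := x q ^+ 2 * _; set D := hyperbolic_defect _ _ _ => S X2.
  have X3 : B * h * (B * h) * K <= eps * h.
    have -> : B * h * (B * h) * K = h * (B ^+ 2 * K) * h by ring.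
    rewrite ler_wpM2r ?ltW//; move: hM'; rewrite mulrDr mulr1; lra.
  have T : `|2 * (n%:R - 1) * D| <= eps * h + eps * h.
    have -> : 2 * (n%:R - 1) * D = (Y + 2 * (n%:R - 1) * D) - Y by ring.
    apply: le_trans (ler_normB _ _) _; apply: lerD => //; exact: le_trans X3.
  rewrite normrM ger0_norm in T; last by lra.
  have := normr_ge0 D; nra.
have Cx1 : C_open 3 W1 x by exact: C_open_sub W1W Cx.
have Gu1 q : W1 q -> G q \in unitmx by move=> /W1W; exact: Gu.
have CG1 : mxC 2 W1 G by exact: mxC_sub W1W CG.
have [C C0 [r3 r30 Hr3]] := @defect_taylor R n x (laplacian G x) (grad_norm2 G x)
  (n%:R / 2) a p r1 r10 pa (C_openW Cx1) (C_open_laplacian W1o Gu1 CG1 Cx1)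
  (C_open_grad_norm2 W1o Gu1 CG1 Cx1) (fun y W1y => bdry y (W1W y W1y)) Fo.
exists (n.+1%:R * K * B ^+ 2 + n%:R * C).
  apply: addr_ge0; apply: mulr_ge0 => //; last exact: sqr_ge0.
  exact: mulr_ge0.
exists (Num.min r1 r3); first by rewrite lt_min r10 r30.
move=> q; rewrite lt_min => /andP[qr1 qr3] qa u v uv.
have W1q : W1 q by [].
have [Wq _ /(_ qa)[K1 K2 _]] := Hr1 q qr1.
have Vq : V q by split.
have [Gs Gp _] := Gpos q Wq qa.
have := sectional_conformal_bound Vo mG CxV x0V Vq n2 Gp
  (fun u v uu vv _ => K1 u v uu vv) K2 (Hric q Wq qa) uv.
move=> /le_trans; apply.
have F := Hr3 q qr3 (ltW qa).
have X := xB q W1q (ltW qa).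
have X2 : x q ^+ 2 <= B ^+ 2 * q 0 a ^+ 2.
  rewrite -exprMn -real_normK ?num_real//.
  by apply: lerXn2r X; rewrite nnegrE// mulr_ge0// ?ltW//; lra.
rewrite mulrDl; apply: lerD; last by rewrite -mulrA ler_wpM2l.
by rewrite -[leRHS]mulrA; apply: ler_wpM2l X2; exact: mulr_ge0.
Qed.

End LocalEstimates.

(** * One-sided derivatives and locality *)

Section ChartAnalysis.
Context {R : realType} {n : nat}.
Implicit Types (U S : set 'rV[R]_n) (F f : 'rV[R]_n -> R) (p q v : 'rV[R]_n).
Implicit Types (a : 'I_n) (k : nat).

(** The one-sided derivatives taken in charts can thus be computed from
    extensions across the boundary, where the usual rules of calculus
    apply. *)
Lemma partial_right_derive a f F p : derivable F p (evec R a) -> f p = F p ->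
  (\forall h \near (0 : R)^'+, f (p + h *: evec R a) = F (p + h *: evec R a)) ->
  partial_right a f p = 'D_(evec R a) F p.
Proof.
move=> dF fp fF; apply: cvg_lim => //.
have L : h^-1 *: ((F \o shift p) (h *: evec R a) - F p) @[h --> 0^'] -->
    'D_(evec R a) F p by exact: dF.
apply: cvg_trans (cvg_dnbhs_at_right L); apply: near_eq_cvg.
apply: filterS fF => h fh.
by rewrite fh fp /= [_ *: evec R a + p]addrC.
Qed.

Lemma C_open_locally k U F : (forall p, U p -> exists W, [/\ open W, W p & C_open k W F]) ->
  C_open k U F.
Proof.
elim: k F => [|k IH] F loc.
  split=> // p Up; have [W [Wo Wp [cW _]]] := loc p Up; exact: cW.
split=> [p Up|a].
  by have [W [Wo Wp CW]] := loc p Up; exact: C_open_continuous CW Wp.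
split=> [p Up|].
  by have [W [Wo Wp CW]] := loc p Up; exact: C_open_derivable CW Wp.
apply: IH => p Up; have [W [Wo Wp CW]] := loc p Up.
by exists W; split=> //; exact: C_open_derive CW.
Qed.

Lemma C_on_open k U S f : open U -> U `<=` S -> C_on k S f -> C_open k U f.
Proof.
move=> Uo US CS; apply: C_open_locally => p Up.
have [W [F [Wo Wp CF Ff]]] := CS p (US p Up).
exists (W `&` U); split; [exact: openI|by []|].
apply: (@C_open_ext R n k (W `&` U) F f) => //; first exact: openI.
  by move=> q [Wq Uq]; apply: Ff => //; exact: US.
apply: C_open_sub CF; by move=> q [].
Qed.

Lemma derive_sign_ge0 F p v : derivable F p v ->
  (forall eps : R, 0 < eps -> exists h, [/\ 0 < h, h < eps & F p <= F (p + h *: v)]) ->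
  0 <= 'D_v F p.
Proof.
move=> dF Fh; rewrite leNgt; apply/negP => D0.
have e0 : 0 < - 'D_v F p by rewrite oppr_gt0.
have /cvgrPdist_lt/(_ _ e0) : h^-1 *: ((F \o shift p) (h *: v) - F p) @[h --> 0^'] -->
  'D_v F p by exact: dF.
move=> /nbhs_ballP[r /= r0 Hr].
have [h [h0 hr Fph]] := Fh r r0.
have : `|'D_v F p - h^-1 *: ((F \o shift p) (h *: v) - F p)| < - 'D_v F p.
  apply: Hr; last by rewrite gt_eqF.
  by rewrite /ball/= sub0r normrN gtr0_norm.
rewrite ltr_norml => /andP[+ _]; rewrite /= [_ *: v + p]addrC /GRing.scale/= opprK.
have : 0 <= h^-1 * (F (p + h *: v) - F p).
  by rewrite mulr_ge0 ?invr_ge0 ?subr_ge0// ltW.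
lra.
Qed.

Lemma derive_sign_le0 F p v : derivable F p v ->
  (forall eps : R, 0 < eps -> exists h, [/\ 0 < h, h < eps & F p <= F (p - h *: v)]) ->
  'D_v F p <= 0.
Proof.
move=> dF Fh; rewrite leNgt; apply/negP => D0.
have /cvgrPdist_lt/(_ _ D0) : h^-1 *: ((F \o shift p) (h *: v) - F p) @[h --> 0^'] -->
  'D_v F p by exact: dF.
move=> /nbhs_ballP[r /= r0 Hr].
have [h [h0 hr Fph]] := Fh r r0.
have : `|'D_v F p - (- h)^-1 *: ((F \o shift p) ((- h) *: v) - F p)| < 'D_v F p.
  apply: Hr; last by rewrite oppr_eq0 gt_eqF.
  by rewrite /ball/= sub0r normrN normrN gtr0_norm.
rewrite ltr_norml => /andP[_]; rewrite /= [_ *: v + p]addrC scaleNr /GRing.scale/=.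
have : 0 <= h^-1 * (F (p - h *: v) - F p).
  by rewrite mulr_ge0 ?invr_ge0 ?subr_ge0// ltW.
rewrite invrN mulNr; lra.
Qed.

Lemma row_cvg (T : Type) (Fil : set_system T) {FF : Filter Fil} (Phi : T -> 'rV[R]_n) p :
  (forall i, Phi t 0 i @[t --> Fil] --> p 0 i) -> Phi t @[t --> Fil] --> p.
Proof.
move=> H; apply/cvgrPdist_le => e e0.
have : \forall t \near Fil, forall i, `|p 0 i - Phi t 0 i| <= e.
  apply: (@filter_forall _ _ (fun i => [set t | `|p 0 i - Phi t 0 i| <= e]) Fil) => i.
  by move/cvgrPdist_le : (H i) => /(_ e e0).
apply: filterS => t Ht; apply: row_norm_le => [|i]; first exact: ltW.
by rewrite !mxE.
Qed.

Lemma near_shift_right p v (S : set 'rV[R]_n) : nbhs p S ->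
  \forall h \near (0 : R)^'+, S (p + h *: v).
Proof.
move=> Sp; have : (p + h *: v) @[h --> (0 : R)^'+] --> p.
  rewrite -[X in _ --> X]addr0 -(scale0r v).
  apply: cvgD; first exact: cvg_cst.
  apply: cvgZ; last exact: cvg_cst.
  exact: cvg_at_right_filter cvg_id.
by move=> /(_ _ Sp).
Qed.

Lemma riemann_fun_local U (G G' : 'rV[R]_n -> 'M[R]_n) p : open U -> U p ->
  (forall q, U q -> G q = G' q) ->
  [/\ ricci G p = ricci G' p, scalar_curvature G p = scalar_curvature G' p &
      forall u v, sectional_curvature G p u v = sectional_curvature G' p u v].
Proof.
move=> Uo Up GG.
have RR d c a b : riemann G d c a b p = riemann G' d c a b p by exact: riemann_local Up GG.
have Ric : ricci G p = ricci G' p.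
  apply/matrixP => b c; rewrite [LHS]mxE [RHS]mxE.
  by apply: eq_bigr => a _; rewrite RR.
have Vec u v w : curvature_vec G p u v w = curvature_vec G' p u v w.
  apply/rowP => d; rewrite [LHS]mxE [RHS]mxE; do 3 (apply: eq_bigr => ? _).
  by rewrite RR.
split; [exact: Ric|by rewrite /scalar_curvature (GG p Up) Ric|move=> u v].
by rewrite /sectional_curvature (GG p Up) Vec.
Qed.

End ChartAnalysis.

(** * Charts of a manifold with boundary *)

Section Charts.
Context {R : realType} {n : nat} {M : topologicalType}.
Variables (A : smooth_atlas R n M) (a0 : 'I_n).
Hypothesis a00 : val a0 = 0%N.
Implicit Types (i j : cindex A) (m : M) (p q : 'rV[R]_n).

Lemma first_coord (a : 'I_n) : val a = 0%N -> a = a0.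
Proof. by move=> a_0; apply: val_inj; rewrite a_0 a00. Qed.

Lemma half_spaceP q : @half_space R n q <-> 0 <= q 0 a0.
Proof. by split=> [|q0 a /first_coord ->//]; apply. Qed.

Definition chart_image i : set 'rV[R]_n := cmap i @` cdom i.

Definition chart_interior i : set 'rV[R]_n :=
  chart_image i `&` [set q | 0 < q 0 a0].

Lemma chart_imageP i q : chart_image i q -> cdom i (cinv i q) /\ cmap i (cinv i q) = q.
Proof. by move=> [m im <-]; rewrite cmapK. Qed.

Lemma chart_image_map i m : cdom i m -> chart_image i (cmap i m).
Proof. by exists m. Qed.

Lemma chart_coord_ge0 i m : cdom i m -> 0 <= cmap i m 0 a0.
Proof.
move=> im; have [U [_ UE]] := cimage_open i; apply/half_spaceP.
have : chart_image i (cmap i m) by exact: chart_image_map.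
by rewrite /chart_image UE => -[].
Qed.

Lemma boundary_chart i m : cdom i m -> cmap i m 0 a0 = 0 -> boundary A m.
Proof. by move=> im m0; exists i, a0. Qed.

Lemma interior_coord i m : mfd_interior A m -> cdom i m -> 0 < cmap i m 0 a0.
Proof.
move=> mI im; rewrite lt_neqAle chart_coord_ge0// andbT eq_sym.
by apply/eqP => m0; apply: mI; exact: boundary_chart m0.
Qed.

Lemma open_chart_interior i : open (chart_interior i).
Proof.
have [U [Uo UE]] := cimage_open i.
have -> : chart_interior i = U `&` [set q | 0 < q 0 a0].
  apply/seteqP; split=> q; rewrite /chart_interior /chart_image UE.
    by move=> [[Uq _] q0].
  by move=> [Uq q0]; split=> //; split=> //; apply/half_spaceP; exact: ltW.
by apply: openI => //; exact: open_coord_gt0.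
Qed.

Lemma chart_image_near i m : cdom i m ->
  exists U, [/\ open U, U (cmap i m) & forall q, U q -> 0 <= q 0 a0 -> chart_image i q].
Proof.
move=> im; have [U [Uo UE]] := cimage_open i; exists U; split=> //.
  by have := chart_image_map im; rewrite /chart_image UE => -[].
by move=> q Uq q0; rewrite /chart_image UE; split=> //; exact/half_spaceP.
Qed.

Lemma near_chart i m (S : set 'rV[R]_n) : cdom i m -> nbhs (cmap i m) S ->
  \forall m' \near m, cdom i m' /\ S (cmap i m').
Proof.
move=> im Sm; have io := cdom_open i.
have nd : \forall m' \near m, cdom i m' by exact: open_nbhs_nbhs.
have c : {for m, continuous (cmap i)}.
  have := @cmap_continuous _ _ _ A i; rewrite (continuous_open_subspace _ io) => /(_ m).
  by apply; rewrite inE.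
by apply: filterI nd (c _ Sm).
Qed.

Lemma near_cinv i q (D : set M) : chart_image i q -> open D -> D (cinv i q) ->
  \forall q' \near q, chart_image i q' -> D (cinv i q').
Proof.
move=> iq Do Dq.
have /subspace_continuousP/(_ q iq) H := @cinv_continuous _ _ _ A i.
by have := H D (open_nbhs_nbhs (conj Do Dq)).
Qed.

Definition transition i j q : 'rV[R]_n := cmap j (cinv i q).

(** At an interior point the local extensions of the components of a
    transition map coincide with it on a common open neighbourhood. *)
Lemma transition_nbhd i j m : cdom i m -> cdom j m -> 0 < cmap i m 0 a0 ->
  exists V, [/\ open V, V (cmap i m), V `<=` chart_interior i,
    forall q, V q -> cdom j (cinv i q) &
    forall k (a : 'I_n), C_open k V (fun q => transition i j q 0 a)].
Proof.
move=> im jm m0; set p := cmap i m.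
have pI : chart_interior i p by split=> //; exact: chart_image_map.
have sm a : exists UF : set 'rV[R]_n * ('rV[R]_n -> R),
    [/\ open UF.1, UF.1 p, forall k, C_open k UF.1 UF.2 &
     forall q, (cmap i @` (cdom i `&` cdom j)) q -> UF.1 q ->
       UF.2 q = transition i j q 0 a].
  have [|U [F [Uo Up CF FE]]] := @ctransition_smooth _ _ _ A i j a p.
    by exists m.
  by exists (U, F).
have [UF UFP] := choice sm.
pose V0 := [set q | [/\ chart_interior i q, cdom j (cinv i q) & forall a, (UF a).1 q]].
have nV0 : \forall q \near p, V0 q.
  have n1 : \forall q \near p, chart_interior i q.
    by apply: open_nbhs_nbhs; split=> //; exact: open_chart_interior.
  have n2 : \forall q \near p, chart_image i q -> cdom j (cinv i q).
    apply: near_cinv; [exact: chart_image_map|exact: cdom_open|].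
    by rewrite cmapK.
  have n3 : \forall q \near p, forall a, (UF a).1 q.
    apply: (@filter_forall _ _ (fun a => (UF a).1) (nbhs p)) => a.
    by apply: open_nbhs_nbhs; have [? ? _ _] := UFP a.
  apply: filterS3 n1 n2 n3 => q h1 h2 h3; split=> //.
  by apply: h2; case: h1.
exists (V0°); split.
- exact: open_interior.
- exact: nV0.
- by move=> q /interior_subset[].
- by move=> q /interior_subset[].
move=> k a; have [Uo Up CF FE] := UFP a.
apply: (@C_open_ext R n k (V0°) (UF a).2 _ (@open_interior _ V0)).
  move=> q /interior_subset[[iq _] jq Uq]; apply: FE => //.
  by have [ic iK] := chart_imageP iq; exists (cinv i q).
by apply: C_open_sub (CF k) => q /interior_subset[].
Qed.

(** Invariance of the boundary: where a transition map takes an interior point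
    of the half-space to its boundary, the first component has a minimum, so
    the Jacobian has a zero row and cannot be invertible. *)
Lemma coord_interior i m : cdom i m -> 0 < cmap i m 0 a0 -> mfd_interior A m.
Proof.
move=> im m0 [j [a [jm /first_coord -> bm]]].
have [V [Vo Vp VI Vj CV]] := transition_nbhd im jm m0.
set p := cmap i m in m0 Vp; set Phi := transition i j.
have Pp : Phi p = cmap j m by rewrite /Phi /transition cmapK.
have dPhi k b : derivable (fun q => Phi q 0 k) p (evec R b).
  exact: C_open_derivable (CV 1 k) Vp.
(* the first component is nonnegative and vanishes at m *)
have min b : 'D_(evec R b) (fun q => Phi q 0 a0) p = 0.
  have [r r0 rV] := nbhs_ballP_open Vo Vp.
  have le (s eps : R) : 0 < eps -> exists h, [/\ 0 < h, h < eps &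
      Phi p 0 a0 <= Phi (p + (s * h) *: evec R b) 0 a0] \/ ~~ (`|s| <= 1).
    move=> e0; have [s1|] := boolP (`|s| <= 1); last by exists 0; right.
    pose h := Num.min r eps / 2.
    have m1 : 0 < Num.min r eps by rewrite lt_min r0 e0.
    have h0 : 0 < h by rewrite divr_gt0.
    have hm : h < Num.min r eps by rewrite /h; lra.
    have hr : h < r by apply: lt_le_trans hm _; rewrite ge_min lexx.
    have he : h < eps by apply: lt_le_trans hm _; rewrite ge_min lexx orbT.
    exists h; left; split=> //; rewrite Pp bm; apply: chart_coord_ge0; apply: Vj.
    apply: rV; rewrite addrC addKr; apply: le_lt_trans (norm_scale_evec _ _) _.
    rewrite normrM (gtr0_norm h0); apply: le_lt_trans hr.
    by rewrite ler_piMl// ltW.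
  apply/eqP; rewrite eq_le; apply/andP; split.
    apply: (derive_sign_le0 (dPhi a0 b)) => eps /(le (-1))[h [[h0 he]|]].
      by rewrite mulN1r scaleNr => H; exists h.
    by rewrite normrN normr1 lexx.
  apply: (derive_sign_ge0 (dPhi a0 b)) => eps /(le 1)[h [[h0 he]|]].
    by rewrite mul1r => H; exists h.
  by rewrite normr1 lexx.
have sm b : exists UF : set 'rV[R]_n * ('rV[R]_n -> R),
    [/\ open UF.1, UF.1 (Phi p), C_open 1 UF.1 UF.2 &
     forall q, (cmap j @` (cdom j `&` cdom i)) q -> UF.1 q ->
       UF.2 q = transition j i q 0 b].
  have [|U [F [Uo Up CF FE]]] := @ctransition_smooth _ _ _ A j i b (Phi p).
    by exists m.
  by exists (U, F).
have [UF UFP] := choice sm.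
pose JPhi : 'M[R]_n := \matrix_(k, b) 'D_(evec R b) (fun q => Phi q 0 k) p.
pose JPsi : 'M[R]_n := \matrix_(b, k) 'D_(evec R k) (UF b).2 (Phi p).
(* JPsi uses an extension of the inverse transition map across the boundary,
   which agrees with it on the image of V *)
have JJ : JPsi *m JPhi = 1%:M.
  apply/matrixP => b c; rewrite mxE.
  have [Uo Up CF FE] := UFP b.
  have [_ D] := chain_rule Uo Up CF (fun k => dPhi k c).
  transitivity ('D_(evec R c) (fun q => (UF b).2 (Phi q)) p).
    by rewrite D; apply: eq_bigr => k _; rewrite !mxE mulrC.
  transitivity ('D_(evec R c) (fun q : 'rV[R]_n => q 0 b) p).
    apply: near_eq_derive.
    have nV : \forall q \near p, V q by exact: open_nbhs_nbhs.
    have cPhi : Phi q @[q --> p] --> Phi p.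
      apply: (@row_cvg _ _ _ (nbhs p) (nbhs_filter p) Phi (Phi p)) => k.
      exact: C_open_continuous (CV 0%N k) Vp.
    have nU : \forall q \near p, (UF b).1 (Phi q).
      by apply: cPhi; exact: open_nbhs_nbhs.
    apply: filterS2 nV nU => q Vq Uq.
    have [[iq _] jq] := (VI q Vq, Vj q Vq).
    have [ic iK] := chart_imageP iq.
    rewrite FE//; last by exists (cinv i q).
    by rewrite /Phi /transition cmapK// iK.
  by rewrite (@derive_val _ _ _ _ _ _ _ (is_derive_coord p b c)) mxE.
have /matrixP/(_ a0 a0) := mulmx1C JJ.
rewrite !mxE eqxx big1 => [/eqP|k _]; first by rewrite eq_sym oner_eq0.
by rewrite mxE min mul0r.
Qed.

End Charts.

(** * Metrics and defining functions in charts *)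

Section Manifold.
Context {R : realType} {n : nat} {M : topologicalType}.
Variables (A : smooth_atlas R n M) (a0 : 'I_n).
Hypothesis a00 : val a0 = 0%N.
Implicit Types (i j : cindex A) (m : M) (p q : 'rV[R]_n).

Let chart_interior i := chart_interior a0 i.

Lemma chart_interior_interior i q : chart_interior i q -> mfd_interior A (cinv i q).
Proof.
move=> [/chart_imageP[ic iK] q0]; apply: (coord_interior a00 ic).
by rewrite iK.
Qed.

Lemma chart_metric_on (g : cindex A -> M -> 'M[R]_n) i :
  riemannian_metric 2 (mfd_interior A) g ->
  metric_on 2 (chart_interior i) (chart_metric g i) /\
  forall q, chart_interior i q -> forall w, w != 0 -> 0 < bilin (chart_metric g i q) w w.
Proof.
move=> [gC gs gp _].
have pos q : chart_interior i q ->
    forall w, w != 0 -> 0 < bilin (chart_metric g i q) w w.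
  move=> iq; have [[ic _] q0] := (chart_imageP iq.1, iq.2).
  exact: gp (chart_interior_interior iq) ic.
split=> //; split.
- move=> a b; apply: C_on_open (gC i a b); first exact: open_chart_interior.
  move=> q iq; have [ic iK] := chart_imageP iq.1.
  by exists (cinv i q) => //; split=> //; exact: chart_interior_interior.
- move=> q iq; have [ic _] := chart_imageP iq.1.
  exact: gs (chart_interior_interior iq) ic.
- by move=> q iq; apply: posdef_unit; exact: pos.
Qed.

(** The transition map is a diffeomorphism of open sets near an interior
    point, so sectional_pullback applies. *)
Lemma sectional_invariance (g : cindex A -> M -> 'M[R]_n) i j m :
  riemannian_metric 2 (mfd_interior A) g -> mfd_interior A m ->
  cdom i m -> cdom j m ->
  exists2 J : 'M[R]_n, J \in unitmx & forall u v,
    sectional_curvature_at g i m u v =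
    sectional_curvature_at g j m (u *m J^T) (v *m J^T).
Proof.
move=> gm mI im jm.
have m0 := interior_coord a00 mI im.
have [V [Vo Vp VI Vj CV]] := transition_nbhd a00 im jm m0.
have [mGi posi] := chart_metric_on i gm.
have [mGj _] := chart_metric_on j gm.
have VjI q : V q -> chart_interior j (transition i j q).
  move=> Vq; split; first exact: chart_image_map (Vj q Vq).
  have := interior_coord a00 (chart_interior_interior (VI q Vq)) (Vj q Vq).
  exact.
have GH q : V q -> chart_metric g i q = (jacobian_mx (transition i j) q)^T
    *m chart_metric g j (transition i j q) *m jacobian_mx (transition i j) q.
  move=> Vq; have [ic iK] := chart_imageP (VI q Vq).1.
  have jc := Vj q Vq.
  have -> : jacobian_mx (transition i j) q = transition_jacobian i j (cinv i q).
    apply/matrixP => k b; rewrite [LHS]mxE [RHS]mxE iK; apply/esym.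
    apply: partial_right_derive => //; first exact: C_open_derivable (CV 1%N k) Vq.
    by near=> h.
  have [_ _ _ gt] := gm.
  rewrite /chart_metric /transition cmapK//.
  exact: gt (chart_interior_interior (VI q Vq)) ic jc.
have mG : metric_on 2 V (chart_metric g i) := metric_on_sub VI mGi.
have Uo : open (chart_interior j) by exact: open_chart_interior.
exists (jacobian_mx (transition i j) (cmap i m)).
  have : chart_metric g i (cmap i m) \in unitmx by case: mG => _ _; apply.
  by rewrite GH// unitmx_mul => /andP[].
move=> u v; rewrite /sectional_curvature_at.
rewrite (sectional_pullback Vo Uo VjI (fun k => CV 3%N k) mG mGj GH u v Vp).
by rewrite /transition cmapK.
Unshelve. all: by end_near. Qed.

(** The image of a chart is relatively open in the half-space, so it contains
    a half-ball around each of its points, and the extension provided at the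
    centre serves on all of it. *)
Lemma smooth_extension (f : M -> R) i m : smooth_fun A f -> cdom i m ->
  exists F, exists2 rho : R, 0 < rho &
    (forall k, C_open k [set q | `|q - cmap i m| < rho] F) /\
    forall q, `|q - cmap i m| < rho -> 0 <= q 0 a0 ->
      chart_image i q /\ F q = f (cinv i q).
Proof.
move=> fs im; set p := cmap i m.
have ip : chart_image i p := chart_image_map im.
have [U [F [Uo Up CF FE]]] := fs i p ip.
have [U' [Uo' Up' UI]] := chart_image_near a00 im.
have UUo : open (U `&` U') by exact: openI.
have [r r0 rU] := nbhs_ballP_open UUo (conj Up Up').
exists F, r => //; split=> [k|q qr q0].
  by apply: C_open_sub (CF k) => q /rU[].
have [Uq Uq'] := rU q qr; have iq := UI q Uq' q0.
by split=> //; exact: FE.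
Qed.

Lemma partial_right_extension (f : M -> R) F i m (rho : R) (b : 'I_n) q :
  C_open 1 [set q | `|q - cmap i m| < rho] F ->
  (forall q, `|q - cmap i m| < rho -> 0 <= q 0 a0 ->
      chart_image i q /\ F q = f (cinv i q)) ->
  `|q - cmap i m| < rho -> 0 <= q 0 a0 ->
  partial_right b (fun p => f (cinv i p)) q = 'D_(evec R b) F q.
Proof.
move=> CF FE qr q0; apply: partial_right_derive.
- exact: C_open_derivable CF qr.
- by have [_ ->] := FE q qr q0.
have Wo : open [set q : 'rV[R]_n | `|q - cmap i m| < rho] by exact: open_norm_ball.
have nq := open_nbhs_nbhs (conj Wo qr).
near=> h.
have h0 : 0 < h by near: h; exact: nbhs_right_gt.
have [_ ->//] : chart_image i (q + h *: evec R b) /\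
    F (q + h *: evec R b) = f (cinv i (q + h *: evec R b)).
apply: FE; first by near: h; exact: near_shift_right nq.
by rewrite mxE [X in _ + X]mxE evecE addr_ge0// mulr_ge0// ltW.
Unshelve. all: by end_near. Qed.

Lemma defining_function_ge0 (x : M -> R) m : defining_function A x -> 0 <= x m.
Proof.
move=> [_ xp xb _]; have [/xb -> //|/xp/ltW//] := pselect (boundary A m).
Qed.

(** At a boundary point the differential of a defining function is a positive
    multiple of that of the first coordinate: the tangential derivatives
    vanish, and the normal one is nonnegative and nonzero. The mean value
    theorem along normal segments then compares the two functions. *)
Lemma defining_function_coord (x : M -> R) i m : defining_function A x ->
  cdom i m -> cmap i m 0 a0 = 0 ->
  exists2 C : R, 1 <= C & nbhs (cmap i m) [set q : 'rV[R]_n | 0 <= q 0 a0 ->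
    x (cinv i q) <= C * q 0 a0 /\ q 0 a0 <= C * x (cinv i q)].
Proof.
move=> xdef im m0; have [xs xp xb xd] := xdef; set p := cmap i m.
have [F [rho rho0 [CF FE]]] := smooth_extension xs im.
set W := [set q | _] in CF.
have Wo : open W by exact: open_norm_ball.
have Wp : W p by rewrite /W/= subrr normr0.
have F0 q : W q -> q 0 a0 = 0 -> F q = 0.
  move=> Wq q0; have [|iq ->] := FE q Wq; first by rewrite q0.
  have [ic iK] := chart_imageP iq.
  by apply: xb; apply: (boundary_chart a00 ic); rewrite iK.
have dF b q : W q -> derivable F q (evec R b) by exact: C_open_derivable (CF 1%N).
have inW b : exists2 d : R, 0 < d & forall h, 0 < h -> h < d -> W (p + h *: evec R b).
  exists rho => // h h0 hr; rewrite /W/= addrC addKr.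
  by apply: le_lt_trans (norm_scale_evec _ _) _; rewrite gtr0_norm.
have tangential b : b != a0 -> 'D_(evec R b) F p = 0.
  move=> ba; apply: derive_right_eq (dF b p Wp) _ => eps eps0.
  have [d d0 Hd] := inW b; exists d => // h h0 hd.
  rewrite mulr0 subr0 !F0 ?subrr ?normr0 ?mulr_ge0 ?ltW//; first exact: Hd.
  by rewrite mxE [X in _ + X]mxE evecE eq_sym (negbTE ba) mulr0 addr0.
pose D := 'D_(evec R a0) F p.
have D0 : 0 <= D.
  apply: derive_sign_ge0 (dF a0 p Wp) _ => eps eps0.
  have [d d0 Hd] := inW a0; pose h := Num.min d eps / 2.
  have m1 : 0 < Num.min d eps by rewrite lt_min d0 eps0.
  have h0 : 0 < h by rewrite divr_gt0.
  have hm : h < Num.min d eps by rewrite /h; lra.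
  have hd : h < d by apply: lt_le_trans hm _; rewrite ge_min lexx.
  have he : h < eps by apply: lt_le_trans hm _; rewrite ge_min lexx orbT.
  exists h; split=> //; rewrite F0//.
  have [|_ ->] := FE _ (Hd h h0 hd); last exact: defining_function_ge0.
  by rewrite mxE [X in _ + X]mxE evecE eqxx mulr1 m0 add0r ltW.
have Dpos : 0 < D.
  rewrite lt_neqAle D0 andbT eq_sym; apply/eqP => DE.
  have mB : boundary A m by exact: boundary_chart im m0.
  have /eqP := xd m i mB im; apply; apply/rowP => b; rewrite [LHS]mxE [RHS]mxE.
  rewrite (partial_right_extension b (CF 1%N) FE Wp) ?m0//.
  by have [->|] := eqVneq b a0; [exact: DE|exact: tangential].
have cD : {for p, continuous (fun q => 'D_(evec R a0) F q)}.
  exact: C_open_continuous (C_open_derive a0 (CF 1%N)) Wp.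
have D2 : 0 < D / 2 by rewrite divr_gt0.
have nD : \forall q \near p, `|D - 'D_(evec R a0) F q| < D / 2.
  by move/cvgrPdist_lt : cD => /(_ _ D2).
have [r r0 Hr] := nbhs_norm_ball (filterI (open_nbhs_nbhs (conj Wo Wp)) nD).
pose C := 1 + 2 * D + 2 / D.
have iD : 0 < 2 / D by rewrite divr_gt0.
exists C; first by rewrite /C; lra.
have nr : \forall q \near p, `|q - p| < r by exact: ball_open_nbhs.
apply: filterS nr => q qr q0.
have inr t : 0 <= t <= q 0 a0 -> `|foot a0 q + t *: evec R a0 - p| < r.
  by move=> tq; exact: le_lt_trans (foot_dist m0 tq) qr.
have [t tq E] := @MVT_line_ge0 R n F (foot a0 q) (evec R a0) (q 0 a0) q0
  (fun t tq => dF a0 _ (Hr _ (inr t tq)).1).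
rewrite footK in E.
have Wf : W (foot a0 q).
  by have [] := Hr _ (inr 0 _); rewrite ?lexx ?q0// scale0r addr0.
rewrite (F0 _ Wf (foot0 a0 q)) subr0 in E.
have [_ /=] := Hr _ (inr t tq); rewrite ltr_norml => /andP[lo hi].
have Wq : W q by have [] := Hr q qr.
have [_ FqE] := FE q Wq q0.
rewrite -FqE E; move: lo hi; set d := 'D_(evec R a0) F _ => lo hi.
split; first by rewrite mulrC; apply: ler_wpM2r => //; rewrite /C; lra.
have dD : D / 2 <= d by lra.
have : (2 / D) * (q 0 a0 * (D / 2)) <= C * (q 0 a0 * d).
  apply: ler_pM; [exact: ltW|by rewrite mulr_ge0// ltW|by rewrite /C; lra|].
  exact: ler_wpM2l.
by apply: le_trans; rewrite le_eqVlt; apply/orP; left; apply/eqP; field; rewrite gt_eqF.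
Qed.

End Manifold.

(** * The global estimate *)

Section GlobalEstimate.
Context {R : realType} {n : nat} {M : topologicalType}.
Variables (A : smooth_atlas R n M) (g : cindex A -> M -> 'M[R]_n) (x : M -> R).
Variables (a0 : 'I_n).
Hypotheses (a00 : val a0 = 0%N) (n2 : (2 <= n)%N).
Hypothesis g_metric : riemannian_metric 2 (mfd_interior A) g.
Hypothesis x_def : defining_function A x.
Implicit Types (i j : cindex A) (m : M) (p q : 'rV[R]_n).

(** One chart is enough, as the bound passes to all the others; each
    neighbourhood below can then be studied in a single chart. *)
Definition sectional_bound_at (C : R) m : Prop :=
  exists2 i, cdom i m & forall u v : 'rV[R]_n, row_free (col_mx u v) ->
    `|sectional_curvature_at g i m u v + 1| <= C * x m ^+ 2.

Lemma sectional_bound_every_chart (C : R) m : mfd_interior A m ->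
  sectional_bound_at C m -> forall i, cdom i m ->
  forall u v : 'rV[R]_n, row_free (col_mx u v) ->
    `|sectional_curvature_at g i m u v + 1| <= C * x m ^+ 2.
Proof.
move=> mI [j jm bound] i im u v uv.
have [J Ju ->] := sectional_invariance a00 g_metric mI im jm.
apply: bound; rewrite -mul_col_mx /row_free mxrankMfree ?row_free_unit ?unitmx_tr//.
Qed.

(** Near an interior point x is bounded away from 0, so boundedness of the
    curvature suffices. *)
Lemma interior_local_bound i m0 : cdom i m0 -> 0 < cmap i m0 0 a0 ->
  exists2 C : R, 0 <= C & \forall m \near m0, mfd_interior A m -> sectional_bound_at C m.
Proof.
move=> im m00; have [xs xp _ _] := x_def; set p := cmap i m0 in m00.
have [mG posG] := chart_metric_on a00 i g_metric.
have ip : chart_interior a0 i p by split=> //; exact: chart_image_map.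
have Io : open (chart_interior a0 i) by exact: open_chart_interior.
have [K K0 nK] := interior_estimate n2 Io ip mG posG.
have [F [rho rho0 [CF FE]]] := smooth_extension a00 xs im.
have Wp : `|p - p| < rho by rewrite subrr normr0.
have mI : mfd_interior A m0 := coord_interior a00 im m00.
have xm0 : 0 < x m0 by exact: xp.
have Fp : F p = x m0.
  by have [_ ->] := FE p Wp (ltW m00); rewrite cmapK.
have cF : {for p, continuous F} by exact: C_open_continuous (CF 0%N) Wp.
pose c := x m0 / 2; have c0 : 0 < c by rewrite divr_gt0.
have nF : \forall q \near p, `|F p - F q| < c.
  by move/cvgrPdist_lt : cF => /(_ _ c0).
have nW : nbhs p [set q : 'rV[R]_n | `|q - p| < rho] by exact: ball_open_nbhs.
exists (K / c ^+ 2); first by rewrite divr_ge0// sqr_ge0.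
apply: filterS (near_chart im (filterI nK (filterI nF nW))) => m [imm [HK [HF HW]]] mIm.
exists i => // u v uv; apply: le_trans (HK u v uv) _.
have [|_ Fm] := FE _ HW; first exact: chart_coord_ge0.
rewrite cmapK// in Fm.
have cx : c <= x m.
  by move: HF; rewrite Fm Fp ltr_norml => /andP[_]; rewrite /c; lra.
rewrite mulrAC ler_pdivlMr ?exprn_gt0//; apply: ler_wpM2l => //.
by rewrite ler_pXn2r// nnegrE ltW// (lt_le_trans c0).
Qed.

(** In a chart, the compactified metric and its defining function y extend to
    a ball, where boundary_estimate applies. The function x enters only
    through its comparability with the first coordinate t, once to restate
    o(x) as o(t) and once to replace t^2 by x^2 in the conclusion. *)
Lemma boundary_local_bound i m0 (y : M -> R) gbar :
  compactification 2 g y gbar ->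
  (forall i m, boundary A m -> cdom i m ->
     bilin (invmx (gbar i m)) (differential y i m) (differential y i m) = 1) ->
  (forall i m, mfd_interior A m -> cdom i m -> forall v : 'rV[R]_n,
     - (n%:R - 1) * bilin (g i m) v v <= bilin (ricci_at g i m) v v) ->
  (forall eps : R, 0 < eps -> exists2 delta : R, 0 < delta &
     forall i m, mfd_interior A m -> cdom i m -> x m < delta ->
       `|scalar_curvature_at g i m + n%:R * (n%:R - 1)| <= eps * x m) ->
  cdom i m0 -> cmap i m0 0 a0 = 0 ->
  exists2 C : R, 0 <= C & \forall m \near m0, mfd_interior A m -> sectional_bound_at C m.
Proof.
move=> [ydef gbar_metric gbarE] AH Hric Hscal im m00; set p := cmap i m0 in m00.
have [ys yp yb _] := ydef; have [gbC gbs gbp _] := gbar_metric.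
have ip : chart_image i p := chart_image_map im.
have mB : boundary A m0 := boundary_chart a00 im m00.
(* each entry of gbar comes with its own extension; they are restricted to a
   common ball where the matrix stays invertible *)
have ext (ab : 'I_n * 'I_n) : exists UF : set 'rV[R]_n * ('rV[R]_n -> R),
    [/\ open UF.1, UF.1 p, C_open 2 UF.1 UF.2 & forall q, chart_image i q ->
       UF.1 q -> UF.2 q = gbar i (cinv i q) ab.1 ab.2].
  have [|U [F [Uo Up CF FE]]] := gbC i ab.1 ab.2 p; first by exists m0.
  exists (U, F); split=> // q iq Uq; apply: FE => //.
  by have [ic iK] := chart_imageP iq; exists (cinv i q).
have [UF UFP] := choice ext.
pose G q : 'M[R]_n := \matrix_(a, b) (UF (a, b)).2 q.
have GE q : chart_image i q -> (forall ab, (UF ab).1 q) -> G q = gbar i (cinv i q).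
  move=> iq Uq; apply/matrixP => a b; rewrite mxE.
  by have [_ _ _ ->] := UFP (a, b).
have nU : nbhs p [set q | forall ab, (UF ab).1 q].
  apply: (@filter_forall _ _ (fun ab => (UF ab).1) (nbhs p)) => ab.
  by apply: open_nbhs_nbhs; have [? ? _ _] := UFP ab.
have Up : forall ab, (UF ab).1 p := nbhs_singleton nU.
have CG ab : {for p, continuous (fun q => G q ab.1 ab.2)}.
  have [Uo Uab CF _] := UFP ab; have := C_open_continuous CF Uab.
  have -> : (fun q => G q ab.1 ab.2) = (UF ab).2.
    by apply/funext => q; rewrite mxE -surjective_pairing.
  by [].
have [r1 r10 Hr1] := nbhs_norm_ball nU.
pose W1 := [set q : 'rV[R]_n | `|q - p| < r1].
have W1o : open W1 by exact: open_norm_ball.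
have W1p : W1 p by rewrite /W1/= subrr normr0.
have CG1 : mxC 2 W1 G.
  move=> a b; under eq_fun do rewrite mxE.
  by have [Uo _ CF _] := UFP (a, b); apply: C_open_sub CF => q /Hr1; exact.
have Gp : G p = gbar i m0 by rewrite GE// cmapK.
have detp : \det (G p) != 0.
  have : G p \in unitmx.
    by apply: posdef_unit => w w0; rewrite Gp; exact: gbp.
  by rewrite unitmxE unitfE.
have ndet : \forall q \near p, \det (G q) != 0.
  have cdet : {for p, continuous (fun q => \det (G q))}.
    exact: C_open_continuous (C_open_det W1o CG1) W1p.
  have := cdet; move=> /cvgrPdist_lt/(_ `|\det (G p)|).
  rewrite normr_gt0 => /(_ detp); apply: filterS => q.
  by apply: contraTneq => ->; rewrite subr0 ltxx.
have [F [rho1 rho10 [CF FE]]] := smooth_extension a00 ys im.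
have [Cx Cx1 nx] := defining_function_coord a00 x_def im m00.
have [rho rho0 Hrho] := nbhs_norm_ball (filterI (open_nbhs_nbhs (conj W1o W1p))
  (filterI ndet (filterI (ball_open_nbhs p rho10) nx))).
pose W := [set q : 'rV[R]_n | `|q - p| < rho].
have WW1 : W `<=` W1 by move=> q /Hrho[].
have bd q : W q -> 0 <= q 0 a0 ->
    [/\ chart_image i q, G q = gbar i (cinv i q) & F q = y (cinv i q)].
  move=> Wq q0; have [W1q [_ [Wrho _]]] := Hrho q Wq.
  by have [iq Fq] := FE q Wrho q0; split=> //; apply: GE => //; exact: Hr1.
have inside q : W q -> 0 < q 0 a0 -> [/\ mfd_interior A (cinv i q),
    cdom i (cinv i q), cmap i (cinv i q) = q & chart_metric g i q = conformal G F q].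
  move=> Wq q0; have [iq Gq Fq] := bd q Wq (ltW q0).
  have [ic iK] := chart_imageP iq.
  have mI : mfd_interior A (cinv i q) by apply: (coord_interior a00 ic); rewrite iK.
  split=> //; rewrite /conformal Gq Fq gbarE// scalerA mulVf ?scale1r//.
  by rewrite expf_neq0// gt_eqF// yp.
pose V := W `&` [set q : 'rV[R]_n | 0 < q 0 a0].
have Vo : open V by apply: openI; [exact: open_norm_ball|exact: open_coord_gt0].
have loc q : W q -> 0 < q 0 a0 -> [/\ ricci (chart_metric g i) q = ricci (conformal G F) q,
    scalar_curvature (chart_metric g i) q = scalar_curvature (conformal G F) q &
    forall u v, sectional_curvature (chart_metric g i) q u v =
      sectional_curvature (conformal G F) q u v].
  move=> Wq q0; apply: (riemann_fun_local Vo (conj Wq q0)) => z [Wz z0].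
  by have [_ _ _] := inside z Wz z0.
have [C C0 [r2 r20 Hr2]] : exists2 C : R, 0 <= C & exists2 rho' : R, 0 < rho' &
    forall q, `|q - p| < rho' -> 0 < q 0 a0 -> forall u v, row_free (col_mx u v) ->
      `|sectional_curvature (conformal G F) q u v + 1| <= C * q 0 a0 ^+ 2.
  apply: (@boundary_estimate R n a0 p rho G F n2 rho0 m00).
  - exact: mxC_sub WW1 CG1.
  - by move=> q /Hrho[_ [dq _]]; rewrite unitmxE unitfE.
  - by apply: C_open_sub (CF 3%N) => q /Hrho[_ [_ []]].
  - move=> q Wq q0; have [mI ic iK _] := inside q Wq q0.
    have [iq -> ->] := bd q Wq (ltW q0).
    by split; [exact: gbs|exact: gbp|exact: yp].
  - move=> q Wq q0; have [|iq Gq Fq] := bd q Wq; first by rewrite q0.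
    have [ic iK] := chart_imageP iq.
    have qB : boundary A (cinv i q).
      by apply: (boundary_chart a00 ic); rewrite iK.
    split; first by rewrite Fq yb.
    have dE : grad_covector F q = differential y i (cinv i q).
      apply/rowP => b; rewrite [LHS]mxE [RHS]mxE iK; apply/esym.
      have [_ [_ [Wrho _]]] := Hrho q Wq.
      by apply: (partial_right_extension b (CF 1%N) FE Wrho); rewrite q0.
    by rewrite /grad_norm2 dE Gq; exact: AH.
  - move=> q Wq q0 w; have [mI ic iK E] := inside q Wq q0.
    have [Ric _ _] := loc q Wq q0; rewrite -Ric -E.
    by have := Hric i _ mI ic w; rewrite /ricci_at iK.
  - move=> eps eps0.
    have Cx0 : 0 < Cx by lra.
    have [d d0 Hd] := Hscal (eps / Cx) (divr_gt0 eps0 Cx0).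
    exists (d / Cx); first exact: divr_gt0.
    move=> q Wq q0 qd; have [mI ic iK _] := inside q Wq q0.
    have [_ Sc _] := loc q Wq q0; rewrite -Sc.
    have [_ [_ [_ /(_ (ltW q0))[xq _]]]] := Hrho q Wq.
    have xd : x (cinv i q) < d.
      by apply: le_lt_trans xq _; rewrite mulrC -ltr_pdivlMr.
    have := Hd i _ mI ic xd; rewrite /scalar_curvature_at iK => /le_trans; apply.
    rewrite mulrAC ler_pdivrMr// -mulrA [q 0 a0 * _]mulrC.
    by apply: ler_wpM2l xq; exact: ltW.
exists (C * Cx ^+ 2); first by rewrite mulr_ge0// sqr_ge0.
have nr2 : nbhs p [set q : 'rV[R]_n | `|q - p| < r2] by exact: ball_open_nbhs.
have nrho : nbhs p W by exact: ball_open_nbhs.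
apply: filterS (near_chart im (filterI nr2 nrho)) => m [imm [Hm Wm]] mI.
have q0 := interior_coord a00 mI imm.
exists i => // u v uv; rewrite /sectional_curvature_at.
have [_ _ ->] := loc _ Wm q0; apply: le_trans (Hr2 _ Hm q0 u v uv) _.
have [_ [_ [_ /(_ (ltW q0))[_ qx]]]] := Hrho _ Wm.
rewrite cmapK// in qx.
rewrite -mulrA; apply: ler_wpM2l => //; rewrite -exprMn.
by rewrite ler_pXn2r// nnegrE ltW// (lt_le_trans q0).
Qed.

End GlobalEstimate.

Theorem lemma1p6 (R : realType) (n : nat) (M : topologicalType)
    (A : smooth_atlas R n M) (g : cindex A -> M -> 'M[R]_n) (x : M -> R)
    (M_hausdorff : hausdorff_space M)
    (M_compact : compact [set: M])
    (g_metric : riemannian_metric 2 (mfd_interior A) g)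
    (g_AH : asymptotically_hyperbolic 2 g)
    (x_def : defining_function A x)
    (g_ric : forall (i : cindex A) (m : M), mfd_interior A m -> cdom i m ->
      forall v : 'rV[R]_n,
        - (n%:R - 1) * bilin (g i m) v v <= bilin (ricci_at g i m) v v)
    (g_scal : forall eps : R, 0 < eps -> exists2 delta : R, 0 < delta &
      forall (i : cindex A) (m : M), mfd_interior A m -> cdom i m ->
        x m < delta ->
        `|scalar_curvature_at g i m + n%:R * (n%:R - 1)| <= eps * x m) :
  exists C0 : R, forall (i : cindex A) (m : M),
    mfd_interior A m -> cdom i m ->
    forall u v : 'rV[R]_n, row_free (col_mx u v) ->
      `|sectional_curvature_at g i m u v + 1| <= C0 * x m ^+ 2.
Proof.
have [n2|n1] := leqP 2 n; last first.
  (* no two vectors are linearly independent *)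
  exists 0 => i m _ _ u v /eqP uv.
  by have := rank_leq_col (col_mx u v); rewrite uv leqNgt n1.
pose a0 : 'I_n := Ordinal (leq_trans (isT : (0 < 2)%N) n2).
have a00 : val a0 = 0%N by [].
have [y [gbar [comp AH]]] := g_AH.
have loc (m0 : M) : exists2 C : R, 0 <= C &
    \forall m \near m0, mfd_interior A m -> sectional_bound_at g x C m.
  have [i im] := @cdom_cover _ _ _ A m0.
  have [m00|m00] := eqVneq (cmap i m0 0 a0) 0.
    exact (boundary_local_bound a00 n2 x_def comp AH g_ric g_scal im m00).
  refine (interior_local_bound a00 n2 g_metric x_def im _).
  by rewrite lt_neqAle eq_sym m00 (chart_coord_ge0 a00 im).
pose P (C : R) (m : M) := mfd_interior A m -> sectional_bound_at g x C m.
have [C HC] : exists C : R, forall m, P C m.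
  (* P C m is monotone in C, so by compactness it holds for all m as C tends
     to infinity *)
  have /compact_near_coveringP/(_ R (pinfty_nbhs R) P _) cover := M_compact.
  have [|C [_ HC]] := cover.
    move=> m0 _; have [C C0 nC] := loc m0.
    exists ([set m | P C m], [set D : R | C < D]).
      split; [exact: nC|exists C; split=> //; exact: num_real].
    move=> [m D] [/= PC CD] mI; have [i im bound] := PC mI.
    exists i => // u v uv; apply: le_trans (bound u v uv) _.
    by rewrite ler_wpM2r ?sqr_ge0// ltW.
  by exists (C + 1) => m; apply: HC => //; rewrite ltrDl.
exists C => i m mI im u v uv.
exact (sectional_bound_every_chart a00 g_metric mI (HC m mI) im uv).
Qed.
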